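(* Let $\mathcal{VB}$ and $\mathcal{VB}^1$ be as defined in the context. Then, as $x \to \infty$, $$ \#((\mathcal{VB} \setminus \mathcal{VB}^1) \cap [1,x]) \ll x^{\frac{2}{5}+o(1)}.$$ In particular $\#(\mathcal{VB} \cap [1,x]) \sim \#(\mathcal{VB}^1 \cap [1,x])$, and $$ \#(\mathcal{VB} \cap [1,x]) \sim \frac{\zeta(3/2)}{\zeta(3)} \sqrt{x}.$$
   Context: For integers $N \geq 0$, $H \geq 1$, the interval $\{N+1,\dots,N+H\}$ has product $(N+1)\cdots(N+H)$. A natural number is powerful if every prime dividing it divides it at least twice. The interval is called very bad if its product is powerful. $\mathcal{VB}$ is the set of natural numbers contained in at least one very bad interval, and $\mathcal{VB}^1$ is the set of powerful numbers. $\zeta$ is the Riemann zeta function. $X \ll Y$ means $|X|\le CY$ for an absolute constant $C$; $o(1)$ denotes a quantity tending to $0$ as $x \to \infty$; $X\sim Y$ means $X = (1+o(1))Y$. *)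

(* Defs.v *)
From mathcomp Require Import all_boot all_order all_algebra finmap.
From mathcomp Require Import all_classical all_reals all_analysis.

Set Implicit Arguments.
Unset Strict Implicit.
Unset Printing Implicit Defensive.

Import Order.TTheory GRing.Theory Num.Theory.
Import numFieldNormedType.Exports.

Local Open Scope classical_set_scope.
Local Open Scope ring_scope.

(* The Landau notations [=O_F] and [~_F] need a canonical [filter_on] structure
   on F, which the library does not declare for [+oo]. *)
Canonical pinfty_nbhs_filter_on (R : numFieldType) :=
  FilterType (pinfty_nbhs R) _.

Definition powerful (n : nat) : Prop :=
  forall p : nat, prime p -> (p %| n)%N -> (p ^ 2 %| n)%N.

(* The interval {N+1, ..., N+H}. *)
Definition very_bad (N H : nat) : Prop :=
  powerful (\prod_(N.+1 <= m < (N + H).+1) m)%N.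

Definition VB : set nat :=
  [set n | exists N H : nat,
    [/\ (1 <= H)%N, very_bad N H & (N.+1 <= n <= N + H)%N]].

(* [powerful 0] holds vacuously; natural numbers here are positive. *)
Definition VB1 : set nat := [set n | (0 < n)%N /\ powerful n].

(* #(A `&` [1, x]) for real x, cast to R; the set is finite, so [fset_set]
   does not fall back on its default value. *)
Definition counting_fun (R : realType) (A : set nat) (x : R) : R :=
  #|` fset_set (A `&` [set n : nat | 1 <= (n%:R : R) <= x]) |%:R.

(* The Dirichlet series: only the Riemann zeta function for real s > 1. *)
Definition zeta (R : realType) (s : R) : R := limn (series (riemannR s)).

(* Main.v *)
(** Proof.  Let I = (N, N+H] be very bad, so that every prime p > H dividing an
    element n of I satisfies p^2 | n.

    For each K, N > H^K once H is large.  Otherwise a prime p > H with p || n for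
    some n in I is found: by Bertrand's postulate if N <= H, by Sylvester's theorem if
    H <= N <= H^(9/5) (then p^2 > N + H), and for H^(9/5) < N <= H^K by exponential
    sums: with P slightly larger than H, Vaughan's identity and Weyl differencing
    show that many primes p in (P, 2P] divide an element of I, while for few of
    them p^2 does.  Hence H = x^o(1) for the intervals that matter below x.

    Each element of I is d s^3 r^2 with d dividing the product of the primes up to H
    that divide it; the product of all these is at most (H!)^2, so two elements
    m' < m of I have d <= H^5.  Elements with s > S number about x^(1/2) S^(-1/2),
    and if s, s' <= S then (r, r') solves one of S^2 x^o(1) Pell type equations
    A r^2 - B r'^2 = m - m', each with x^o(1) solutions.  Take S = x^(1/5).

    Powerful numbers are s^3 r^2 with s squarefree in a unique way, and summing
    n^(-3/2) over n = s d^2 gives the constant zeta(3/2) / zeta(3). *)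

Require Import Defs.
From mathcomp Require Import all_boot all_order all_algebra finmap.
From mathcomp Require Import all_classical all_reals all_analysis.
From mathcomp Require Import ring lra zify.
Import Order.TTheory GRing.Theory Num.Theory.
Import numFieldNormedType.Exports.
Local Open Scope classical_set_scope.
Local Open Scope ring_scope.
Set Implicit Arguments.
Unset Strict Implicit.
Unset Printing Implicit Defensive.

(** P must exceed H: a prime p <= H may divide several elements of I, and then p^2 need not divide
    any of them. But it may exceed H only by a small power, because a proportion about H / P of the
    u in (P, 2P] has a multiple in I, and this density has to survive the errors of the exponential
    sums. Hence P = T^q with H between T^(q-1) / 2^(q-1) and T^(q-1), where q is large in terms of
    K; all savings are fixed powers of T.

    Weyl's method reaches the bilinear sums only for N above about P^(26/15), and the elementary
    argument only works below N = H^2, where proper prime powers contribute o(H) to the logarithm of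
    the binomial coefficient. The exponent 9/5 lies between the two.

    A powerful number is an interval with H = 1; outside [VB1] one has H >= 2, and this provides two
    elements with small d. The choice of S balances x^(1/2) S^(-1/2) against S^2, whence the
    exponent 2/5. For fixed K, all factors H^O(1) amount to x^(15/K), and K tends to infinity only
    at the end. *)

Ltac sgn :=
  repeat first
    [ done
    | match goal with
      | |- is_true (0 <= _ + _) => apply: addr_ge0
      | |- is_true (0 <= _ * _) => apply: mulr_ge0
      | |- is_true (0 <= _ ^+ _) => apply: exprn_ge0
      | |- is_true (0 <= _^-1) => rewrite invr_ge0
      | |- is_true (0 < _ * _) => apply: mulr_gt0
      | |- is_true (0 < _ ^+ _) => apply: exprn_gt0
      | |- is_true (0 < _^-1) => rewrite invr_gt0
      | |- is_true (0 < _%:R) => rewrite ltr0n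
      | |- is_true (_ != 0) => apply: lt0r_neq0
      end
    | by apply: ltW ].

(** * Exponential sums *)

Section ExpSums.
Variable R : realType.
Implicit Types (w x f : nat -> R).

(** Summation by parts: in the invariant [main] the boundary term is removed, and what remains is at
    most the total decrease of [w] times [B]. *)
Lemma abel_nonincr w x n W B : 0 <= W ->
  (forall u, (u.+1 < n)%N -> w u.+1 <= w u) ->
  (forall u, (u < n)%N -> 0 <= w u <= W) ->
  (forall m, (m <= n)%N -> `|\sum_(u < m) x u| <= B) ->
  `|\sum_(u < n) w u * x u| <= W * B.
Proof.
move=> W0; case: n => [|n] wdec w0W xB.
  rewrite big_ord0 normr0 mulr_ge0 //.
  by have := xB 0%N isT; rewrite big_ord0 normr0.
have main m : (m <= n)%N ->
    `|\sum_(u < m.+1) w u * x u - w m * \sum_(u < m.+1) x u|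
    <= (w 0%N - w m) * B.
  elim: m => [|m IH] mn; first by rewrite !big_ord_recr !big_ord0 /= !add0r !subrr normr0 mul0r.
  rewrite !(big_ord_recr m.+1) /=.
  have := IH (ltnW mn); have := xB m.+1 (leqW mn).
  set X := \sum_(u < m.+1) x u; set Y := \sum_(u < m.+1) w u * x u => XB YB.
  have -> : Y + w m.+1 * x m.+1 - w m.+1 * (X + x m.+1) =
     (Y - w m * X) + (w m - w m.+1) * X by ring.
  rewrite (le_trans (ler_normD _ _))// normrM.
  have w1 : 0 <= w m - w m.+1 by rewrite subr_ge0 wdec.
  rewrite (ger0_norm w1).
  have -> : (w 0%N - w m.+1) * B = (w 0%N - w m) * B + (w m - w m.+1) * B by ring.
  by rewrite lerD// ler_wpM2l.
have /(_ _ (leqnn n)) := main.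
have XB := xB n.+1 (leqnn _).
have /andP[wn0 _] := w0W n (leqnn _).
have /andP[_ w0] := w0W 0%N isT.
set X := \sum_(u < n.+1) x u in XB *; set Y := \sum_(u < n.+1) w u * x u => YB.
have B0 : 0 <= B by apply: le_trans XB.
have -> : Y = (Y - w n * X) + w n * X by ring.
rewrite (le_trans (ler_normD _ _))// normrM (ger0_norm wn0).
apply: (@le_trans _ _ ((w 0%N - w n) * B + w n * B)); first by rewrite lerD// ler_wpM2l.
rewrite -mulrDl ler_wpM2r//; lra.
Qed.

(** The reflected weight [W - w] is nonincreasing; undoing the reflection costs the factor 2. *)
Lemma abel_nondecr w x n W B : 0 <= W ->
  (forall u, (u.+1 < n)%N -> w u <= w u.+1) ->
  (forall u, (u < n)%N -> 0 <= w u <= W) ->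
  (forall m, (m <= n)%N -> `|\sum_(u < m) x u| <= B) ->
  `|\sum_(u < n) w u * x u| <= 2 * W * B.
Proof.
move=> W0 wi w0W xB.
have := @abel_nonincr (fun u => W - w u) x n W B W0.
case/(_ _ _ xB)/Wrap => [u un|u un|].
- by rewrite lerB// wi.
- by have := w0W u un; lra.
move=> [H].
have -> : \sum_(u < n) w u * x u = W * (\sum_(u < n) x u) - \sum_(u < n) (W - w u) * x u.
  by rewrite mulr_sumr -sumrB; apply: eq_bigr => i _; ring.
rewrite (le_trans (ler_normB _ _))// normrM (ger0_norm W0).
have -> : 2 * W * B = W * B + W * B by ring.
by rewrite lerD// ler_wpM2l// xB.
Qed.

Lemma sin_lipschitz (y : R) : 0 <= y -> `|sin y| <= y.
Proof.
rewrite le_eqVlt => /orP[/eqP <-|y0]; first by rewrite sin0 normr0.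
have [|c _] := @MVT R sin cos 0 y y0.
  by apply/continuous_subspaceT => ?; exact: continuous_sin.
rewrite sin0 !subr0 => ->.
by rewrite normrM (gtr0_norm y0) ler_piMl ?(ltW y0) // cos_max.
Qed.

Lemma cos_half_angle (y : R) : cos y = 1 - 2 * sin (y / 2) ^+ 2.
Proof.
have e : y = (y / 2) *+ 2 by rewrite -mulr_natr -mulrA mulVf ?mulr1// pnatr_eq0.
by rewrite [in LHS]e cos_mulr2n cos2sin2 -mulr_natr; ring.
Qed.

Lemma cos_ge_quadratic (y : R) : 1 - y ^+ 2 / 2 <= cos y.
Proof.
have sq (z : R) : sin z ^+ 2 <= z ^+ 2.
  have abs : `|sin z| <= `|z|.
    have [z0|z0] := ger0P z; first exact: sin_lipschitz.
    by rewrite -[X in sin X]opprK sinN normrN sin_lipschitz// oppr_ge0 ltW.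
  by rewrite -[leLHS]real_normK ?num_real// -[leRHS]real_normK ?num_real// lerXn2r ?nnegrE.
by rewrite cos_half_angle; have := sq (y / 2); lra.
Qed.

Lemma sin_ge_half (y : R) : 0 <= y <= 1 -> y / 2 <= sin y.
Proof.
move=> /andP[]; rewrite le_eqVlt => /orP[/eqP <-|y0 y1]; first by rewrite sin0 mul0r.
have [|c] := @MVT R sin cos 0 y y0.
  by apply/continuous_subspaceT => ?; exact: continuous_sin.
rewrite in_itv/= => /andP[c0 cy]; rewrite sin0 !subr0 => ->.
rewrite mulrC ler_pM2r//.
have := cos_ge_quadratic c.
have : c ^+ 2 <= 1 by rewrite expr_le1//; lra.
lra.
Qed.

(* With d = (f (u+1) - f u) / 2, cos (f u) is half of
   cos (f u) - cos (f (u+1)) + cot d (sin (f (u+1)) - sin (f u)),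
   which is summed by parts. *)
Lemma kusmin_landau f n (l : R) : 0 < l ->
  (forall u, (u < n)%N -> l <= f u.+1 - f u <= 2) ->
  (forall u, (u.+1 < n)%N -> f u.+2 - f u.+1 <= f u.+1 - f u) ->
  `|\sum_(u < n) cos (f u)| <= 1 + 8 / l.
Proof.
move=> l0 fl fdec.
pose d u := (f u.+1 - f u) / 2.
have d01 u : (u < n)%N -> l / 2 <= d u <= 1 by move=> /fl; rewrite /d; lra.
have sind0 u : (u < n)%N -> l / 4 <= sin (d u).
  move=> un; have := d01 u un => du.
  by apply: le_trans (@sin_ge_half (d u) _); lra.
pose w u := cos (d u) / sin (d u).
have cosE u : (u < n)%N -> cos (f u) = (cos (f u) - cos (f u.+1)) / 2
    + w u * (sin (f u.+1) - sin (f u)) / 2.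
  move=> un.
  have -> : f u.+1 = f u + d u + d u by rewrite /d; lra.
  have s0 := sind0 u un.
  rewrite /w !(cosD, sinD).
  have := cos2Dsin2 (d u).
  move: (cos (d u)) (sin (d u)) s0 => c s s0 cs.
  have sn0 : s != 0 by rewrite gt_eqF// (lt_le_trans _ s0)//; lra.
  move: (cos (f u)) (sin (f u)) => A B.
  (* Both sides differ by a multiple of [c ^+ 2 + s ^+ 2 - 1], which [field] does not know to
     vanish. *)
  transitivity (A + (c ^+ 2 + s ^+ 2 - 1) * (A / 2 + c * B / (2 * s))).
    by rewrite cs subrr mul0r addr0.
  by field.
have -> : \sum_(u < n) cos (f u) = (cos (f 0%N) - cos (f n)) / 2 +
   (\sum_(u < n) w u * (sin (f u.+1) - sin (f u))) / 2.
  have -> : cos (f 0%N) - cos (f n) = \sum_(u < n) (cos (f u) - cos (f u.+1)).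
    rewrite -(big_mkord predT (fun u => cos (f u) - cos (f u.+1))).
    rewrite (eq_bigr (fun u => - cos (f u.+1) - (- cos (f u)))); last by move=> u _; ring.
    by rewrite (@telescope_sumr _ 0 n (fun u => - cos (f u)))//; ring.
  by rewrite !mulr_suml -big_split/=; apply: eq_bigr => i _; exact: cosE.
have c01 u : (u < n)%N -> 0 <= cos (d u) <= 1.
  move=> un; rewrite cos_le1 andbT.
  have := cos_ge_quadratic (d u); have := d01 u un => du.
  have : d u ^+ 2 <= 1 by rewrite expr_le1//; lra.
  lra.
have := @abel_nondecr w (fun u => sin (f u.+1) - sin (f u)) n (4 / l) 2.
case/(_ _ _ _ _)/Wrap => [|u un|u un|m mn|].
- by rewrite divr_ge0 ?ltW.
- have un' := ltnW un.
  have su := sind0 u un'; have su1 := sind0 _ un.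
  rewrite /w ler_pdivrMr; last by apply: lt_le_trans su; lra.
  rewrite mulrAC ler_pdivlMr; last by apply: lt_le_trans su1; lra.
  have dd : d u.+1 <= d u by rewrite /d ler_pM2r// fdec.
  (* Cross-multiplied, the monotonicity of the cotangent is the sign of this sine. *)
  have : 0 <= sin (d u - d u.+1).
    apply: sin_ge0_pi; have := d01 u un'; have := d01 _ un; have := pi_ge2 R; lra.
  rewrite sinB; lra.
- have su := sind0 u un.
  have /andP[c0 c1] := c01 u un.
  have s0 : 0 < sin (d u) by apply: lt_le_trans su; lra.
  apply/andP; split; first by apply: divr_ge0 => //; exact: ltW.
  rewrite /w ler_pdivrMr// mulrAC ler_pdivlMr//.
  have : cos (d u) * l <= l by rewrite ler_piMl// ltW.
  lra.
- rewrite -(big_mkord predT (fun u => sin (f u.+1) - sin (f u))).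
  rewrite (@telescope_sumr _ 0 m (fun u => sin (f u)))//.
  rewrite (le_trans (ler_normB _ _))//.
  have := sin_max (f m); have := sin_max (f 0%N); lra.
move=> [H].
rewrite (le_trans (ler_normD _ _))// lerD//.
  have := cos_max (f 0%N); have := cos_max (f n).
  rewrite normrM (ger0_norm (_ : 0 <= 2^-1 :> R)) ?invr_ge0//.
  by have := ler_normB (cos (f 0%N)) (cos (f n)); lra.
rewrite normrM (ger0_norm (_ : 0 <= 2^-1 :> R)) ?invr_ge0//.
have -> : 8 / l = (2 * (4 / l) * 2) / 2 by field; rewrite gt_eqF.
by rewrite ler_pM2r.
Qed.
End ExpSums.

(** * Van der Corput's inequality *)

Section VdC.
Variable R : realType.
Implicit Types (f : nat -> R).

(** Lagrange's identity: the sum of the squares [(a i * b j - a j * b i) ^+ 2] over all pairs is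
    twice the defect of the inequality. *)
Lemma cauchy_schwarz_sum (I : Type) (r : seq I) (P : pred I) (a b : I -> R) :
  (\sum_(i <- r | P i) a i * b i) ^+ 2 <=
  (\sum_(i <- r | P i) a i ^+ 2) * (\sum_(i <- r | P i) b i ^+ 2).
Proof.
have : 0 <= \sum_(i <- r | P i) \sum_(j <- r | P j) (a i * b j - a j * b i) ^+ 2.
  by apply: sumr_ge0 => i _; apply: sumr_ge0 => j _; exact: sqr_ge0.
set S1 := \sum_(i <- r | P i) a i * b i.
set S2 := \sum_(i <- r | P i) a i ^+ 2.
set S3 := \sum_(i <- r | P i) b i ^+ 2.
have -> : \sum_(i <- r | P i) \sum_(j <- r | P j) (a i * b j - a j * b i) ^+ 2
   = 2 * (S2 * S3 - S1 ^+ 2).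
  transitivity (\sum_(i <- r | P i) (a i ^+ 2 * S3 + b i ^+ 2 * S2 - 2 * (a i * b i) * S1)).
    apply: eq_bigr => i _; rewrite /S1 /S2 /S3 !mulr_sumr -big_split/= -sumrB.
    by apply: eq_bigr => j _; ring.
  rewrite sumrB big_split/= -!mulr_suml -mulr_sumr -/S1 -/S2 -/S3; ring.
lra.
Qed.

Lemma sum_sqr_le n (a : nat -> R) :
  (\sum_(i < n) a i) ^+ 2 <= n%:R * \sum_(i < n) a i ^+ 2.
Proof.
have := @cauchy_schwarz_sum _ (index_enum 'I_n) predT (fun=> 1) a.
rewrite (eq_bigr (fun i : 'I_n => a i)); last by move=> i _; rewrite mul1r.
move=> /le_trans; apply; rewrite ler_wpM2r//; first by apply: sumr_ge0 => i _; exact: sqr_ge0.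
by rewrite (eq_bigr (fun=> 1)) ?sumr_const ?card_ord// => i _; rewrite expr1n.
Qed.

Lemma sum_window_shift M h n (F : nat -> R) : (h + n <= M)%N ->
  \sum_(0 <= v < M | (h <= v < h + n)%N) F (v - h)%N = \sum_(0 <= u < n) F u.
Proof.
move=> hM.
rewrite (@big_cat_nat _ _ _ h)/= ?leq0n//; last by lia.
rewrite (@big_cat_nat _ _ _ (h + n)%N h)/=; [|lia|lia].
rewrite big_nat_cond big_pred0 ?add0r; last by move=> v; lia.
rewrite [X in _ + X]big_nat_cond [X in _ + X]big_pred0 ?addr0; last by move=> v; lia.
rewrite big_nat_cond (eq_bigl (fun v => (h <= v < h + n)%N)); last by move=> v; lia.
rewrite -big_nat -{1}[h]add0n big_addn addKn.
by apply: eq_big_nat => u _; rewrite addnK.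
Qed.

(** The sum is averaged over Q translates, spread over n + Q positions v, before Cauchy-Schwarz in
    v. Two translates then interact only through the phase differences f (u + h) - f u, and in each
    row every nonzero shift occurs at most twice. *)
Lemma van_der_corput f n Q :
  (Q%:R * \sum_(0 <= u < n) cos (f u)) ^+ 2 <= (n + Q)%:R * (Q%:R *
    (n%:R + 2 * \sum_(1 <= h < Q) `|\sum_(0 <= u < n - h) cos (f (u + h)%N - f u)|)).
Proof.
pose B h v := (h <= v < h + n)%N.
pose D e : R := `|\sum_(0 <= u < n - e) cos (f (u + e)%N - f u)|.
have -> : Q%:R * \sum_(0 <= u < n) cos (f u) =
    \sum_(v < n + Q) \sum_(0 <= h < Q | B h v) cos (f (v - h)%N).
  rewrite -(big_mkord predT (fun v => \sum_(0 <= h < Q | B h v) cos (f (v - h)%N))).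
  rewrite (exchange_big_dep predT)//=.
  rewrite [RHS]big_nat [RHS](eq_bigr (fun=> \sum_(0 <= u < n) cos (f u))).
    by rewrite -[RHS]big_nat sumr_const_nat subn0 mulr_natl.
  move=> h hQ; rewrite (eq_bigl (B h)); last by move=> v; rewrite ?andbT.
  by rewrite (@sum_window_shift _ h n (fun v => cos (f v)))//; lia.
rewrite (le_trans (@sum_sqr_le _ (fun v => \sum_(0 <= h < Q | B h v) cos (f (v - h)%N))))//.
rewrite ler_wpM2l//.
apply: (@le_trans _ _ (\sum_(v < n + Q) \sum_(0 <= h < Q | B h v) \sum_(0 <= k < Q | B k v)
    cos (f (v - h)%N - f (v - k)%N))).
  apply: ler_sum => v _.
  set Cs := \sum_(0 <= h < Q | B h v) cos (f (v - h)%N).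
  (* Adding the square of the sine sum completes cos cos + sin sin to the cosine of a difference; in
     complex form this is the squared modulus. *)
  pose Sn := \sum_(0 <= h < Q | B h v) sin (f (v - h)%N).
  have -> : \sum_(0 <= h < Q | B h v) \sum_(0 <= k < Q | B k v)
    cos (f (v - h)%N - f (v - k)%N) = Cs ^+ 2 + Sn ^+ 2.
    rewrite !expr2 {1}/Cs {1}/Sn !mulr_suml -big_split/=; apply: eq_bigr => h _.
    rewrite /Cs /Sn !mulr_sumr -big_split/=; apply: eq_bigr => k _.
    by rewrite cosB.
  by rewrite lerDl sqr_ge0.
rewrite -(big_mkord predT (fun v : nat => \sum_(0 <= h < Q | B h v) \sum_(0 <= k < Q | B k v)
    cos (f (v - h)%N - f (v - k)%N))).
rewrite (exchange_big_dep predT)//=.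
have pair h k : (h < Q)%N -> (k <= h)%N ->
   `|\sum_(0 <= v < n + Q | B h v && B k v) cos (f (v - h)%N - f (v - k)%N)| = D (h - k)%N.
  move=> hQ kh.
  have e : \sum_(0 <= v < n + Q | B h v && B k v) cos (f (v - h)%N - f (v - k)%N) =
      \sum_(0 <= u < n - (h - k)) cos (f (u + (h - k))%N - f u).
    rewrite -(@sum_window_shift (n + Q) h (n - (h - k))
      (fun u => cos (f (u + (h - k))%N - f u))); last by lia.
    rewrite [LHS]big_nat_cond [RHS]big_nat_cond; apply: eq_big => v; first by rewrite /B; lia.
    rewrite /B => vb; rewrite -cosN opprB.
    by have -> : (v - h + (h - k) = v - k)%N by lia.
  by rewrite /D -e.
have row h : (h < Q)%N -> `|\sum_(0 <= v < n + Q) \sum_(0 <= k < Q | B h v && B k v)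
    cos (f (v - h)%N - f (v - k)%N)| <= n%:R + 2 * \sum_(1 <= e < Q) D e.
  move=> hQ; rewrite (exchange_big_dep predT)//=.
  rewrite (le_trans (ler_norm_sum _ _ _))//.
  have pairE k : (k < Q)%N -> `|\sum_(0 <= v < n + Q | B h v && B k v) cos (f (v - h)%N - f (v - k)%N)|
     = D (maxn h k - minn h k)%N.
    move=> kQ; case: (leqP k h) => kh; first by rewrite pair//; congr D; lia.
    have -> : \sum_(0 <= v < n + Q | B h v && B k v) cos (f (v - h)%N - f (v - k)%N) =
       \sum_(0 <= v < n + Q | B k v && B h v) cos (f (v - k)%N - f (v - h)%N).
      by apply: eq_big => v; [rewrite andbC|move=> _; rewrite -cosN opprB].
    by rewrite pair// ltnW.
  rewrite [leLHS](@eq_big_nat _ _ _ _ _ _ (fun k => D (maxn h k - minn h k)%N)); last first.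
    by move=> k /andP[_ kQ]; exact: (pairE k kQ).
  rewrite [leLHS](@big_cat_nat _ _ _ h)/=; [|lia|lia].
  rewrite (@big_ltn _ _ _ h)//.
  have D0 e : 0 <= D e by exact: normr_ge0.
  have -> : \sum_(0 <= k < h) D (maxn h k - minn h k)%N = \sum_(1 <= e < h.+1) D e.
    rewrite big_add1/= big_nat_rev/=; apply: eq_big_nat => i ih; congr D; lia.
  have -> : \sum_(h.+1 <= k < Q) D (maxn h k - minn h k)%N = \sum_(1 <= e < (Q - h)%N) D e.
    rewrite -{1}[h.+1]add1n big_addn; apply: eq_big_nat => i ih; congr D; lia.
  have sub m : (m <= Q)%N -> \sum_(1 <= e < m) D e <= \sum_(1 <= e < Q) D e.
    case: m => [|m] mQ; first by rewrite big_geq// sumr_ge0.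
    by rewrite [leRHS](@big_cat_nat _ _ _ m.+1)//= lerDl sumr_ge0.
  have -> : D (maxn h h - minn h h)%N = `|n%:R|.
    rewrite maxnn minnn subnn /D subn0.
    rewrite (eq_bigr (fun=> 1)); last by move=> u _; rewrite addn0 subrr cos0.
    by rewrite sumr_const_nat subn0.
  rewrite normr_nat.
  have := sub h.+1 hQ; have := sub (Q - h)%N (leq_subr _ _); lra.
apply: (@le_trans _ _ (\sum_(0 <= h < Q) (n%:R + 2 * \sum_(1 <= e < Q) D e))).
  apply: ler_sum_nat => h /andP[_ hQ]; rewrite (le_trans _ (row h hQ))//.
  rewrite (le_trans _ (ler_norm _))// big_mkcond/= ler_sum// => v _.
  by case: (B h v) => //=; rewrite big_pred0.
by rewrite sumr_const_nat subn0 -[leLHS]mulr_natl.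
Qed.
End VdC.

(** * Weyl differencing for X / u^i *)

Section Weyl.
Variable R : realType.
Implicit Types (f g : nat -> R).

Definition lprod (cs : seq nat) (u : nat) : R := \prod_(c <- cs) ((u + c)%:R)^-1.

(* Nonnegative combinations, of total weight [A], of products of [m] factors
   1/(u + c) with c <= c0; the class is stable under backward differences. *)
Inductive cmon (m c0 : nat) : R -> (nat -> R) -> Prop :=
| CMprod cs : size cs = m -> all (fun c => c <= c0)%N cs -> cmon m c0 1 (lprod cs)
| CMscale w A f : 0 <= w -> cmon m c0 A f -> cmon m c0 (w * A) (fun u => w * f u)
| CMadd A B f g : cmon m c0 A f -> cmon m c0 B g -> cmon m c0 (A + B) (fun u => f u + g u)
| CMext A f g : (forall u, (0 < u)%N -> f u = g u) -> cmon m c0 A f -> cmon m c0 A g.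

Lemma cmon_mul m c0 A f c : (c <= c0)%N -> cmon m c0 A f ->
  cmon m.+1 c0 A (fun u => ((u + c)%:R)^-1 * f u).
Proof.
move=> cc0; elim=> [cs sz ac|w B g w0 _ IH|B C g h _ IH1 _ IH2|B g h gh _ IH].
- apply: (@CMext _ _ _ (lprod (c :: cs))); first by move=> u _; rewrite /lprod big_cons.
  by apply: CMprod; rewrite /= ?sz ?cc0.
- by apply: CMext (CMscale w0 IH) => u _; rewrite mulrCA.
- by apply: CMext (CMadd IH1 IH2) => u _; rewrite mulrDr.
- by apply: CMext IH => u u0; rewrite gh.
Qed.

(** A product rule: the factor 1 / (u + c) has the difference h / ((u + c) (u + c + h)), so each of
    the m factors contributes products with one more factor and weight h, with shifts at most c0 +
    h. *)
Lemma cmon_dif m c0 A f h : cmon m c0 A f ->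
  cmon m.+1 (c0 + h) (m%:R * h%:R * A) (fun u => f u - f (u + h)%N).
Proof.
elim=> [cs sz ac|w B g w0 _ IH|B C g k _ IH1 _ IH2|B g k gk _ IH].
- rewrite mulr1; elim: cs m sz ac => [|c cs IH] m sz ac.
    rewrite -sz /=; apply: (@CMext _ _ _ (fun u => 0 * lprod [:: 0%N] u)).
      by move=> u u0; rewrite /lprod !big_nil subrr mul0r.
    have H : cmon 1 (c0 + h) (0 * 1) (fun u => 0 * lprod [:: 0%N] u).
      by apply: CMscale => //; exact: CMprod.
    by rewrite mul0r in H; rewrite mul0r.
  case: m sz => // m [sz]; move: ac => /= /andP[cc0 ac].
  have {}IH := IH m sz ac.
  have ch : (c <= c0 + h)%N by exact: leq_trans (leq_addr _ _).
  have H1 := cmon_mul ch IH.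
  have sz2 : size [:: c, (c + h)%N & map (addn h) cs] = m.+2 by rewrite /= size_map sz.
  have a2 : all (fun d => d <= c0 + h)%N [:: c, (c + h)%N & map (addn h) cs].
    rewrite /= ch leq_add2r cc0 /= all_map; apply: sub_all ac => d /= dc.
    by rewrite addnC leq_add2r.
  have H2 := CMscale (ler0n R h) (CMprod sz2 a2).
  apply: (@CMext _ _ _ _ _ _ (_ : cmon _ _ _ _)); last first.
    have -> : m.+1%:R * h%:R = m%:R * h%:R + h%:R * 1 :> R by rewrite -natr1; ring.
    exact: (CMadd H1 H2).
  move=> u u0; rewrite /lprod !big_cons.
  set G := \prod_(j <- cs) ((u + j)%:R)^-1.
  set G' := \prod_(j <- map (addn h) cs) _.
  have -> : \prod_(j <- cs) (((u + h + j)%N)%:R)^-1 = G' :> R.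
    by rewrite /G' big_map; apply: eq_bigr => j _; rewrite addnA.
  rewrite !natrD; field.
  by rewrite -!natrD !pnatr_eq0; apply/andP; split; lia.
- have -> : m%:R * h%:R * (w * B) = w * (m%:R * h%:R * B) by ring.
  by apply: CMext (CMscale w0 IH) => u _; rewrite mulrBr.
- rewrite mulrDr; apply: CMext (CMadd IH1 IH2) => u _; ring.
- by apply: CMext IH => u u0; rewrite !gk// addn_gt0 u0.
Qed.

Lemma cmon_bounds m c0 A f u : (0 < u)%N -> cmon m c0 A f ->
  [/\ 0 <= A, A / (u + c0)%:R ^+ m <= f u & f u <= A / u%:R ^+ m].
Proof.
move=> u0; have U0 : 0 < u%:R :> R by rewrite ltr0n.
have V0 : 0 < (u + c0)%:R :> R by rewrite ltr0n addn_gt0 u0.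
elim=> [cs sz ac|w B g w0 _ [B0 lB uB]|B C g k _ [B0 lB uB] _ [C0 lC uC]|B g k gk _ [B0 lB uB]].
- split => //.
    elim: cs m sz ac => [|c cs IH] m /= <- /=; first by rewrite /lprod big_nil expr0 divr1.
    move=> /andP[cc0 ac]; rewrite /lprod big_cons exprS invfM mulrA mul1r.
    rewrite ler_pM// ?invr_ge0 ?exprn_ge0 ?ler0n//.
      by rewrite lef_pV2 ?posrE ?ler_nat ?leq_add2l// ltr0n addn_gt0 u0.
    by have := IH _ erefl ac; rewrite div1r.
  elim: cs m sz ac => [|c cs IH] m /= <- /=; first by rewrite /lprod big_nil expr0 divr1.
  move=> /andP[cc0 ac]; rewrite /lprod big_cons exprS invfM mulrA mul1r.
  rewrite ler_pM//.
  + by apply: prodr_ge0 => i _; rewrite invr_ge0.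
  + by rewrite lef_pV2 ?posrE ?ler_nat ?leq_addr// ltr0n addn_gt0 u0.
  + by have := IH _ erefl ac; rewrite div1r.
- by rewrite mulr_ge0// -!mulrA !ler_wpM2l.
- by rewrite addr_ge0// !mulrDl !lerD.
- by rewrite -gk.
Qed.

(** Two successive differences of f stay in the class, so f is decreasing and convex: [- f] has
    positive, decreasing increments, as [kusmin_landau] asks. The hypothesis on [m%:R * A] keeps
    them at most 2. *)
Lemma cmon_base m c0 A f U a n : (0 < m)%N -> 0 < A -> (0 < U)%N ->
  cmon m c0 A f -> (U <= a)%N -> (a + n <= 2 * U)%N -> (c0 <= U)%N ->
  m%:R * A <= 2 * U%:R ^+ m.+1 ->
  `|\sum_(0 <= u < n) cos (f (a + u)%N)| <= 1 + 8 * (4 * U%:R) ^+ m.+1 / A.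
Proof.
move=> m0 A0 U0 fA Ua an c0U mA.
have gA := cmon_dif 1 fA; have hA := cmon_dif 1 gA.
have u0 u : (0 < a + u)%N by lia.
have m0' : 0 < m%:R :> R by rewrite ltr0n.
have UR : 0 < U%:R :> R by rewrite ltr0n.
pose l : R := m%:R * A / (4 * U%:R) ^+ m.+1.
have l0 : 0 < l by rewrite divr_gt0// ?mulr_gt0// exprn_gt0// mulr_gt0.
have := @kusmin_landau R (fun u => - f (a + u)%N) n l l0.
case/(_ _ _)/Wrap => [u un|u un|].
- have [_ lo up] := cmon_bounds (u0 u) gA.
  move: lo up; rewrite (addn1 (a + u)) mulr1 => lo up.
  apply/andP; split.
    rewrite addnS opprK addrC; apply: le_trans lo; rewrite ler_pM2l ?mulr_gt0//.
    rewrite lef_pV2 ?posrE; [|by rewrite exprn_gt0// mulr_gt0|by rewrite exprn_gt0// ltr0n; lia].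
    rewrite lerXn2r ?nnegrE ?mulr_ge0//; rewrite -(natrM _ 4) ler_nat; lia.
  rewrite addnS opprK addrC; apply: le_trans up _.
  rewrite ler_pdivrMr ?exprn_gt0 ?ltr0n//; apply: le_trans mA _; rewrite ler_pM2l//.
  by rewrite lerXn2r ?nnegrE// ler_nat; lia.
- have [H lo _] := cmon_bounds (u0 u) hA.
  have : 0 <= f (a + u)%N - f (a + u + 1)%N - (f (a + u + 1)%N - f (a + u + 1 + 1)%N).
    by apply: le_trans lo; rewrite divr_ge0// exprn_ge0.
  by rewrite !addn1 !addnS; lra.
move=> [H].
rewrite big_mkord (eq_bigr (fun u : 'I_n => cos (- f (a + u)%N))); last by move=> u _; rewrite cosN.
apply: le_trans H _; rewrite lerD2l /l invf_div mulrA.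
apply: ler_wpM2l; first by rewrite mulr_ge0// exprn_ge0// mulr_ge0// ltW.
by rewrite lef_pV2 ?posrE ?mulr_gt0// ler_peMl ?ler1n// ltW.
Qed.
End Weyl.

Section WeylInd.
Variable R : realType.
Implicit Types (f g : nat -> R).

Lemma power_mean j q Q (x : nat -> R) : (q <= Q)%N -> (0 < Q)%N ->
  (forall h, 0 <= x h) ->
  ((\sum_(h < q) x h) / Q%:R) ^+ (2 ^ j) <= (\sum_(h < q) x h ^+ (2 ^ j)) / Q%:R.
Proof.
move=> qQ Q0; elim: j x => [|j IH] x x0.
  by rewrite expn0 expr1 (eq_bigr (fun h : 'I_q => x h)).
have Q0' : 0 < Q%:R :> R by rewrite ltr0n.
rewrite expnS exprM.
apply: (@le_trans _ _ (((\sum_(h < q) x h ^+ 2) / Q%:R) ^+ (2 ^ j))).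
  have s0 : 0 <= \sum_(h < q) x h ^+ 2 by apply: sumr_ge0 => i _; exact: sqr_ge0.
  rewrite lerXn2r ?nnegrE ?sqr_ge0 ?divr_ge0//.
  rewrite expr_div_n ler_pdivrMr ?exprn_gt0//.
  have -> : (\sum_(h < q) x h ^+ 2) / Q%:R * Q%:R ^+ 2 = (\sum_(h < q) x h ^+ 2) * Q%:R.
    by field; rewrite gt_eqF.
  rewrite (le_trans (@sum_sqr_le R _ _))//; by rewrite mulrC ler_wpM2l// ler_nat.
apply: le_trans (IH (fun h => x h ^+ 2) _) _; first by move=> h; exact: sqr_ge0.
by rewrite ler_pM2r ?invr_gt0//; apply: ler_sum => i _; rewrite -exprM.
Qed.

Lemma exprD_le2 (x y : R) n : 0 <= x -> 0 <= y ->
  (x + y) ^+ n <= 2 ^+ n * (x ^+ n + y ^+ n).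
Proof.
move=> x0 y0; wlog xy : x y x0 y0 / x <= y => [H|].
  by case: (lerP x y) => xy; [exact: H|rewrite addrC [x ^+ n + _]addrC; apply: H => //; exact: ltW].
apply: (@le_trans _ _ ((2 * y) ^+ n)).
  by rewrite lerXn2r ?nnegrE ?addr_ge0 ?mulr_ge0//; lra.
by rewrite exprMn ler_wpM2l ?exprn_ge0// lerDr exprn_ge0.
Qed.

Definition harm (Q : nat) : R := \sum_(1 <= h < Q.+1) (h%:R)^-1.

(** One van der Corput step replaces f by f u - f (u + h), of degree m + 1 and weight m h A; the
    factor 1 / h in the inductive bound then sums to [harm Q], and each step squares the sum. The
    size condition anticipates all j steps: the increments of the final phase must still be at most
    2. *)
Lemma weyl_differencing j : exists2 K : R, 0 < K & forall m c0 (A : R) f U Q a n,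
  (0 < m)%N -> 0 < A -> (0 < Q <= U)%N -> cmon m c0 A f ->
  (U <= a)%N -> (a + n <= 2 * U)%N -> (c0 + j * Q <= U)%N ->
  (\prod_(i < j.+1) (m + i))%:R * A * Q%:R ^+ j <= 2 * U%:R ^+ (m + j).+1 ->
  `|\sum_(0 <= u < n) cos (f (a + u)%N)| ^+ (2 ^ j) <= K * U%:R ^+ (2 ^ j) *
    (Q%:R^-1 + U%:R^-1 + 8 * 4 ^+ (m + j).+1 * U%:R ^+ (m + j) * harm Q ^+ j / (A * Q%:R ^+ j)).
Proof.
elim: j => [|j [K K0 IH]].
  exists 1 => // m c0 A f U Q a n m0 A0 /andP[Q0 QU] fA Ua an.
  rewrite mul0n addn0 big_ord_recl big_ord0 muln1 !addn0 !expr0 !mulr1 expn0 !expr1 mul1r => c0U mA.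
  have U0 : 0 < U%:R :> R by rewrite ltr0n (leq_trans Q0).
  have := cmon_base m0 A0 (leq_trans Q0 QU) fA Ua an c0U mA.
  move=> /le_trans; apply.
  have -> : U%:R * (Q%:R^-1 + U%:R^-1 + 8 * 4 ^+ m.+1 * U%:R ^+ m / A) =
     U%:R / Q%:R + (1 + 8 * (4 * U%:R) ^+ m.+1 / A).
    by rewrite exprMn (exprS U%:R); field; rewrite !gt_eqF// ltr0n.
  by rewrite lerDr divr_ge0.
exists (2 ^+ (2 ^ j) * (2 ^+ (2 ^ j) + 4 ^+ (2 ^ j) * K)) => [|m c0 A f U Q a n m0 A0 /andP[Q0 QU] fA Ua an cU mAQ].
  by rewrite mulr_gt0 ?exprn_gt0// addr_gt0 ?exprn_gt0// mulr_gt0 ?exprn_gt0.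
have U0 : 0 < U%:R :> R by rewrite ltr0n (leq_trans Q0).
have QR0 : 0 < Q%:R :> R by rewrite ltr0n.
set T := \sum_(0 <= u < n) cos (f (a + u)%N).
pose Th h := `|\sum_(0 <= u < n - h) cos (f (a + (u + h))%N - f (a + u)%N)| : R.
have Th0 h : 0 <= Th h by exact: normr_ge0.
have TT : `|T| ^+ 2 <= 2 * U%:R ^+ 2 / Q%:R + (4 * U%:R) * ((\sum_(h < Q.-1) Th h.+1) / Q%:R).
  have := van_der_corput (fun u => f (a + u)%N) n Q.
  rewrite -/T -/(Th _).
  have -> : \sum_(1 <= h < Q) `|\sum_(0 <= u < n - h) cos (f (a + (u + h))%N - f (a + u)%N)|
     = \sum_(h < Q.-1) Th h.+1 by rewrite big_add1 big_mkord.
  move=> H; rewrite real_normK ?num_real//.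
  have S0 : 0 <= \sum_(h < Q.-1) Th h.+1 by apply: sumr_ge0.
  set S := \sum_(h < Q.-1) Th h.+1 in H S0 *.
  have nU : n%:R <= U%:R :> R by rewrite ler_nat; clear -Q0 QU Ua an; lia.
  have nQU : (n + Q)%:R <= 2 * U%:R :> R by rewrite -natrM ler_nat; clear -Q0 QU Ua an; lia.
  have H2 : (Q%:R * T) ^+ 2 <= 2 * U%:R * (Q%:R * (U%:R + 2 * S)).
    apply: le_trans H _; rewrite ler_pM// ?mulr_ge0 ?addr_ge0 ?mulr_ge0//.
    by rewrite ler_pM2l// lerD2r.
  rewrite -(@ler_pM2l _ (Q%:R ^+ 2)) ?exprn_gt0// -exprMn (le_trans H2)//.
  rewrite le_eqVlt; apply/orP; left; apply/eqP; field.
  by rewrite gt_eqF.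
rewrite expnS exprM.
apply: (@le_trans _ _ ((2 * U%:R ^+ 2 / Q%:R + (4 * U%:R) * ((\sum_(h < Q.-1) Th h.+1) / Q%:R)) ^+ (2 ^ j))).
  by rewrite lerXn2r ?nnegrE ?sqr_ge0// (le_trans _ TT)// sqr_ge0.
have S0 : 0 <= (\sum_(h < Q.-1) Th h.+1) / Q%:R by rewrite divr_ge0 ?sumr_ge0.
have x0 : 0 <= 2 * U%:R ^+ 2 / Q%:R :> R by rewrite divr_ge0// mulr_ge0// exprn_ge0.
have y0 : 0 <= 4 * U%:R * ((\sum_(h < Q.-1) Th h.+1) / Q%:R) by rewrite mulr_ge0// mulr_ge0.
apply: le_trans (exprD_le2 _ x0 y0) _.
set M := (2 ^ j)%N.
have M0 : (0 < M)%N by rewrite expn_gt0.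
have A0w : 0 <= A by exact: ltW.
have K0w : 0 <= K by exact: ltW.
set E := (Q%:R^-1 + U%:R^-1 : R).
set F := 8 * 4 ^+ (m + j.+1).+1 * U%:R ^+ (m + j.+1) * harm Q ^+ j.+1 / (A * Q%:R ^+ j.+1).
have harm0 : 0 <= harm Q by apply: sumr_ge0 => h _; rewrite invr_ge0.
have F0 : 0 <= F.
  by rewrite divr_ge0 ?mulr_ge0 ?exprn_ge0.
have E0 : Q%:R^-1 <= E by rewrite lerDl invr_ge0.
(* The inductive bound averaged over h; [power_mean] will bring the exponent 2^j inside the
   average. *)
have avg : (\sum_(h < Q.-1) Th h.+1 ^+ M) / Q%:R <= K * U%:R ^+ M * (E + F).
  pose G := 8 * 4 ^+ (m.+1 + j).+1 * U%:R ^+ (m.+1 + j) * harm Q ^+ j / (A * Q%:R ^+ j).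
  have G0 : 0 <= G by rewrite /G; sgn.
  have Thb h : (h < Q.-1)%N -> Th h.+1 ^+ M <= K * U%:R ^+ M * (E + G / h.+1%:R).
    move=> hQ.
    have m0R : 0 < m%:R :> R by rewrite ltr0n.
    have Ah : 0 < m%:R * h.+1%:R * A by rewrite !mulr_gt0.
    have Qj0 : 0 < Q%:R ^+ j :> R by rewrite exprn_gt0.
    have := IH m.+1 (c0 + h.+1)%N _ _ U Q a (n - h.+1)%N isT Ah _ (cmon_dif h.+1 fA) Ua.
    case/(_ _ _ _ _)/Wrap => [|||| [H]].
    - by rewrite Q0.
    - by clear -an; lia.
    - by move: cU; rewrite mulSn; clear -hQ; lia.
    - have eP : (\prod_(i < j.+2) (m + i) = m * \prod_(i < j.+1) (m.+1 + i))%N.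
        rewrite big_ord_recl addn0; congr (m * _)%N; apply: eq_bigr => i _.
        by rewrite lift0 addnS addSn.
      move: mAQ; rewrite eP natrM addnS exprSr => mAQ.
      apply: le_trans mAQ.
      set Pr := ((\prod_(i < j.+1) (m.+1 + i))%N%:R : R).
      have -> : Pr * (m%:R * h.+1%:R * A) * Q%:R ^+ j = (m%:R * Pr * A * Q%:R ^+ j) * h.+1%:R by ring.
      have -> : m%:R * Pr * A * (Q%:R ^+ j * Q%:R) = (m%:R * Pr * A * Q%:R ^+ j) * Q%:R by ring.
      apply: ler_wpM2l; [by sgn|rewrite ler_nat; clear -hQ; lia].
    have -> : Th h.+1 = `|\sum_(0 <= u < n - h.+1) cos (f (a + u)%N - f (a + u + h.+1)%N)|.
      rewrite /Th; congr (Num.norm _); apply: eq_bigr => u _.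
      by rewrite -cosN opprB addnA.
    apply: le_trans H _; rewrite ler_wpM2l ?mulr_ge0 ?exprn_ge0//.
    rewrite lerD2l.
    have -> : G / h.+1%:R = 8 * 4 ^+ (m.+1 + j).+1 * U%:R ^+ (m.+1 + j) * harm Q ^+ j / (h.+1%:R * A * Q%:R ^+ j).
      by rewrite /G; field; rewrite !gt_eqF.
    apply: ler_wpM2l; first by sgn.
    rewrite lef_pV2 ?posrE ?mulr_gt0// -!mulrA ler_peMl; [by []|by sgn|by rewrite ler1n].
  rewrite ler_pdivrMr//.
  apply: (@le_trans _ _ (\sum_(h < Q.-1) K * U%:R ^+ M * (E + G / h.+1%:R))).
    by apply: ler_sum => h _; exact: Thb.
  have -> : K * U%:R ^+ M * (E + F) * Q%:R = K * U%:R ^+ M * ((E + F) * Q%:R) by ring.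
  rewrite -mulr_sumr; apply: ler_wpM2l; first by sgn.
  rewrite big_split/= sumr_const card_ord mulrDl; apply: lerD.
    rewrite -[leLHS]mulr_natr; apply: ler_wpM2l; last by rewrite ler_nat leq_pred.
    by rewrite (le_trans _ E0)// invr_ge0.
  have -> : F * Q%:R = G * harm Q.
    by rewrite /F /G addnS addSn !exprSr; field; rewrite !gt_eqF// exprn_gt0.
  rewrite -mulr_sumr ler_wpM2l// /harm big_add1/= big_mkord.
  by case: (Q) Q0 => //= q _; rewrite big_ord_recr/= lerDl invr_ge0.
have -> : 2 ^+ M * (2 ^+ M + 4 ^+ M * K) * U%:R ^+ (2 * M) * (E + F) =
    2 ^+ M * (2 ^+ M * (U%:R ^+ (2 * M) * (E + F)) + 4 ^+ M * U%:R ^+ M * (K * U%:R ^+ M * (E + F))).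
  by rewrite mul2n -addnn exprD; ring.
apply: ler_wpM2l; first by sgn.
apply: lerD.
  have -> : (2 * U%:R ^+ 2 / Q%:R) ^+ M = 2 ^+ M * (U%:R ^+ (2 * M) * Q%:R ^- M) :> R.
    by rewrite exprM [in RHS]mulrA -exprMn -exprVn -exprMn.
  apply: ler_wpM2l; first by sgn.
  apply: ler_wpM2l; first by sgn.
  apply: (@le_trans _ _ Q%:R^-1); last by rewrite (le_trans E0)// lerDl.
  by rewrite lef_pV2 ?posrE ?exprn_gt0// ler_eXnr// ler1n.
rewrite exprMn [(4 * _) ^+ M]exprMn; apply: ler_wpM2l; first by sgn.
apply: le_trans avg.
by apply: (@power_mean j Q.-1 Q (fun h => Th h.+1)) => //; exact: leq_pred.
Qed.
End WeylInd.

Section WeylFinal.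
Variable R : realType.

Lemma harm_le_ln Q : (0 < Q)%N -> harm R Q <= 1 + ln Q%:R.
Proof.
case: Q => // Q _; rewrite /harm; elim: Q => [|Q IH].
  by rewrite big_nat1 invr1 ln1 addr0.
rewrite big_nat_recr//=; have := IH.
suff : (Q.+2%:R)^-1 <= ln Q.+2%:R - ln Q.+1%:R :> R.
  move: (ln Q.+1%:R) (ln Q.+2%:R) (Q.+2%:R^-1) (\sum_(1 <= h < Q.+2) _).
  by move=> p q r s; lra.
have Q2 : 0 < Q.+2%:R :> R by rewrite ltr0n.
have Q1 : 0 < Q.+1%:R :> R by rewrite ltr0n.
have := @le_ln1Dx R (- (Q.+2%:R)^-1).
have -> : 1 + - (Q.+2%:R)^-1 = Q.+1%:R / Q.+2%:R :> R.
  by rewrite -(natr1 Q.+1); field; apply: lt0r_neq0; move: (ler0n R Q); lra.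
rewrite ln_div ?posrE// => /(_ _)/Wrap[|[]]; last by move: (ln _) (ln _) (_^-1) => p q r; lra.
by rewrite ltrN2 invf_lt1// ltr1n.
Qed.

Lemma nat_root (j : nat) (Y : R) : (0 < j)%N -> 1 <= Y ->
  exists2 Q : nat, (0 < Q)%N & Q%:R ^+ j <= Y < Q.+1%:R ^+ j.
Proof.
move=> j0 Y1.
have ex : exists Q : nat, Q%:R ^+ j <= Y by exists 1%N; rewrite expr1n.
have ub Q : Q%:R ^+ j <= Y -> (Q <= Num.truncn Y)%N.
  move=> QY; rewrite -ltnS -(ltr_nat R) (le_lt_trans _ (truncnS_gt _))//.
  apply: le_trans QY; case: Q => [|Q]; first by rewrite expr0n; case: (j).
  by rewrite ler_eXnr// ler1n.
case: (ex_maxnP ex ub) => Q QY Qmax; exists Q.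
  by have := Qmax 1%N; rewrite expr1n => /(_ Y1).
rewrite QY ltNge; apply/negP => /Qmax; by rewrite ltnn.
Qed.

(** The phase X / u^i, with X between U^(i + 1/5) and U^kap, is differenced j = kap times. Writing U
    = w^(40 j) makes all sizes powers of w: y = U^(1/10) fits twice into the room above U^i, the
    harmonic sum is at most a constant times w, and the saving is w, hence D = 2^j * 40 j. *)
Lemma weyl_bound (i kap : nat) : (0 < i)%N -> (0 < kap)%N ->
  exists D : nat, exists2 C : R, (0 < D)%N /\ 0 < C &
  forall (U : nat) (X : R) a n, (0 < U)%N -> U%:R ^+ (5 * i).+1 <= X ^+ 5 -> 0 < X ->
    X <= U%:R ^+ kap -> (U <= a)%N -> (a + n <= 2 * U)%N ->
    `|\sum_(0 <= u < n) cos (X / (a + u)%:R ^+ i)| ^+ D <= C * U%:R ^+ D.-1.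
Proof.
move=> i0; case: kap => // j' _; set j := j'.+1.
have [K K0 H] := weyl_differencing R j.
pose P := (\prod_(l < j.+1) (i + l))%N.
pose W : R := (j ^ j + P)%:R.
pose C1 : R := 3 + 8 * 4 ^+ (i + j).+1 * 2 ^+ j * (41 * j)%:R ^+ j.
exists (2 ^ j * (40 * j))%N.
have C10 : 0 < C1 by rewrite addr_gt0//; sgn; rewrite ?expn_gt0//.
exists (W ^+ (40 * j) + (K * C1) ^+ (40 * j)).
  split; first by rewrite !muln_gt0 expn_gt0.
  by rewrite ltr_pwDr ?exprn_gt0 ?mulr_gt0// exprn_ge0.
set D := (2 ^ j * (40 * j))%N.
have D0 : (0 < D)%N by rewrite !muln_gt0 expn_gt0.
move=> U X a n U0 UX X0 XU Ua an.
have UR : 1 <= U%:R :> R by rewrite ler1n.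
have UR0 : 0 < U%:R :> R by rewrite ltr0n.
set T := `|_|.
have T0 : 0 <= T by exact: normr_ge0.
have UD : U%:R ^+ D = U%:R * U%:R ^+ D.-1 :> R by rewrite -exprS prednK.
have [w w1 wU] : exists2 w : R, 1 <= w & w ^+ (40 * j) = U%:R.
  exists (U%:R `^ (((40 * j)%N%:R)^-1)).
    have e0 : 0 <= ((40 * j)%N%:R)^-1 :> R by rewrite invr_ge0.
    by have := ge0_ler_powR e0 (ler01 : 1 \in Num.nneg) (ler0n R U : _ \in Num.nneg) UR; rewrite powR1.
  rewrite -powR_mulrn ?powR_ge0// -powRrM mulVf ?powRr1//.
  by rewrite pnatr_eq0 muln_eq0.
have w0 : 0 < w by apply: lt_le_trans w1.
have jpos : (0 < j)%N by [].
clearbody j.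
have TU : T <= U%:R.
  apply: le_trans (ler_norm_sum _ _ _) _.
  apply: (@le_trans _ _ (\sum_(0 <= u < n) 1)); first by apply: ler_sum => u _; exact: cos_max.
  by rewrite sumr_const_nat subn0 ler_nat; clear -Ua an; lia.
(* For small w the trivial bound U suffices; from W on, the constants j^j and P are at most y. *)
have [wW|Ww] := ltP w W.
  apply: (@le_trans _ _ (U%:R ^+ D)); first by rewrite lerXn2r ?nnegrE.
  rewrite UD; apply: ler_wpM2r; first by sgn.
  rewrite -wU; apply: (@le_trans _ _ (W ^+ (40 * j))).
    by rewrite lerXn2r ?nnegrE// ltW.
  by rewrite lerDl exprn_ge0// mulr_ge0// ltW.
pose y := w ^+ (4 * j).
have y0 : 0 < y by rewrite exprn_gt0.
have wy : w <= y by rewrite ler_eXnr// muln_gt0.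
have y1 : 1 <= y by apply: le_trans wy.
have y10 : y ^+ 10 = U%:R by rewrite -exprM -wU mulnAC.
have UiX : U%:R ^+ i * y ^+ 2 <= X.
  rewrite -(@ler_pXn2r _ 5)// ?nnegrE; [|by sgn|exact: ltW].
  by apply: le_trans UX; rewrite exprMn -[(y ^+ 2) ^+ 5]exprM (y10 : y ^+ (2 * 5) = _) -exprM -exprSr mulnC.
pose Y := U%:R ^+ (i + j) * y / X.
have XY : X * Y = U%:R ^+ (i + j) * y by rewrite /Y mulrC divfK// gt_eqF.
have YU : U%:R * y <= Y.
  rewrite /Y ler_pdivlMr//.
  have -> : U%:R ^+ (i + j) * y = U%:R ^+ i * y * U%:R ^+ j by rewrite exprD; ring.
  apply: ler_pM => //; [by sgn|by sgn|apply: ler_wpM2r; first by sgn].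
  by rewrite ler_eXnr.
have Y1 : 1 <= Y.
  by apply: le_trans YU; rewrite -[leLHS]mulr1 ler_pM.
have [Q Q0 /andP[QY YQ]] := nat_root jpos Y1.
have QR0 : 0 < Q%:R :> R by rewrite ltr0n.
have jQU : (j * Q <= U)%N.
  rewrite -(@leq_exp2r _ _ j)// -(ler_nat R) expnMn natrM !natrX.
  have YyU : Y * y <= U%:R ^+ j.
    rewrite /Y mulrAC ler_pdivrMr// exprD.
    have -> : U%:R ^+ i * U%:R ^+ j * y * y = U%:R ^+ j * (U%:R ^+ i * y ^+ 2) by ring.
    by apply: ler_wpM2l => //; sgn.
  have jy : (j ^ j)%N%:R <= y by rewrite (le_trans _ wy)// (le_trans _ Ww)// ler_nat leq_addr.
  apply: (@le_trans _ _ (y * Y)); last by rewrite mulrC.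
  rewrite -natrX.
  by apply: ler_pM => //; sgn.
have QU : (Q <= U)%N by apply: leq_trans jQU; rewrite leq_pmull.
have cm : cmon i 0 X (fun u => X * lprod R (nseq i 0) u).
  have := CMscale (ltW X0) (@CMprod R i 0 (nseq i 0%N) (size_nseq _ _) _).
  by rewrite mulr1; apply; apply/allP => c /nseqP[->].
have cond : (\prod_(l < j.+1) (i + l))%:R * X * Q%:R ^+ j <= 2 * U%:R ^+ (i + j).+1.
  apply: (@le_trans _ _ (P%:R * (X * Y))).
    by rewrite -mulrA; apply: ler_wpM2l => //; apply: ler_wpM2l => //; exact: ltW.
  rewrite XY mulrCA [leRHS](_ : _ = U%:R ^+ (i + j) * (2 * U%:R)); last by rewrite exprSr; ring.
  apply: ler_wpM2l; first by sgn.
  have Py : P%:R <= y by rewrite (le_trans _ wy)// (le_trans _ Ww)// ler_nat leq_addl.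
  rewrite -y10; apply: (@le_trans _ _ (y ^+ 2)); first by rewrite expr2 ler_wpM2r// ltW.
  have : y ^+ 2 <= y ^+ 10 by apply: ler_weXn2l.
  have : 0 <= y ^+ 10 by sgn.
  by move: (y ^+ 2) (y ^+ 10) => p q; lra.
have := H i 0%N X _ U Q a n i0 X0 _ cm Ua an _ cond.
rewrite Q0 QU add0n => /(_ isT jQU).
have -> : \sum_(0 <= u < n) cos (X * lprod R (nseq i 0) (a + u)) = \sum_(0 <= u < n) cos (X / (a + u)%:R ^+ i).
  apply: eq_bigr => u _; rewrite /lprod big_nseq addn0 -exprVn.
  by congr (cos (_ * _)); elim: (i) => // k IH; rewrite iterS IH exprS.
rewrite -/T => TB.
have {}TB : T ^+ (2 ^ j) <= K * U%:R ^+ (2 ^ j) * (C1 / w).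
  apply: le_trans TB _; apply: ler_wpM2l; first by apply: mulr_ge0; [exact: ltW|sgn].
  have QjY : Y <= 2 ^+ j * Q%:R ^+ j.
    rewrite -exprMn; apply: le_trans (ltW YQ) _; rewrite lerXn2r ?nnegrE ?mulr_ge0//.
    by rewrite -(natrM _ 2) ler_nat mul2n -addnn -addn1 leq_add2l.
  rewrite /C1 [(3 + _) / w]mulrDl; apply: lerD; last first.
    have -> : 8 * 4 ^+ (i + j).+1 * U%:R ^+ (i + j) * harm R Q ^+ j / (X * Q%:R ^+ j) =
      8 * 4 ^+ (i + j).+1 * ((Y / Q%:R ^+ j) * (harm R Q ^+ j / y)).
      have -> : U%:R ^+ (i + j) = X * Y / y by rewrite XY mulfK// gt_eqF.
      by field; rewrite !gt_eqF// exprn_gt0.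
    have -> : 8 * 4 ^+ (i + j).+1 * 2 ^+ j * (41 * j)%:R ^+ j / w =
      8 * 4 ^+ (i + j).+1 * (2 ^+ j * ((41 * j)%:R ^+ j / w)) by rewrite !mulrA.
    apply: ler_wpM2l; first by sgn.
    have h0 : 0 <= harm R Q by apply: sumr_ge0 => h _; rewrite invr_ge0.
    have hw : harm R Q <= (41 * j)%:R * w.
      apply: le_trans (harm_le_ln Q0) _.
      have : ln Q%:R <= ln (U%:R : R) by rewrite ler_ln ?posrE// ler_nat.
      have -> : ln U%:R = ln w * (40 * j)%:R by rewrite -wU lnXn// mulr_natr.
      move=> lnQ.
      have lw : ln w <= w by apply: ltW; exact: ln_sublinear.
      have : ln w * (40 * j)%:R <= w * (40 * j)%:R by apply: ler_wpM2r.
      have : 1 * 1 <= w * j%:R by apply: ler_pM => //; rewrite ler1n.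
      have aux (p q r v : R) : p <= q * (40 * r) -> 1 * 1 <= v * r ->
          q * (40 * r) <= v * (40 * r) -> 1 + p <= 41 * r * v by move=> *; lra.
      by move: lnQ; rewrite !natrM; exact: aux.
    have Y0 : 0 <= Y by apply: le_trans Y1.
    apply: ler_pM; [by sgn|by sgn| |].
      by rewrite ler_pdivrMr// exprn_gt0.
    apply: (@le_trans _ _ ((41 * j)%:R ^+ j * w ^+ j / y)).
      apply: ler_wpM2r; first by sgn.
      by rewrite -exprMn lerXn2r ?nnegrE// mulr_ge0// ltW.
    rewrite -mulrA; apply: ler_wpM2l; first by sgn.
    rewrite ler_pdivrMr// mulrC ler_pdivlMr// -exprSr.
    by apply: ler_weXn2l => //; clear -jpos; lia.
  have wQ : w <= 2 * Q%:R.
    rewrite -(@ler_pXn2r _ j)// ?nnegrE ?mulr_ge0//; last exact: ltW.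
    rewrite exprMn; apply: le_trans QjY; apply: le_trans YU.
    apply: (@le_trans _ _ y); first by apply: ler_weXn2l => //; clear -jpos; lia.
    by rewrite ler_peMl// ltW.
  have wUu : w <= U%:R.
    by rewrite -wU ler_eXnr// muln_gt0.
  have : Q%:R^-1 <= 2 / w by rewrite ler_pdivlMr// mulrC ler_pdivrMr.
  have : U%:R^-1 <= w^-1 by rewrite lef_pV2 ?posrE.
  by move: (Q%:R^-1) (U%:R^-1) (w^-1) => p q r; lra.
have -> : T ^+ D = (T ^+ (2 ^ j)) ^+ (40 * j) by rewrite -exprM.
apply: (@le_trans _ _ ((K * U%:R ^+ (2 ^ j) * (C1 / w)) ^+ (40 * j))).
  have T20 : 0 <= T ^+ (2 ^ j) by sgn.
  by rewrite lerXn2r ?nnegrE// (le_trans T20 TB).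
have -> : (K * U%:R ^+ (2 ^ j) * (C1 / w)) ^+ (40 * j) = (K * C1) ^+ (40 * j) * U%:R ^+ D.-1.
  rewrite !exprMn -exprM -/D UD exprVn wU; field; exact: lt0r_neq0.
apply: ler_wpM2r; first by sgn.
by rewrite lerDr exprn_ge0// ler0n.
Qed.
End WeylFinal.

(** * Vaughan's identity *)

Section Arith.
Variable R : realType.
Implicit Types (F G : nat -> R).

Definition mu (n : nat) : R :=
  \prod_(p <- primes n) (if logn p n == 1%N then -1 else 0).

Definition vonMangoldt (n : nat) : R := if primes n is [:: p] then ln p%:R else 0.
Local Notation Lam := vonMangoldt.

Lemma mu_norm_le1 n : `|mu n| <= 1.
Proof.
rewrite /mu; elim: (primes n) => [|p s IH]; first by rewrite big_nil normr1.
rewrite big_cons normrM; apply: mulr_ile1 => //.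
by case: ifP => _; rewrite ?normrN1 ?normr0.
Qed.

Lemma primes_mul_prime p n : prime p -> (0 < n)%N -> ~~ (p %| n)%N ->
  perm_eq (primes (p * n)) (p :: primes n).
Proof.
move=> pp n0 pn; apply: uniq_perm; rewrite ?primes_uniq//.
  by rewrite cons_uniq primes_uniq andbT mem_primes pp n0.
have p0 := prime_gt0 pp.
by move=> q; rewrite primesM// primes_prime// !inE.
Qed.

Lemma mu_mul_prime p n : prime p -> (0 < n)%N ->
  mu (p * n) = if (p %| n)%N then 0 else - mu n.
Proof.
move=> pp n0; have p0 := prime_gt0 pp; case: ifPn => pn.
  rewrite /mu (bigD1_seq p)/= ?primes_uniq//; last first.
    by rewrite mem_primes pp muln_gt0 p0 n0 dvdn_mulr.
  rewrite lognM// logn_prime// eqxx add1n eqSS.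
  by rewrite gtn_eqF ?mul0r// logn_gt0 mem_primes pp n0.
rewrite /mu (perm_big _ (primes_mul_prime pp n0 pn)) big_cons/=.
have pn0 : logn p n = 0%N by apply/eqP; rewrite -leqn0 leqNgt logn_gt0 mem_primes pp n0.
rewrite lognM// logn_prime// eqxx pn0 addn0 eqxx mulN1r; congr (- _).
apply: eq_big_seq => q; rewrite mem_primes => /and3P[qp _ qn].
rewrite lognM// logn_prime//.
by have [qe|] := eqVneq p q; [move: qn; rewrite -qe (negbTE pn)|rewrite add0n].
Qed.

(** For p the least prime factor, d and p d cancel when p does not divide d, and [mu] vanishes at
    the divisors p d with p | d. *)
Lemma sum_mu_divisors n : (0 < n)%N ->
  \sum_(d <- divisors n) mu d = (n == 1%N)%:R.
Proof.
have [->|n1] := eqVneq n 1%N; first by rewrite /= big_seq1 /mu /= big_nil.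
rename n into m => n0; have m1 : (1 < m)%N by rewrite ltn_neqAle eq_sym n1.
pose p := pdiv m; have pp : prime p by exact: pdiv_prime.
have p0 := prime_gt0 pp.
have pm : (p %| m)%N by exact: pdiv_dvd.
pose k := (m %/ p)%N.
have mpk : (m = p * k)%N by rewrite mulnC divnK.
have k0 : (0 < k)%N by rewrite divn_gt0 ?prime_gt0// dvdn_leq.
rewrite (bigID (fun d => p %| d)%N)/=.
rewrite -big_filter (perm_big (map (muln p) (divisors k))); last first.
  apply: uniq_perm; rewrite ?filter_uniq ?divisors_uniq//.
    by rewrite map_inj_uniq ?divisors_uniq// => a b /eqP; rewrite eqn_pmul2l ?prime_gt0// => /eqP.
  move=> d; rewrite mem_filter -dvdn_divisors//; apply/andP/mapP.
    move=> [/dvdnP[e ->]]; rewrite mpk mulnC dvdn_pmul2l ?prime_gt0// => ek.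
    by exists e; [rewrite -dvdn_divisors|rewrite mulnC].
  move=> [e]; rewrite -dvdn_divisors// => ek ->; rewrite dvdn_mulr//.
  by rewrite mpk dvdn_pmul2l ?prime_gt0.
rewrite big_map.
rewrite (eq_big_seq (fun d => if (p %| d)%N then 0 else - mu d)); last first.
  by move=> d; rewrite -dvdn_divisors// => dk; rewrite mu_mul_prime// (dvdn_gt0 k0).
rewrite -[X in _ + X]big_filter [X in _ + X](perm_big [seq d <- divisors k | ~~ (p %| d)%N]); last first.
  apply: uniq_perm; rewrite ?filter_uniq ?divisors_uniq//.
  move=> d; rewrite !mem_filter -!dvdn_divisors//; case pd: (p %| d)%N => //=.
  by rewrite mpk Gauss_dvdr// coprime_sym prime_coprime// pd.
rewrite big_filter [X in _ + X]big_mkcond -big_split/= big1// => d _.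
by case: ifP; rewrite /= ?addr0 ?addNr.
Qed.

Lemma vonMangoldt_ge0 n : 0 <= Lam n.
Proof.
rewrite /Lam; case E : (primes n) => [|p [|//]] //.
apply: ln_ge0; rewrite ler1n.
have : p \in primes n by rewrite E inE.
by rewrite mem_primes => /andP[/prime_gt0].
Qed.

Lemma vonMangoldt_pfactor p e : prime p -> (0 < e)%N -> Lam (p ^ e) = ln p%:R.
Proof. by move=> pp e0; rewrite /Lam primesX// primes_prime. Qed.

(** Induction through n = p k with p the least prime factor: the only prime power dividing n but not
    k is p^e with e = [logn p n], and its weight ln p is the increment. *)
Lemma sum_vonMangoldt n : (0 < n)%N -> \sum_(d <- divisors n) Lam d = ln n%:R.
Proof.
have [m] := ubnP n; elim: m n => // m IH q; have [->|q1] := eqVneq q 1%N.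
  by rewrite /= big_seq1 /Lam /= ln1.
rewrite ltnS => nm n0; have m1 : (1 < q)%N by rewrite ltn_neqAle eq_sym q1.
pose p := pdiv q; have pp : prime p by exact: pdiv_prime.
have p0 := prime_gt0 pp.
have pm : (p %| q)%N by exact: pdiv_dvd.
pose k := (q %/ p)%N.
have mpk : (q = p * k)%N by rewrite mulnC divnK.
have k0 : (0 < k)%N by rewrite divn_gt0 ?prime_gt0// dvdn_leq.
have kq : (k < q)%N by rewrite /k ltn_Pdiv// prime_gt1.
rewrite (bigID (fun d => d %| k)%N)/= -big_filter (perm_big (divisors k)); last first.
  apply: uniq_perm; rewrite ?filter_uniq ?divisors_uniq// => d.
  rewrite mem_filter -!dvdn_divisors//; apply: andb_idr => dk.
  by rewrite mpk dvdn_mull.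
rewrite IH//; last exact: leq_trans kq nm.
have -> : ln q%:R = ln k%:R + ln p%:R :> R.
  by rewrite mpk natrM lnM ?posrE ?ltr0n// addrC.
congr (_ + _).
pose e := logn p q.
have e0 : (0 < e)%N by rewrite logn_gt0 mem_primes pp n0.
have ek : logn p k = e.-1. by rewrite /e [in RHS]mpk lognM// (logn_prime _ pp) eqxx add1n.
have peq : (p ^ e %| q)%N by rewrite pfactor_dvdnn.
have pek : ~~ (p ^ e %| k)%N by rewrite pfactor_dvdn// ek -ltnNge prednK.
rewrite big_mkcond (bigD1_seq (p ^ e)%N)/= ?divisors_uniq//; last by rewrite -dvdn_divisors.
rewrite pek vonMangoldt_pfactor// big1_seq ?addr0// => d /andP[dpe].
rewrite -dvdn_divisors// => dq; case: ifPn => // dk.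
rewrite /Lam; case E : (primes d) => [//|r [|//]].
have d0 : (0 < d)%N by apply: dvdn_gt0 dq.
have : r \in primes d by rewrite E inE.
rewrite mem_primes => /and3P[rp _ rd].
have dr : d = (r ^ logn r d)%N.
  by rewrite {1}(prod_prime_decomp d0) prime_decompE E /= big_seq1.
have [rpe|rp'] := eqVneq r p; last first.
  move: dk; rewrite -(@Gauss_dvdr d p k) -?mpk ?dq//.
  rewrite dr coprimeXl// prime_coprime//.
  by apply: contra rp'; rewrite dvdn_prime2.
have le1 : (logn r d <= e)%N by rewrite /e -rpe; apply: dvdn_leq_log.
have : (e.-1 < logn r d)%N.
  by move: dk; rewrite {1}dr rpe pfactor_dvdn// ek -ltnNge.
rewrite prednK// => le2.
by move: dpe; rewrite dr rpe (_ : logn p d = e) ?eqxx//; apply/eqP; rewrite eqn_leq -{1}rpe le1 -rpe.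
Qed.

Lemma divisors_range n B F : (0 < n < B)%N ->
  \sum_(d <- divisors n) F d = \sum_(1 <= d < B | (d %| n)%N) F d.
Proof.
move=> /andP[n0 nB]; rewrite -[RHS]big_filter; apply: perm_big.
apply: uniq_perm; rewrite ?filter_uniq ?divisors_uniq ?iota_uniq// => d.
rewrite mem_filter -dvdn_divisors// mem_index_iota.
case dn : (d %| n)%N => //=; symmetry; apply/andP; split; first exact: dvdn_gt0 dn.
by apply: leq_ltn_trans nB; exact: dvdn_leq.
Qed.

(** For fixed c the sum of [mu b] runs over the divisors of u / c, so only c = u survives. *)
Lemma mobius_inversion u B F : (0 < u < B)%N ->
  \sum_(1 <= b < B) \sum_(1 <= c < B | (b * c %| u)%N) mu b * F c = F u.
Proof.
move=> uB; have /andP[u0 uB'] := uB.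
rewrite (exchange_big_dep predT)//=.
rewrite (bigD1_seq u)/= ?iota_uniq//; last by rewrite mem_index_iota u0.
rewrite (eq_bigl (fun b => b == 1%N)); last first.
  by move=> b; rewrite -{2}[u]mul1n dvdn_pmul2r// dvdn1.
have B1 : (1 < B)%N by apply: leq_ltn_trans uB'.
rewrite big_mkcond big_ltn//= /mu /= big_nil mul1r big1_seq ?addr0; last first.
  by move=> b; rewrite mem_index_iota => /andP[_ /andP[b1 _]]; rewrite gtn_eqF.
rewrite big1_seq ?addr0// => c /andP[cu]; rewrite mem_index_iota => /andP[c0 cB].
have [cdu|cdu] := boolP (c %| u)%N; last first.
  rewrite big_pred0// => b; apply/negbTE; apply: contra cdu; apply: dvdn_trans.
  exact: dvdn_mull.
rewrite -mulr_suml (eq_bigl (fun b => b %| u %/ c)%N); last by move=> b; rewrite dvdn_divRL.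
rewrite -(@divisors_range _ B mu); last first.
  by rewrite divn_gt0// dvdn_leq//= (leq_ltn_trans _ uB')// leq_div.
rewrite sum_mu_divisors; last by rewrite divn_gt0// dvdn_leq.
rewrite gtn_eqF ?mul0r// ltn_divRL// mul1n ltn_neqAle cu dvdn_leq//.
Qed.

Lemma sum_multiples b P Q F : (0 < b)%N ->
  \sum_(P.+1 <= u < Q.+1 | (b %| u)%N) F u =
  \sum_((P %/ b).+1 <= v < (Q %/ b).+1) F (b * v)%N.
Proof.
move=> b0; rewrite -[LHS]big_filter -[RHS](big_map (muln b) predT F); apply: perm_big.
apply: uniq_perm; rewrite ?filter_uniq ?iota_uniq//.
  by rewrite map_inj_uniq ?iota_uniq// => x y /eqP; rewrite eqn_pmul2l// => /eqP.
move=> u; rewrite mem_filter mem_index_iota; apply/andP/mapP.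
  move=> [/dvdnP[v ->] /andP[Pv vQ]]; exists v; last by rewrite mulnC.
  by rewrite mem_index_iota ltn_divLR// Pv ltnS leq_divRL.
move=> [v]; rewrite mem_index_iota ltn_divLR// ltnS leq_divRL// => /andP[Pv vQ] ->.
by rewrite dvdn_mulr// mulnC Pv ltnS.
Qed.
End Arith.

Section Vaughan.
Variable R : realType.
Implicit Types (g F : nat -> R).
Local Notation Lam := (vonMangoldt R).
Local Notation mu := (mu R).

(* B is only a cut-off beyond all divisors in play. *)
Definition vbeta z B n : R := \sum_(z.+1 <= c < B | (c %| n)%N) Lam c.

Lemma sum_ln_quotient b u B : (0 < b)%N -> (0 < u < B)%N ->
  \sum_(1 <= c < B | (b * c %| u)%N) Lam c = if (b %| u)%N then ln (u %/ b)%:R else 0.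
Proof.
move=> b0 /andP[u0 uB]; case: ifPn => bu; last first.
  by rewrite big_pred0// => c; apply/negbTE; apply: contra bu; apply: dvdn_trans; exact: dvdn_mulr.
have q0 : (0 < u %/ b)%N by rewrite divn_gt0// dvdn_leq.
rewrite -sum_vonMangoldt// (@divisors_range _ _ B); last by rewrite q0 (leq_ltn_trans (leq_div _ _)).
by apply: eq_bigl => c; rewrite mulnC dvdn_divRL.
Qed.

(** Lambda is the Dirichlet convolution of mu, 1 and Lambda, here cut at z in both outer factors.
    The part with b > z, c <= z is traded for minus the part with b, c <= z: their sum is the
    inversion formula for Lambda truncated at z, which vanishes at u > z. *)
Lemma vaughan_identity z u B : (z < u < B)%N ->
  Lam u = \sum_(1 <= b < z.+1 | (b %| u)%N) mu b * ln (u %/ b)%:R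
   - \sum_(1 <= b < z.+1) \sum_(1 <= c < z.+1 | (b * c %| u)%N) mu b * Lam c
   + \sum_(z.+1 <= b < B | (b %| u)%N) mu b * vbeta z B (u %/ b).
Proof.
move=> /andP[zu uB]; have u0 : (0 < u)%N by apply: leq_ltn_trans zu.
have zB : (z.+1 <= B)%N by apply: leq_trans (ltnW uB).
have uB' : (0 < u < B)%N by rewrite u0.
pose A b : R := \sum_(1 <= c < B | (b * c %| u)%N) Lam c.
pose A1 b : R := \sum_(1 <= c < z.+1 | (b * c %| u)%N) Lam c.
pose A2 b : R := \sum_(z.+1 <= c < B | (b * c %| u)%N) Lam c.
have A12 b : A b = A1 b + A2 b by rewrite /A (@big_cat_nat _ _ _ z.+1).
have AE : Lam u = \sum_(1 <= b < B) mu b * A b.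
  rewrite -(mobius_inversion Lam uB'); apply: eq_bigr => b _.
  by rewrite mulr_sumr.
have A1E : 0 = \sum_(1 <= b < B) mu b * A1 b.
  have H := @mobius_inversion R u B (fun c => if (c <= z)%N then Lam c else 0) uB'.
  rewrite leqNgt zu /= in H; rewrite -[LHS]H; apply: eq_bigr => b _.
  rewrite /A1 mulr_sumr (@big_cat_nat _ _ _ z.+1)//=.
  rewrite [X in _ + X]big1_seq ?addr0; last first.
    move=> c; rewrite mem_index_iota => /andP[_ /andP[zc _]].
    by rewrite leqNgt zc mulr0.
  rewrite [LHS]big_nat_cond [RHS]big_nat_cond; apply: eq_bigr => c /andP[/andP[_]].
  by rewrite ltnS => ->.
have split (F : nat -> R) : \sum_(1 <= b < B) F b = \sum_(1 <= b < z.+1) F b + \sum_(z.+1 <= b < B) F b.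
  by rewrite (@big_cat_nat _ _ _ z.+1).
rewrite AE split.
have -> : \sum_(z.+1 <= b < B) mu b * A b = - \sum_(1 <= b < z.+1) mu b * A1 b +
    \sum_(z.+1 <= b < B) mu b * A2 b.
  rewrite split in A1E.
  have -> : \sum_(z.+1 <= b < B) mu b * A b = \sum_(z.+1 <= b < B) mu b * A1 b + \sum_(z.+1 <= b < B) mu b * A2 b.
    by rewrite -big_split/=; apply: eq_bigr => b _; rewrite A12 mulrDr.
  by move: A1E; move: (\sum_(z.+1 <= b < B) mu b * A1 b) => p /eqP; rewrite eq_sym addrC addr_eq0 => /eqP ->.
rewrite addrA; congr (_ - _ + _).
- rewrite [RHS]big_mkcond; apply: eq_big_nat => b /andP[b0 _].
  by rewrite /A sum_ln_quotient//; case: ifP => //; rewrite mulr0.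
- by apply: eq_bigr => b _; rewrite mulr_sumr.
- rewrite [RHS]big_mkcond; apply: eq_big_nat => b /andP[b0 _].
  have b0' : (0 < b)%N by apply: leq_trans b0.
  case: ifPn => bu.
    by congr (_ * _); apply: eq_bigl => c; rewrite mulnC dvdn_divRL.
  rewrite /A2 big_pred0 ?mulr0// => c; apply/negbTE; apply: contra bu; apply: dvdn_trans.
  exact: dvdn_mulr.
Qed.

Lemma vaughan_sum P z g : (0 < z <= P)%N ->
  \sum_(P.+1 <= u < (2 * P).+1) Lam u * g u =
  \sum_(1 <= b < z.+1) mu b * (\sum_((P %/ b).+1 <= v < (2 * P %/ b).+1) ln v%:R * g (b * v)%N)
  - \sum_(1 <= b < z.+1) \sum_(1 <= c < z.+1) mu b * Lam c *
      (\sum_((P %/ (b * c)).+1 <= v < (2 * P %/ (b * c)).+1) g (b * c * v)%N)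
  + \sum_(z.+1 <= b < (2 * P).+1) mu b *
      (\sum_((P %/ b).+1 <= v < (2 * P %/ b).+1) vbeta z (2 * P).+1 v * g (b * v)%N).
Proof.
move=> /andP[z0 zP].
rewrite (@eq_big_nat _ _ _ _ _ _ (fun u =>
   (\sum_(1 <= b < z.+1 | (b %| u)%N) mu b * ln (u %/ b)%:R * g u)
   - \sum_(1 <= b < z.+1) \sum_(1 <= c < z.+1 | (b * c %| u)%N) mu b * Lam c * g u
   + \sum_(z.+1 <= b < (2 * P).+1 | (b %| u)%N) mu b * vbeta z (2 * P).+1 (u %/ b) * g u)); last first.
  move=> u /andP[Pu uP]; rewrite (@vaughan_identity z u (2 * P).+1); last first.
    by rewrite uP (leq_ltn_trans zP).
  rewrite mulrDl mulrBl !mulr_suml; congr (_ - _ + _).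
  by apply: eq_bigr => b _; rewrite mulr_suml.
rewrite big_split/= sumrB; congr (_ - _ + _).
- rewrite (exchange_big_dep predT)//=; apply: eq_big_nat => b /andP[b0 _].
  rewrite (@sum_multiples _ b P (2 * P) (fun u => mu b * ln (u %/ b)%:R * g u))// mulr_sumr.
  by apply: eq_bigr => v _; rewrite mulKn// mulrA.
- rewrite (exchange_big_dep predT)//=; apply: eq_big_nat => b /andP[b0 _].
  rewrite (exchange_big_dep predT)//=; apply: eq_big_nat => c /andP[c0 _].
  rewrite (@sum_multiples _ (b * c) P (2 * P) (fun u => mu b * Lam c * g u))// ?muln_gt0 ?b0//.
  by rewrite mulr_sumr.
- rewrite (exchange_big_dep predT)//=; apply: eq_big_nat => b /andP[b0 _].
  have b0' : (0 < b)%N by apply: leq_trans b0.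
  rewrite (@sum_multiples _ b P (2 * P) (fun u => mu b * vbeta z (2 * P).+1 (u %/ b) * g u))// mulr_sumr.
  by apply: eq_bigr => v _; rewrite mulKn// mulrA.
Qed.

Lemma vbeta_bounds z B n : (0 < n)%N -> 0 <= vbeta z B n <= ln n%:R.
Proof.
move=> n0; apply/andP; split.
  by apply: sumr_ge0 => c _; exact: vonMangoldt_ge0.
rewrite -sum_vonMangoldt// (@divisors_range _ _ (maxn B (maxn z.+1 n.+1))); last first.
  by rewrite n0/= !leq_max leqnn !orbT.
rewrite [leRHS](@big_cat_nat _ _ _ z.+1)//=; last by rewrite !leq_max leqnn orbT.
rewrite -[leLHS]add0r; apply: lerD; first by apply: sumr_ge0 => c _; exact: vonMangoldt_ge0.
have [zB|Bz] := leqP z.+1 B; last first.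
  rewrite [leLHS]big_geq; last exact: ltnW.
  by apply: sumr_ge0 => c _; exact: vonMangoldt_ge0.
rewrite [leRHS](@big_cat_nat _ _ _ B)//=; last by rewrite leq_max leqnn.
by rewrite lerDl sumr_ge0// => c _; exact: vonMangoldt_ge0.
Qed.

Lemma dyadic_split F z I :
  \sum_(z.+1 <= n < (z * 2 ^ I).+1) F n =
  \sum_(i < I) \sum_((z * 2 ^ i).+1 <= n < (2 * (z * 2 ^ i)).+1) F n.
Proof.
elim: I => [|I IH]; first by rewrite big_ord0 muln1 big_geq.
rewrite big_ord_recr/= -IH expnS mulnCA (@big_cat_nat _ _ _ (z * 2 ^ I).+1)//= ltnS.
  by rewrite leq_pmulr// expn_gt0.
by rewrite leq_pmull.
Qed.
End Vaughan.

Section VaughanBound.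
Variable R : realType.
Local Notation Lam := (vonMangoldt R).
Local Notation mu := (mu R).

Lemma ln2_bounds : 2^-1 <= ln (2 : R) <= 1.
Proof.
apply/andP; split.
  have := @le_ln1Dx R (- 2^-1).
  have -> : 1 + - 2^-1 = 2^-1 :> R by lra.
  rewrite lnV ?posrE// => /(_ _)/Wrap[|[]]; lra.
have := @le_ln1Dx R 1; have -> : 1 + 1 = 2 :> R by lra.
by move=> /(_ _)/Wrap[|[]]//; lra.
Qed.

Variables (P z : nat) (X r : R).
Hypotheses (z0 : (0 < z)%N) (zP : (z <= P)%N) (r1 : 1 <= r) (rz : r ^+ 2 <= z%:R).
(** [HI] treats sums over the multiples of d, with d up to z^2 because d = b c occurs. [HII] treats
    two rows n, m of one dyadic block, which remain when a square is opened. Both save r^2, of which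
    the square root survives in the bilinear sum. *)
Hypothesis HI : forall d n, (0 < d <= z * z)%N -> (n <= 2 * P %/ d - P %/ d)%N ->
  `|\sum_(0 <= u < n) cos (X / (d * ((P %/ d).+1 + u))%:R)| <= P%:R / d%:R / r ^+ 2.
Hypothesis HII : forall n m, (z < n)%N -> (z < m)%N -> n != m -> (n <= 2 * m)%N -> (m <= 2 * n)%N ->
  `|\sum_(z.+1 <= b < (2 * P).+1 | (P < b * n <= 2 * P)%N && (P < b * m <= 2 * P)%N)
     cos (X / (b * n)%:R - X / (b * m)%:R)| <= P%:R / n%:R / r ^+ 2.

Let L : R := 1 + ln (2 * P)%:R.
Let s : R := r ^+ 2.
Let g (u : nat) : R := cos (X / u%:R).
Let P0 : (0 < P)%N. Proof. exact: leq_trans zP. Qed.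
Let L1 : 1 <= L.
Proof. by rewrite /L lerDl ln_ge0// ler1n muln_gt0. Qed.
Let s1 : 1 <= s. Proof. by rewrite exprn_ege1. Qed.
Let ln_le_L n : (0 < n <= 2 * (2 * P))%N -> ln (n%:R : R) <= L.
Proof.
move=> /andP[n0 nP]; have /andP[_ l2] := ln2_bounds.
apply: (@le_trans _ _ (ln (2 * (2 * P)%N%:R))).
  by rewrite ler_ln ?posrE -?natrM ?ler_nat// ltr0n// !muln_gt0.
by rewrite lnM ?posrE ?ltr0n ?muln_gt0// lerD2r.
Qed.

Let harm_le_L : harm R z <= L.
Proof.
apply: le_trans (harm_le_ln R z0) _; rewrite lerD2l ler_ln ?posrE ?ltr0n ?muln_gt0//.
by rewrite ler_nat (leq_trans zP)// leq_pmull.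
Qed.

Let s0 : 0 < s. Proof. exact: lt_le_trans s1. Qed.
Let L0 : 0 < L. Proof. exact: lt_le_trans L1. Qed.

(** The logarithm is monotone, so summation by parts removes it at the price of 2 L; the sum of 1 /
    b costs another L. *)
Lemma vaughan_typeI1 :
  `|\sum_(1 <= b < z.+1) mu b * (\sum_((P %/ b).+1 <= v < (2 * P %/ b).+1) ln v%:R * g (b * v)%N)|
  <= 2 * L ^+ 2 * P%:R / s.
Proof.
apply: le_trans (ler_norm_sum _ _ _) _.
apply: (@le_trans _ _ (\sum_(1 <= b < z.+1) (2 * L * P%:R / s) * (b%:R)^-1)); last first.
  rewrite -mulr_sumr -/(harm R z).
  have -> : 2 * L ^+ 2 * P%:R / s = (2 * L * P%:R / s) * L by ring.
  by apply: ler_wpM2l => //; sgn.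
apply: ler_sum_nat => b /andP[b0 bz].
rewrite normrM -[leRHS]mul1r; apply: ler_pM => //; first exact: mu_norm_le1.
rewrite -{1}[(P %/ b).+1]add0n big_addn subSS big_mkord.
have db : (0 < b <= z * z)%N.
  by rewrite b0 (leq_trans (_ : b <= z)%N)// leq_pmulr.
have := @abel_nondecr R (fun u => ln ((u + (P %/ b).+1)%N%:R)) (fun u => g (b * (u + (P %/ b).+1))%N)
  (2 * P %/ b - P %/ b) L (P%:R / b%:R / s) (ltW L0).
case/(_ _ _ _)/Wrap => [u un|u un|m mn|[H]].
- by rewrite ler_ln ?posrE ?ltr0n ?addnS// ler_nat.
- rewrite ln_ge0 ?ler1n ?addnS//= ln_le_L//=.
  rewrite -addnS; apply: (@leq_trans (2 * P %/ b)); first by clear -un; lia.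
  by apply: leq_trans (leq_div _ _) _; rewrite leq_pmull.
- have := HI db mn; rewrite big_mkord.
  by under eq_bigr do rewrite addnC.
apply: le_trans H _.
by rewrite le_eqVlt; apply/orP; left; apply/eqP; ring.
Qed.

Lemma vaughan_typeI2 :
  `|\sum_(1 <= b < z.+1) \sum_(1 <= c < z.+1) mu b * Lam c *
      (\sum_((P %/ (b * c)).+1 <= v < (2 * P %/ (b * c)).+1) g (b * c * v)%N)|
  <= L ^+ 3 * P%:R / s.
Proof.
apply: le_trans (ler_norm_sum _ _ _) _.
apply: (@le_trans _ _ (\sum_(1 <= b < z.+1) (L * P%:R / s * L) * (b%:R)^-1)); last first.
  rewrite -mulr_sumr -/(harm R z).
  have -> : L ^+ 3 * P%:R / s = (L * P%:R / s * L) * L by ring.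
  by apply: ler_wpM2l => //; sgn.
apply: ler_sum_nat => b /andP[b0 bz].
apply: le_trans (ler_norm_sum _ _ _) _.
apply: (@le_trans _ _ (\sum_(1 <= c < z.+1) (L * P%:R / s / b%:R) * (c%:R)^-1)); last first.
  rewrite -mulr_sumr -/(harm R z).
  have -> : L * P%:R / s * L / b%:R = (L * P%:R / s / b%:R) * L by ring.
  by apply: ler_wpM2l => //; sgn.
apply: ler_sum_nat => c /andP[c0 cz].
have db : (0 < b * c <= z * z)%N by rewrite muln_gt0 b0 c0/= leq_mul.
rewrite -{1}[(P %/ (b * c)).+1]add0n big_addn subSS.
have -> : L * P%:R / s / b%:R / c%:R = L * (P%:R / (b * c)%N%:R / s).
  by rewrite natrM; field; rewrite !gt_eqF// ltr0n.
rewrite normrM; apply: ler_pM => //.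
  rewrite normrM -[leRHS]mul1r; apply: ler_pM => //; first exact: mu_norm_le1.
  rewrite ger0_norm ?vonMangoldt_ge0//.
  apply: (@le_trans _ _ (ln c%:R)).
    rewrite -sum_vonMangoldt// (bigD1_seq c)/= ?divisors_uniq -?dvdn_divisors//.
    by rewrite lerDl sumr_ge0// => i _; exact: vonMangoldt_ge0.
  rewrite ln_le_L// c0/=; clear -cz zP; lia.
have := HI db (leqnn _).
by under eq_bigr do rewrite addnC.
Qed.

Let blk C : R := \sum_(z.+1 <= b < (2 * P).+1) mu b *
   \sum_(C.+1 <= n < (2 * C).+1 | (P < b * n <= 2 * P)%N) vbeta R z (2 * P).+1 n * g (b * n)%N.

(** Cauchy-Schwarz over b removes [mu]; at most 2 P / C values of b matter, since n > C. The square
    is opened over pairs n, m: the C diagonal terms cost 2 P / C each, the other pairs save s = r^2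
    by [HII]. As s <= z <= C, the diagonal is of no larger order, and the square root leaves the
    saving r. *)
Lemma vaughan_block C : (z <= C < 2 * P)%N -> `|blk C| <= 3 * P%:R * L / r.
Proof.
move=> /andP[zC CP].
have C0 : (0 < C)%N by apply: leq_trans zC.
have CR : 0 < C%:R :> R by rewrite ltr0n.
have r0 : 0 < r by apply: lt_le_trans r1.
pose be n := vbeta R z (2 * P).+1 n.
have be0 n : (C < n)%N -> 0 <= be n.
  by move=> Cn; have /andP[] := @vbeta_bounds R z (2 * P).+1 n (leq_ltn_trans (leq0n _) Cn).
have beL n : (C < n <= 2 * C)%N -> be n <= L.
  move=> /andP[Cn nC]; have n0 := leq_ltn_trans (leq0n _) Cn.
  have /andP[_ /le_trans] := @vbeta_bounds R z (2 * P).+1 n n0; apply.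
  rewrite ln_le_L// n0 (leq_trans nC)// leq_mul2l ltnW//.
pose q b n := (P < b * n <= 2 * P)%N.
pose inn b : R := \sum_(C.+1 <= n < (2 * C).+1 | q b n) be n * g (b * n)%N.
pose Bc := (2 * P %/ C)%N.
have inn0 b : (Bc < b)%N -> inn b = 0.
  move=> bB; rewrite /inn big_nat_cond big_pred0// => n; apply/negbTE/negP => /andP[/andP[Cn _] /andP[_ bn]].
  move: bB; rewrite /Bc ltn_divLR// => /leq_trans - /(_ (b * n)%N).
  by rewrite leq_mul2l ltnW ?orbT// => /(_ isT); rewrite ltnNge bn.
have blkE : blk C = \sum_(z.+1 <= b < (2 * P).+1 | (b <= Bc)%N) mu b * inn b.
  rewrite /blk [RHS]big_mkcond; apply: eq_bigr => b _; case: leqP => // /inn0.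
  by rewrite /inn => ->; rewrite mulr0.
have sq : blk C ^+ 2 <= 9 * P%:R ^+ 2 * L ^+ 2 / s.
  rewrite blkE; apply: le_trans (cauchy_schwarz_sum _ _ _ _) _.
  have BcR : Bc%:R <= 2 * P%:R / C%:R :> R.
    by rewrite ler_pdivlMr// -!natrM ler_nat leq_trunc_div.
  have S1 : \sum_(z.+1 <= b < (2 * P).+1 | (b <= Bc)%N) mu b ^+ 2 <= 2 * P%:R / C%:R.
    apply: (@le_trans _ _ (\sum_(1 <= b < Bc.+1) 1)); last first.
      by rewrite sumr_const_nat subSS subn0.
    apply: (@le_trans _ _ (\sum_(z.+1 <= b < (2 * P).+1 | (b <= Bc)%N) 1)).
      by apply: ler_sum => b _; rewrite -real_normK ?num_real// exprn_ile1// mu_norm_le1.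
    rewrite !big_const_seq !iter_addr_0 ler_nat.
    rewrite -!size_filter; apply: uniq_leq_size; first by rewrite filter_uniq// iota_uniq.
    move=> b; rewrite !mem_filter !mem_index_iota /= => /andP[bBc /andP[zb _]].
    by rewrite ltnS bBc (leq_ltn_trans _ zb).
  have S2 : \sum_(z.+1 <= b < (2 * P).+1 | (b <= Bc)%N) inn b ^+ 2 <=
      C%:R * (L ^+ 2 * (2 * P%:R / C%:R) + C%:R * (L ^+ 2 * (P%:R / C%:R / s))).
    pose D n m : R := \sum_(z.+1 <= b < (2 * P).+1 | q b n && q b m) cos (X / (b * n)%:R - X / (b * m)%:R).
    apply: (@le_trans _ _ (\sum_(C.+1 <= n < (2 * C).+1) \sum_(C.+1 <= m < (2 * C).+1)
        be n * be m * D n m)).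
      apply: (@le_trans _ _ (\sum_(z.+1 <= b < (2 * P).+1) \sum_(C.+1 <= n < (2 * C).+1 | q b n)
        \sum_(C.+1 <= m < (2 * C).+1 | q b m) be n * be m * cos (X / (b * n)%:R - X / (b * m)%:R))).
        rewrite big_mkcond; apply: ler_sum => b _.
        (* As in van der Corput's inequality, the sine part completes the square. *)
        pose ins : R := \sum_(C.+1 <= n < (2 * C).+1 | q b n) be n * sin (X / (b * n)%:R).
        have -> : \sum_(C.+1 <= n < (2 * C).+1 | q b n)
          \sum_(C.+1 <= m < (2 * C).+1 | q b m) be n * be m * cos (X / (b * n)%:R - X / (b * m)%:R)
           = inn b ^+ 2 + ins ^+ 2.
          rewrite !expr2 {1}/inn {1}/ins !mulr_suml -big_split/=; apply: eq_bigr => n _.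
          rewrite /inn /ins !mulr_sumr -big_split/=; apply: eq_bigr => m _.
          by rewrite cosB /g; ring.
        by case: ifP => _; rewrite ?lerDl ?addr_ge0// sqr_ge0.
      rewrite le_eqVlt; apply/orP; left; apply/eqP.
      rewrite (exchange_big_dep predT)//=; apply: eq_bigr => n _.
      rewrite (exchange_big_dep predT)//=; apply: eq_bigr => m _.
      by rewrite /D; move: (be n * be m) => w; rewrite mulr_sumr.
    apply: (@le_trans _ _ (\sum_(C.+1 <= n < (2 * C).+1)
       (L ^+ 2 * (2 * P%:R / C%:R) + C%:R * (L ^+ 2 * (P%:R / C%:R / s))))); last first.
      by rewrite sumr_const_nat subSS mul2n -addnn addnK -[leLHS]mulr_natl.
    apply: ler_sum_nat => n /andP[Cn]; rewrite ltnS => nC.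
    have Dnn : `|D n n| <= 2 * P%:R / C%:R.
      apply: le_trans (ler_norm_sum _ _ _) _; apply: le_trans BcR.
      apply: (@le_trans _ _ (\sum_(1 <= b < Bc.+1) 1)); last first.
        by rewrite sumr_const_nat subSS subn0.
      apply: (@le_trans _ _ (\sum_(z.+1 <= b < (2 * P).+1 | q b n && q b n) 1)).
        by apply: ler_sum => b _; exact: cos_max.
      rewrite !big_const_seq !iter_addr_0 ler_nat.
      rewrite -!size_filter; apply: uniq_leq_size; first by rewrite filter_uniq// iota_uniq.
      move=> b; rewrite !mem_filter !mem_index_iota /= andbb => /andP[/andP[_ bn] /andP[zb _]].
      by rewrite (leq_ltn_trans _ zb)//= ltnS /Bc leq_divRL// (leq_trans _ bn)// leq_mul2l ltnW ?orbT.
    have Dnm m : (C < m <= 2 * C)%N -> n != m -> `|D n m| <= P%:R / C%:R / s.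
      move=> /andP[Cm mC] nm.
      apply: le_trans (HII _ _ nm _ _) _.
      - exact: leq_ltn_trans Cn.
      - exact: leq_ltn_trans Cm.
      - by clear -Cm nC; lia.
      - by clear -Cn mC; lia.
      rewrite ler_pM2r ?invr_gt0// ler_wpM2l//.
      by rewrite lef_pV2 ?posrE// ?ltr0n ?(leq_ltn_trans _ Cn)// ler_nat ltnW.
    have term m (T : R) : (C < m <= 2 * C)%N -> `|D n m| <= T -> be n * be m * D n m <= L ^+ 2 * T.
      move=> /andP[Cm mC] DT; apply: le_trans (ler_norm _) _.
      rewrite !normrM expr2; apply: ler_pM => //.
      have bn := be0 n Cn; have bm := be0 m Cm.
      rewrite !ger0_norm//; apply: ler_pM => //; apply: beL; first by rewrite Cn.
      by rewrite Cm.
    rewrite (bigD1_seq n)/= ?iota_uniq//; last by rewrite mem_index_iota Cn.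
    apply: lerD; first by apply: term => //; rewrite Cn.
    apply: (@le_trans _ _ (\sum_(C.+1 <= m < (2 * C).+1) L ^+ 2 * (P%:R / C%:R / s))); last first.
      by rewrite sumr_const_nat subSS mul2n -addnn addnK -[leLHS]mulr_natl.
    have T0 : 0 <= L ^+ 2 * (P%:R / C%:R / s) by sgn.
    rewrite big_mkcond big_seq [leRHS]big_seq; apply: ler_sum => m; rewrite mem_index_iota ltnS => mC.
    case: ifP => // mn; apply: term => //; apply: Dnm => //; by rewrite eq_sym.
  have S20 : 0 <= \sum_(z.+1 <= b < (2 * P).+1 | (b <= Bc)%N) inn b ^+ 2.
    by apply: sumr_ge0 => b _; exact: sqr_ge0.
  have S10 : 0 <= \sum_(z.+1 <= b < (2 * P).+1 | (b <= Bc)%N) mu b ^+ 2.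
    by apply: sumr_ge0 => b _; exact: sqr_ge0.
  apply: le_trans (ler_pM S10 S20 S1 S2) _.
  have -> : 2 * P%:R / C%:R * (C%:R * (L ^+ 2 * (2 * P%:R / C%:R) + C%:R * (L ^+ 2 * (P%:R / C%:R / s)))) =
     P%:R ^+ 2 * L ^+ 2 * (4 / C%:R + 2 / s) by field; rewrite !gt_eqF.
  have -> : 9 * P%:R ^+ 2 * L ^+ 2 / s = P%:R ^+ 2 * L ^+ 2 * (9 / s) by field; rewrite gt_eqF.
  apply: ler_wpM2l; first by sgn.
  have : C%:R^-1 <= s^-1.
    by rewrite lef_pV2 ?posrE// (le_trans rz)// ler_nat.
  have : 0 < s^-1 by rewrite invr_gt0.
  move: (C%:R^-1) (s^-1) => p t; lra.
rewrite -(@ler_pXn2r _ 2)// ?nnegrE; [|by sgn].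
rewrite real_normK ?num_real//; apply: le_trans sq _.
rewrite le_eqVlt; apply/orP; left; apply/eqP; rewrite /s; field; exact: lt0r_neq0.
Qed.

(** [vbeta] vanishes up to z, so n runs over dyadic blocks starting at z; at most 2 L of them are
    reached before n exceeds 2 P. *)
Lemma vaughan_typeII :
  `|\sum_(z.+1 <= b < (2 * P).+1) mu b *
      (\sum_((P %/ b).+1 <= v < (2 * P %/ b).+1) vbeta R z (2 * P).+1 v * g (b * v)%N)|
  <= 6 * L ^+ 2 * P%:R / r.
Proof.
have r0 : 0 < r by apply: lt_le_trans r1.
have ex : exists I, (2 * P <= z * 2 ^ I)%N.
  exists (2 * P)%N; apply: (@leq_trans (2 ^ (2 * P))); first by rewrite ltnW// ltn_expl.
  by rewrite leq_pmull.
case: (ex_minnP ex) => I PI Imin.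
have vb0 n : (n <= z)%N -> (0 < n)%N -> vbeta R z (2 * P).+1 n = 0.
  move=> nz n0; rewrite /vbeta big_nat_cond big_pred0// => c; apply/negbTE/negP => /andP[/andP[zc _] /(dvdn_leq n0)].
  by move=> cn; move: (leq_trans zc cn); rewrite ltnNge nz.
have -> : \sum_(z.+1 <= b < (2 * P).+1) mu b *
      (\sum_((P %/ b).+1 <= v < (2 * P %/ b).+1) vbeta R z (2 * P).+1 v * g (b * v)%N)
   = \sum_(i < I) blk (z * 2 ^ i).
  rewrite /blk exchange_big/=; apply: eq_big_nat => b /andP[zb _].
  have b0 : (0 < b)%N by apply: leq_ltn_trans zb.
  rewrite -mulr_sumr; congr (_ * _).
  pose F n : R := if (P < b * n <= 2 * P)%N then vbeta R z (2 * P).+1 n * g (b * n)%N else 0.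
  rewrite (eq_bigr (fun i : 'I_I => \sum_((z * 2 ^ i).+1 <= n < (2 * (z * 2 ^ i)).+1) F n)); last first.
    by move=> i _; rewrite big_mkcond.
  rewrite -dyadic_split.
  pose M := (maxn (z * 2 ^ I) (2 * P)).+1.
  have -> : \sum_((P %/ b).+1 <= v < (2 * P %/ b).+1) vbeta R z (2 * P).+1 v * g (b * v)%N =
     \sum_(1 <= v < M) F v.
    rewrite (@big_cat_nat _ _ _ (P %/ b).+1 1 M)//=; last first.
      by rewrite ltnS leq_max; apply/orP; right; apply: leq_trans (leq_div _ _) _; rewrite leq_pmull.
    rewrite [X in X + _]big1_seq ?add0r; last first.
      move=> v /andP[_]; rewrite mem_index_iota ltnS leq_divRL// => /andP[_ vb].
      by rewrite /F ltnNge (mulnC b v) vb.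
    rewrite (@big_cat_nat _ _ _ (2 * P %/ b).+1 _ M)//=; last 2 first.
    - by rewrite ltnS leq_div2r// leq_pmull.
    - by rewrite ltnS leq_max leq_div orbT.
    rewrite [X in _ + X]big1_seq ?addr0; last first.
      move=> v /andP[_]; rewrite mem_index_iota ltn_divLR// => /andP[vb _].
      by rewrite /F [(b * v <= _)%N]leqNgt (mulnC b v) vb andbF.
    apply: eq_big_nat => v; rewrite ltn_divLR// ltnS leq_divRL// => vP.
    by rewrite /F (mulnC b v) vP.
  rewrite (@big_cat_nat _ _ _ z.+1 1 M)//=; last first.
    by rewrite ltnS leq_max leq_pmulr// expn_gt0.
  rewrite [X in X + _]big1_seq ?add0r; last first.
    move=> v /andP[_]; rewrite mem_index_iota => /andP[v0 vz].
    by rewrite /F vb0 ?mul0r// if_same.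
  rewrite (@big_cat_nat _ _ _ (z * 2 ^ I).+1 z.+1 M)//=; last 2 first.
  - by rewrite ltnS leq_pmulr// expn_gt0.
  - by rewrite ltnS leq_max leqnn.
  rewrite [X in _ + X]big1_seq ?addr0// => v /andP[_]; rewrite mem_index_iota => /andP[vI _].
  rewrite /F ifF//; apply/negbTE; rewrite negb_and -!ltnNge; apply/orP; right.
  apply: leq_ltn_trans PI _; apply: leq_trans vI _; by rewrite leq_pmull.
have I2L : I%:R <= 2 * L.
  case: (I) Imin => [|J] Jmin; first by rewrite mulr_ge0// ltW.
  have J2 : (z * 2 ^ J < 2 * P)%N by rewrite ltnNge; apply/negP => /Jmin; rewrite ltnn.
  have J2' : (2 ^ J <= 2 * P)%N by apply: leq_trans (ltnW J2); rewrite leq_pmull.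
  have : ln ((2 ^ J)%N%:R) <= ln ((2 * P)%N%:R) :> R.
    by rewrite ler_ln ?posrE ?ltr0n ?expn_gt0 ?muln_gt0// ler_nat.
  rewrite natrX lnXn// -[ln 2 *+ J]mulr_natr /L => lnJ.
  have /andP[l2 _] := ln2_bounds.
  have : 2^-1 * J%:R <= ln 2 * J%:R :> R by apply: ler_wpM2r.
  have aux (p q t : R) : p <= q -> 2^-1 * t <= p -> t + 1 <= 2 * (1 + q) by move=> *; lra.
  by rewrite -(natr1 J); exact: (aux _ _ _ lnJ).
apply: le_trans (ler_norm_sum _ _ _) _.
apply: (@le_trans _ _ (\sum_(i < I) 3 * P%:R * L / r)).
  apply: ler_sum => i _; apply: vaughan_block; rewrite leq_pmulr ?expn_gt0//=.
  by rewrite ltnNge; apply/negP => /Imin; rewrite leqNgt ltn_ord.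
rewrite sumr_const card_ord -[leLHS]mulr_natl.
have -> : 6 * L ^+ 2 * P%:R / r = 2 * L * (3 * P%:R * L / r) by ring.
by apply: ler_wpM2r => //; sgn.
Qed.

Lemma vaughan_bound :
  `|\sum_(P.+1 <= u < (2 * P).+1) Lam u * cos (X / u%:R)| <= 9 * L ^+ 3 * P%:R / r.
Proof.
rewrite (@vaughan_sum R P z g) ?z0//.
apply: le_trans (ler_normD _ _) _.
have r0 : 0 < r by apply: lt_le_trans r1.
have -> : 9 * L ^+ 3 * P%:R / r = (2 * L ^+ 3 * P%:R / r + L ^+ 3 * P%:R / r) + 6 * L ^+ 3 * P%:R / r by ring.
have L23 : L ^+ 2 <= L ^+ 3 by apply: ler_weXn2l.
have sr : s^-1 <= r^-1 by rewrite lef_pV2 ?posrE// /s ler_eXnr.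
have Pr0 : 0 <= P%:R / r by sgn.
apply: lerD; last first.
  apply: le_trans vaughan_typeII _.
  have -> : 6 * L ^+ 2 * P%:R / r = L ^+ 2 * (6 * (P%:R / r)) by ring.
  have -> : 6 * L ^+ 3 * P%:R / r = L ^+ 3 * (6 * (P%:R / r)) by ring.
  by apply: ler_wpM2r => //; rewrite mulr_ge0.
apply: le_trans (ler_normB _ _) _; apply: lerD.
  apply: le_trans vaughan_typeI1 _.
  have -> : 2 * L ^+ 2 * P%:R / s = (2 * P%:R) * (L ^+ 2 / s) by ring.
  have -> : 2 * L ^+ 3 * P%:R / r = (2 * P%:R) * (L ^+ 3 / r) by ring.
  apply: ler_wpM2l; first by rewrite mulr_ge0.
  by apply: ler_pM => //; sgn.
apply: le_trans vaughan_typeI2 _.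
by apply: ler_wpM2l => //; sgn.
Qed.
End VaughanBound.

(** * Chebyshev and Sylvester bounds *)

Section Chebyshev.
Variable R : realType.
Local Notation Lam := (vonMangoldt R).

Definition psi n : R := \sum_(1 <= d < n.+1) Lam d.

(* The contribution of d to ln 'C(m, k) in Legendre's formula, where d carries the weight Lambda d;
   it is 0 or 1. *)
Definition bincoef m k d := (m %/ d - k %/ d - (m - k) %/ d)%N.

(** Legendre's formula: each ln i is expanded over the divisors of i, and d divides n / d of the
    numbers up to n. *)
Lemma ln_fact n : ln (n`!%:R : R) = \sum_(1 <= d < n.+1) Lam d * (n %/ d)%:R.
Proof.
rewrite fact_prod natr_prod.
have -> : ln (\prod_(1 <= i < n.+1) (i%:R : R)) = \sum_(1 <= i < n.+1) ln i%:R.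
  elim: n => [|n IH]; first by rewrite !big_geq// ln1.
  rewrite [in LHS]big_nat_recr//= [in RHS]big_nat_recr//= lnM ?posrE ?IH// ?ltr0n//.
  by rewrite big_seq prodr_gt0// => i; rewrite mem_index_iota ltr0n => /andP[].
rewrite (@eq_big_nat _ _ _ _ _ _ (fun i => \sum_(1 <= d < n.+1 | (d %| i)%N) Lam d)); last first.
  by move=> i iP; rewrite -sum_vonMangoldt ?(@divisors_range _ _ n.+1)//; case/andP: iP.
rewrite (exchange_big_dep predT)//=; apply: eq_big_nat => d /andP[d0 dn].
rewrite (@sum_multiples R d 0 n (fun=> Lam d))// div0n sumr_const_nat subSS subn0.
by rewrite mulr_natr.
Qed.

Lemma bincoef_le1 m k d : (0 < d)%N -> (k <= m)%N ->
  (k %/ d + (m - k) %/ d + bincoef m k d = m %/ d)%N /\ (bincoef m k d <= 1)%N.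
Proof.
move=> d0 km; rewrite /bincoef.
have e : m = (k %/ d * d + k %% d + ((m - k) %/ d * d + (m - k) %% d))%N.
  by rewrite -!divn_eq subnKC.
have r1 := ltn_pmod k d0; have r2 := ltn_pmod (m - k) d0.
have md : (m %/ d = k %/ d + (m - k) %/ d + (k %% d + (m - k) %% d) %/ d)%N.
  rewrite {1}e addnACA -mulnDl divnMDl//.
have : ((k %% d + (m - k) %% d) %/ d < 2)%N by rewrite ltn_divLR//; clear -r1 r2; lia.
rewrite md; move: ((k %% d + (m - k) %% d) %/ d)%N (k %/ d)%N ((m - k) %/ d)%N => a b c.
by clear; lia.
Qed.

Lemma ln_bin m k : (k <= m)%N ->
  ln ('C(m, k)%:R : R) = \sum_(1 <= d < m.+1) Lam d * (bincoef m k d)%:R.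
Proof.
move=> km.
have ext j : (j <= m)%N -> ln (j`!%:R : R) = \sum_(1 <= d < m.+1) Lam d * (j %/ d)%:R.
  move=> jm; rewrite ln_fact [RHS](@big_cat_nat _ _ _ j.+1)//= [X in _ + X]big1_seq ?addr0//.
  by move=> d; rewrite mem_index_iota => /andP[_ /andP[jd _]]; rewrite divn_small// mulr0.
have : ln (m`!%:R : R) = ln 'C(m, k)%:R + (ln k`!%:R + ln (m - k)`!%:R).
  rewrite -(bin_fact km) natrM natrM !lnM ?posrE ?mulr_gt0 ?ltr0n ?fact_gt0 ?bin_gt0//.
rewrite !ext ?leq_subr//.
have -> : \sum_(1 <= d < m.+1) Lam d * (m %/ d)%:R = \sum_(1 <= d < m.+1) Lam d * (bincoef m k d)%:R
   + (\sum_(1 <= d < m.+1) Lam d * (k %/ d)%:R + \sum_(1 <= d < m.+1) Lam d * ((m - k) %/ d)%:R).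
  rewrite -!big_split/=; apply: eq_big_nat => d /andP[d0 _].
  have [<- _] := bincoef_le1 d0 km; rewrite !natrD; ring.
by move=> /addIr.
Qed.

Lemma sum_bin_2 n : (2 ^ n = \sum_(i < n.+1) 'C(n, i))%N.
Proof.
by rewrite -[2%N]/(1 + 1)%N expnDn; apply: eq_bigr => i _; rewrite !exp1n !muln1.
Qed.

Lemma bin_dbl_le m : ('C(2 * m, m) <= 4 ^ m)%N.
Proof.
rewrite -[4%N]/(2 ^ 2)%N -expnM sum_bin_2.
have lt : (m < (2 * m).+1)%N by lia.
by rewrite (bigD1 (Ordinal lt))//= leq_addr.
Qed.

Lemma bin_dblS_le m : ('C((2 * m).+1, m) <= 4 ^ m)%N.
Proof.
rewrite -(leq_pmul2l (isT : 0 < 2)%N) -[4%N]/(2 ^ 2)%N -expnM -expnS sum_bin_2.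
have lt1 : (m < (2 * m).+2)%N by lia.
have lt2 : (m.+1 < (2 * m).+2)%N by lia.
rewrite (bigD1 (Ordinal lt1))//= (bigD1 (Ordinal lt2))/=; last by rewrite -val_eqE/=; lia.
have -> : 'C((2 * m).+1, m.+1) = 'C((2 * m).+1, m).
  rewrite -(@bin_sub (2 * m).+1 m); last by lia.
  by congr ('C(_, _)); lia.
by rewrite mul2n -addnn addnA leq_addr.
Qed.

Lemma bin_dbl_ge m : (4 ^ m <= (2 * m).+1 * 'C(2 * m, m))%N.
Proof.
elim: m => [|m IH]; first by rewrite muln0 bin0.
have e1 := mul_bin_diag (2 * m.+1) m.
have e2 := mul_bin_down (2 * m).+1 m.
have d1 : (2 * m.+1).-1 = (2 * m).+1 by lia.
rewrite d1 in e1; rewrite /= in e2.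
have d2 : ((2 * m).+1 - m = m.+1)%N by lia.
rewrite d2 in e2.
move: e1 e2 IH; rewrite expnS.
move: ('C(2 * m.+1, m.+1)) ('C((2 * m).+1, m)) ('C(2 * m, m)) => a b c e1 e2 IH.
have e1' : a = (2 * b)%N by apply/eqP; rewrite -(eqn_pmul2l (ltn0Sn m)) -e1; apply/eqP; lia.
rewrite e1'; rewrite -(leq_pmul2l (ltn0Sn m)).
have -> : (m.+1 * ((2 * m.+1).+1 * (2 * b)) = (2 * m.+1).+1 * 2 * (m.+1 * b))%N by lia.
rewrite -e2; apply: (@leq_trans (m.+1 * (4 * ((2 * m).+1 * c)))).
  by rewrite !leq_mul2l IH !orbT.
have -> : (m.+1 * (4 * ((2 * m).+1 * c)) = 4 * m.+1 * ((2 * m).+1 * c))%N by lia.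
by rewrite leq_mul2r; apply/orP; right; lia.
Qed.

(** Each step multiplies the binomial coefficient by (2H + j + 1) / (H + j + 1), at least 9/5 as
    long as 4 (j + 1) <= H. *)
Lemma bin_growth H j : (4 * j <= H)%N -> (9 ^ j * 'C(2 * H, H) <= 5 ^ j * 'C(2 * H + j, H))%N.
Proof.
elim: j => [|j IH] jH; first by rewrite addn0.
have {}IH : (9 ^ j * 'C(2 * H, H) <= 5 ^ j * 'C(2 * H + j, H))%N by apply: IH; clear -jH; lia.
rewrite !expnS -!mulnA addnS.
apply: (@leq_trans (9 * (5 ^ j * 'C(2 * H + j, H)))); first by rewrite leq_mul2l IH orbT.
rewrite mulnCA [(5 * _)%N]mulnCA leq_mul2l; apply/orP; right.
have e := mul_bin_down (2 * H + j).+1 H; rewrite /= in e.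
rewrite -(leq_pmul2l (ltn0Sn (2 * H + j))) mulnCA e mulnCA mulnA [leqRHS]mulnA leq_mul2r.
by apply/orP; right; clear -jH; lia.
Qed.

Lemma ln_4X m : ln ((4 ^ m)%N%:R : R) = m%:R * (2 * ln 2).
Proof.
rewrite natrX lnXn// -[ln _ *+ m]mulr_natl; congr (_ * _).
have -> : 4%:R = 2 * 2 :> R by rewrite -natrM.
by rewrite lnM ?posrE//; ring.
Qed.

Lemma psi_diff m n : (m <= n)%N -> psi n - psi m = \sum_(m.+1 <= d < n.+1) Lam d.
Proof.
by move=> mn; rewrite {1}/psi (@big_cat_nat _ _ _ m.+1)//= -/(psi m) addrAC subrr add0r.
Qed.

Lemma psi_diff_le m k n : (k <= m)%N -> (n <= m)%N ->
  (forall d, (n < d <= m)%N -> bincoef m k d = 1%N) -> psi m - psi n <= ln 'C(m, k)%:R.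
Proof.
move=> km nm c1; rewrite psi_diff// ln_bin// (@big_cat_nat _ _ _ n.+1 1)//=.
rewrite -[leLHS]add0r; apply: lerD.
  by apply: sumr_ge0 => d _; rewrite mulr_ge0// vonMangoldt_ge0.
by apply: ler_sum_nat => d dP; rewrite c1// mulr1.
Qed.

(** Every d in (m, 2m] has coefficient 1 in ln 'C(2m, m), which is at most m ln 4; halving n gives
    an induction. For odd n = 2m + 1 the coefficient is 1 only for d > m + 1, so the induction goes
    to m + 1. *)
Lemma psi_le n : psi n <= n%:R * (2 * ln 2).
Proof.
have ln2 : 0 <= ln 2 :> R by rewrite ln_ge0// ler1n.
have ln4 m (c : nat) : (0 < c)%N -> (c <= 4 ^ m)%N -> ln (c%:R : R) <= m%:R * (2 * ln 2).
  move=> c0 c4; apply: (@le_trans _ _ (ln ((4 ^ m)%N%:R))).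
    by rewrite ler_ln ?posrE ?ltr0n ?expn_gt0// ler_nat.
  by rewrite ln_4X.
have [k] := ubnP n; elim: k n => // k IH n; rewrite ltnS => nk.
have [n1|n1] := leqP n 1.
  case: n n1 {nk} => [_|[_|//]]; first by rewrite /psi big_geq// mul0r.
  by rewrite /psi big_nat1 /vonMangoldt/= mul1r mulr_ge0.
pose m := (n./2)%N.
have nE := odd_double_half n.
case: (odd n) nE => nE.
  have nE' : n = (2 * m).+1 by rewrite -nE /m; lia.
  have B := ln4 m _ _ (bin_dblS_le m); rewrite bin_gt0 in B.
  have := @psi_diff_le (2 * m).+1 m m.+1.
  case/(_ _ _ _)/Wrap => [|||[H]].
  - by lia.
  - by lia.
  - move=> d dm; rewrite /bincoef (divn_small (_ : m < d)%N); last by lia.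
    rewrite (divn_small (_ : (2 * m).+1 - m < d)%N); last by lia.
    have -> : ((2 * m).+1 %/ d = 1)%N by apply/eqP; rewrite eqn_leq; apply/andP; split; [rewrite -ltnS ltn_divLR|rewrite leq_divRL]; lia.
    by [].
  have := IH m.+1; rewrite nE' => /(_ _)/Wrap[|[]]; first by lia.
  have := B (_ : m <= _)%N => /(_ _)/Wrap[|[]]; first by lia.
  have -> : (2 * m).+1%:R = 2 * m%:R + 1 :> R by rewrite -natr1 natrM.
  by rewrite -natr1; move: H; move: (psi _) (psi _) (ln 'C(_, _)%:R) => p q r; lra.
have nE' : n = (2 * m)%N by rewrite -nE /m; lia.
have B := ln4 m _ _ (bin_dbl_le m); rewrite bin_gt0 in B.
have := @psi_diff_le (2 * m) m m.
case/(_ _ _ _)/Wrap => [|||[H]].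
- by lia.
- by lia.
- move=> d dm; rewrite /bincoef (divn_small (_ : m < d)%N); last by lia.
  rewrite (divn_small (_ : 2 * m - m < d)%N); last by lia.
  have -> : ((2 * m) %/ d = 1)%N by apply/eqP; rewrite eqn_leq; apply/andP; split; [rewrite -ltnS ltn_divLR|rewrite leq_divRL]; lia.
  by [].
have := IH m; rewrite nE' => /(_ _)/Wrap[|[]]; first by lia.
have := B (_ : m <= _)%N => /(_ _)/Wrap[|[]]; first by lia.
have -> : (2 * m)%:R = 2 * m%:R :> R by rewrite natrM.
by move: H; move: (psi _) (psi _) (ln 'C(_, _)%:R) => p q r; lra.
Qed.

(** The d in (2P/3, P] have coefficient 0 in ln 'C(2P, P), so only psi (2P/3), at most (4/3) P ln 2,
    has to be subtracted from the total, about 2 P ln 2. *)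
Lemma psi_dbl_ge P : (0 < P)%N ->
  2 / 3 * P%:R * ln 2 - ln (2 * P).+1%:R <= psi (2 * P) - psi P.
Proof.
move=> P0.
have ln2 : 0 <= ln 2 :> R by rewrite ln_ge0// ler1n.
have lb : 2 * P%:R * ln 2 - ln (2 * P).+1%:R <= ln 'C(2 * P, P)%:R :> R.
  have : ln ((4 ^ P)%N%:R) <= ln (((2 * P).+1 * 'C(2 * P, P))%N%:R : R).
    by rewrite ler_ln ?posrE ?ltr0n ?expn_gt0 ?muln_gt0 ?bin_gt0 ?ler_nat ?bin_dbl_ge//=; lia.
  rewrite natrM lnM ?posrE ?ltr0n ?bin_gt0//; last by lia.
  rewrite ln_4X.
  have aux (p q v w : R) : v * (2 * w) <= q + p -> 2 * v * w - q <= p by move=> *; lra.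
  exact: aux.
pose m := (2 * P %/ 3)%N.
have mP : (m <= P)%N by rewrite /m -ltnS ltn_divLR//; lia.
have P2 : (P <= 2 * P)%N by lia.
have up : ln ('C(2 * P, P)%:R : R) <= psi m + (psi (2 * P) - psi P).
  rewrite ln_bin// psi_diff// (@big_cat_nat _ _ _ P.+1 1)//=; apply: lerD; last first.
    apply: ler_sum_nat => d /andP[Pd _]; rewrite ler_piMr ?vonMangoldt_ge0//.
    by have [_] := @bincoef_le1 (2 * P) P d (leq_ltn_trans (leq0n _) Pd) P2; rewrite lern1.
  rewrite (@big_cat_nat _ _ _ m.+1 1)//= [X in _ + X]big1_seq ?addr0; last first.
    move=> d; rewrite mem_index_iota => /andP[_ /andP[md]]; rewrite ltnS => dP.
    rewrite /bincoef.
    have md' : (2 * P < d * 3)%N by rewrite -ltn_divLR.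
    have d0 : (0 < d)%N by lia.
    have -> : ((2 * P) %/ d = 2)%N.
      apply/eqP; rewrite eqn_leq; apply/andP; split; last by rewrite leq_divRL//; lia.
      by rewrite -ltnS ltn_divLR//; clear -md' dP; lia.
    have -> : (P %/ d = 1)%N.
      apply/eqP; rewrite eqn_leq; apply/andP; split; last by rewrite leq_divRL//; lia.
      by rewrite -ltnS ltn_divLR//; clear -md' dP; lia.
    have -> : ((2 * P - P) %/ d = 1)%N.
      have -> : (2 * P - P = P)%N by lia.
      apply/eqP; rewrite eqn_leq; apply/andP; split; last by rewrite leq_divRL//; lia.
      by rewrite -ltnS ltn_divLR//; clear -md' dP; lia.
    by rewrite mulr0.
  apply: ler_sum_nat => d /andP[d0 _]; rewrite ler_piMr ?vonMangoldt_ge0//.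
  by have [_] := @bincoef_le1 (2 * P) P d d0 P2; rewrite lern1.
have m3 : m%:R * (2 * ln 2) <= 4 / 3 * P%:R * ln 2 :> R.
  have : m%:R * 3 <= 2 * P%:R :> R by rewrite -(natrM _ m 3) -natrM ler_nat leq_trunc_div.
  by move=> h; have : m%:R * 3 * ln 2 <= 2 * P%:R * ln 2 :> R; [exact: ler_wpM2r|lra].
have := psi_le m; move: lb up m3; move: (ln 'C(_, _)%:R) (psi _) (psi _) (psi _) (ln (2 * P).+1%:R) => a b c d e.
by move=> h1 h2 h3 h4; lra.
Qed.
End Chebyshev.

Section Sylvester.
Variable R : realType.
Local Notation Lam := (vonMangoldt R).
Local Notation psi := (psi R).

(** Writing n = w^k turns comparisons between fractional powers of n into comparisons of integer
    powers of w. *)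
Lemma large_root (k : nat) (M : R) : (0 < k)%N ->
  exists n0 : nat, forall n, (n0 <= n)%N ->
  exists w : R, [/\ M <= w, 1 <= w & w ^+ k = n%:R].
Proof.
move=> k0; pose M1 := Num.max 1 M.
exists (Num.truncn (M1 ^+ k)).+1 => n nM.
have M11 : 1 <= M1 by rewrite le_max lexx.
have Mn : M1 ^+ k <= n%:R.
  apply/ltW/(lt_le_trans (truncnS_gt _)); by rewrite ler_nat.
have kR : k%:R != 0 :> R by rewrite pnatr_eq0 -lt0n.
have e0 : 0 <= (k%:R)^-1 :> R by rewrite invr_ge0.
exists (n%:R `^ (k%:R)^-1).
have M1w : M1 <= n%:R `^ (k%:R)^-1.
  have M10 : 0 <= M1 by rewrite (le_trans _ M11).
  rewrite -[leLHS](powRr1 M10) -[X in _ `^ X](mulfV kR) powRrM powR_mulrn//.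
  by apply: ge0_ler_powR => //; rewrite nnegrE// exprn_ge0.
split.
- by rewrite (le_trans _ M1w)// le_max lexx orbT.
- exact: le_trans M1w.
- by rewrite -powR_mulrn ?powR_ge0// -powRrM mulVf// powRr1.
Qed.

Lemma vonMangoldt_neq0 d : Lam d != 0 -> exists p e,
  [/\ prime p, (0 < e)%N & d = (p ^ e)%N].
Proof.
rewrite /vonMangoldt; case E : (primes d) => [|p [|q s]]; rewrite ?eqxx// => _.
have : p \in primes d by rewrite E inE.
rewrite mem_primes => /and3P[pp d0 pd]; exists p, (logn p d); split => //.
  by rewrite logn_gt0 E inE.
by rewrite {1}(prod_prime_decomp d0) prime_decompE E /= big_seq1.
Qed.

(** A prime power p^e <= x with e >= 2 has p <= y and e at most the binary logarithm of x, so the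
    pairs (p, e) bound the number of nonzero terms. *)
Lemma proper_sum_count x y : (x < y.+1 ^ 2)%N ->
  \sum_(1 <= d < x.+1 | ~~ prime d) Lam d <= (y.+1 * (trunc_log 2 x).+1)%:R * ln x%:R.
Proof.
move=> xy; have [x0|x0] := posnP x.
  by rewrite x0 big_geq// ln0// mulr0.
have lnx0 : 0 <= ln x%:R :> R by rewrite ln_ge0// ler1n.
pose s := [seq d <- index_iota 1 x.+1 | ~~ prime d && (Lam d != 0)].
have -> : \sum_(1 <= d < x.+1 | ~~ prime d) Lam d = \sum_(d <- s) Lam d.
  rewrite big_filter [LHS]big_mkcond [RHS]big_mkcond; apply: eq_bigr => d _.
  by case: prime => //=; case: eqP => // ->.
have bnd d : d \in s -> Lam d <= ln x%:R.
  rewrite mem_filter mem_index_iota ltnS => /and3P[_ d0 dx].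
  apply: (@le_trans _ _ (ln d%:R)); last by rewrite ler_ln ?posrE ?ltr0n// ler_nat.
  rewrite -sum_vonMangoldt// (bigD1_seq d)/= ?divisors_uniq -?dvdn_divisors//.
  by rewrite lerDl sumr_ge0// => i _; exact: vonMangoldt_ge0.
apply: (@le_trans _ _ (\sum_(d <- s) ln x%:R)).
  by rewrite big_seq [leRHS]big_seq; apply: ler_sum.
rewrite big_const_seq iter_addr_0 count_predT -[leLHS]mulr_natl; apply: ler_wpM2r => //.
rewrite ler_nat.
pose f d := (pdiv d, logn (pdiv d) d).
have sE d : d \in s -> exists p e, [/\ prime p, (1 < e)%N, d = (p ^ e)%N & (d <= x)%N].
  rewrite mem_filter mem_index_iota ltnS => /andP[/andP[np /vonMangoldt_neq0[p [e [pp e0 dpe]]]] /andP[_ dx]].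
  exists p, e; split=> //; rewrite ltn_neqAle e0 andbT; apply/eqP => e1.
  by move: np; rewrite dpe -e1 expn1 pp.
have fE p e : prime p -> (1 < e)%N -> f (p ^ e)%N = (p, e).
  by move=> pp; case: e => // e _; rewrite /f pdiv_pfactor// pfactorK.
rewrite -(size_map f).
apply: (@leq_trans (size [seq (p, e) | p <- iota 0 y.+1, e <- iota 0 (trunc_log 2 x).+1])); last first.
  by rewrite size_allpairs !size_iota.
apply: uniq_leq_size.
  rewrite map_inj_in_uniq ?filter_uniq ?iota_uniq// => a b.
  move=> /sE[p [e [pp e1 -> _]]] /sE[q [k [qp k1 -> _]]].
  by rewrite !fE// => -[-> ->].
move=> pe /mapP[d /sE[p [e [pp e1 de dx]] ->]]; rewrite de fE//.
apply/allpairsP; exists (p, e); rewrite !mem_iota !add0n /=; split => //.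
  rewrite -(@ltn_exp2r _ _ 2)//; apply: leq_ltn_trans xy; apply: leq_trans dx.
  by rewrite de leq_exp2l// prime_gt1.
rewrite ltnS trunc_log_max//; apply: leq_trans dx; rewrite de leq_exp2r ?prime_gt1//.
exact: ltnW.
Qed.

(** With x at most v^100, the square root of x is at most v^50, and each of the two logarithms is at
    most a constant times v. *)
Lemma proper_sum_le x (v : R) : (0 < x)%N -> 1 <= v -> x%:R <= v ^+ 100 ->
  \sum_(1 <= d < x.+1 | ~~ prime d) Lam d <= 10 ^+ 5 * v ^+ 52.
Proof.
move=> x0 v1 xv.
have v0 : 0 < v by apply: lt_le_trans v1.
have x1 : 1 <= x%:R :> R by rewrite ler1n.
have [y y0 /andP[yx xy]] := @nat_root R 2 x%:R isT x1.
apply: (le_trans (@proper_sum_count x y _)).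
  by rewrite -(ltr_nat R) natrX.
have lnx : ln x%:R <= 100 * v.
  apply: (@le_trans _ _ (ln (v ^+ 100))); first by rewrite ler_ln ?posrE ?ltr0n ?exprn_gt0.
  rewrite lnXn// -[leLHS]mulr_natl; apply: ler_wpM2l => //.
  by apply: ltW; exact: ln_sublinear.
have lnx0 : 0 <= ln x%:R :> R by rewrite ln_ge0.
have yv : y%:R <= v ^+ 50.
  rewrite -(@ler_pXn2r _ 2)// ?nnegrE//; last by sgn.
  by rewrite -exprM; exact: le_trans xv.
have Ev : (trunc_log 2 x)%:R <= 200 * v.
  have : ln ((2 ^ trunc_log 2 x)%N%:R) <= ln x%:R :> R.
    by rewrite ler_ln ?posrE ?ltr0n ?expn_gt0// ler_nat trunc_logP.
  rewrite natrX lnXn// -[ln _ *+ _]mulr_natl => h.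
  have /andP[l2 _] := ln2_bounds R.
  have : (trunc_log 2 x)%:R * 2^-1 <= (trunc_log 2 x)%:R * ln 2 :> R by apply: ler_wpM2l.
  by lra.
have v50 : 1 <= v ^+ 50 by rewrite exprn_ege1.
rewrite natrM -(natr1 y) -(natr1 (trunc_log 2 x)).
apply: (@le_trans _ _ ((2 * v ^+ 50) * (201 * v) * (100 * v))).
  have y10 : 0 <= y%:R + 1 :> R by rewrite addr_ge0.
  have E10 : 0 <= (trunc_log 2 x)%:R + 1 :> R by rewrite addr_ge0.
  apply: ler_pM => //.
  by apply: ler_pM => //; lra.
have -> : 2 * v ^+ 50 * (201 * v) * (100 * v) = 2 * 201 * 100 * v ^+ 52 by rewrite !exprS expr0; ring.
apply: ler_wpM2r; first by rewrite exprn_ge0// ltW.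
rewrite !exprS expr0.
by lra.
Qed.

Lemma bincoef_dvd m k d : (0 < d)%N -> (k <= m)%N -> (0 < bincoef m k d)%N ->
  exists2 n, (m - k < n <= m)%N & (d %| n)%N.
Proof.
move=> d0 km c0; exists (m %/ d * d)%N; last exact: dvdn_mull.
rewrite leq_trunc_div andbT -ltn_divLR//; move: c0; rewrite /bincoef.
by move: (m %/ d)%N (k %/ d)%N ((m - k) %/ d)%N => a b c; lia.
Qed.

(* Without such a prime, ln 'C(N + H, H) is a sum of Lambda over prime powers whose
   prime part is at most H; for N <= 5/4 H the range (N + H)/3 < d <= H does not
   contribute either, and otherwise the binomial coefficient has grown enough. *)
Lemma sylvester : exists H0 : nat, forall H N : nat, (H0 <= H)%N -> (H <= N)%N ->
  (N ^ 5 <= H ^ 9)%N ->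
  exists p, [/\ prime p, (H < p)%N & exists2 n, (N < n <= N + H)%N & (p %| n)%N].
Proof.
have [H0 H0P] := @large_root 500 8 isT.
exists H0.+1 => H N HH HN N5.
have H00 : (0 < H)%N by apply: leq_trans HH.
have [w [w8 w1 wH]] := H0P H (ltnW HH).
have w0 : 0 < w by apply: lt_le_trans w1.
apply: contrapT => noP.
have HR : 0 < H%:R :> R by rewrite ltr0n.
pose m := (N + H)%N.
have Hm : (H <= m)%N by rewrite leq_addl.
have mH : (m - H = N)%N by rewrite addnK.
have c0 d : prime d -> (H < d)%N -> bincoef m H d = 0%N.
  move=> pd Hd; apply/eqP; rewrite -leqn0 leqNgt; apply/negP => /(bincoef_dvd (prime_gt0 pd) Hm)[n].
  by rewrite mH => nI dn; apply: noP; exists d; split => //; exists n.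
(* H = w^500 and N <= H^(9/5) give N + H <= (2 w^9)^100, so [proper_sum_le] applies with v = 2 w^9,
   and 9 * 52 = 468 is below 500. *)
have prop_le : \sum_(1 <= d < m.+1 | ~~ prime d) Lam d <= 10 ^+ 5 * 2 ^+ 52 * w ^+ 468.
  have -> : 10 ^+ 5 * 2 ^+ 52 * w ^+ 468 = 10 ^+ 5 * (2 * w ^+ 9) ^+ 52 :> R.
    have e468 : (9 * 52 = 468)%N by [].
    by rewrite [(2 * w ^+ 9) ^+ 52]exprMn -[(w ^+ 9) ^+ 52]exprM e468 [RHS]mulrA.
  apply: proper_sum_le; first by rewrite addn_gt0 H00 orbT.
    by rewrite -[leLHS]mulr1; apply: ler_pM => //; [lra|rewrite exprn_ege1].
  rewrite -(@ler_pXn2r _ 5)// ?nnegrE//; last by sgn.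
  apply: (@le_trans _ _ ((2 * N%:R) ^+ 5)).
    by rewrite lerXn2r ?nnegrE ?mulr_ge0// -natrM ler_nat /m mul2n -addnn leq_add2l.
  have N5R : N%:R ^+ 5 <= H%:R ^+ 9 :> R by rewrite -!natrX ler_nat.
  have e1 : ((2 * w ^+ 9) ^+ 100) ^+ 5 = 2 ^+ 500 * w ^+ 4500.
    have e5 : (100 * 5 = 500)%N by [].
    have e9 : (9 * 500 = 4500)%N by [].
    by rewrite -exprM e5 [(2 * w ^+ 9) ^+ 500]exprMn -[(w ^+ 9) ^+ 500]exprM e9.
  have e2 : H%:R ^+ 9 = w ^+ 4500.
    have e9 : (500 * 9 = 4500)%N by [].
    by rewrite -wH -[(w ^+ 500) ^+ 9]exprM e9.
  rewrite e1 [(2 * N%:R) ^+ 5]exprMn -e2; apply: ler_pM => //.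
  by apply: ler_weXn2l => //; rewrite ler1n.
have up : ln ('C(m, H)%:R : R) <= \sum_(1 <= d < H.+1) Lam d * (bincoef m H d)%:R
   + 10 ^+ 5 * 2 ^+ 52 * w ^+ 468.
  rewrite ln_bin// (@big_cat_nat _ _ _ H.+1 1)//= lerD2l; apply: le_trans prop_le.
  rewrite [leRHS](@big_cat_nat _ _ _ H.+1 1)//= -[leLHS]add0r; apply: lerD.
    by apply: sumr_ge0 => d _; exact: vonMangoldt_ge0.
  rewrite [leRHS]big_mkcond; apply: ler_sum_nat => d /andP[Hd _].
  have [pd|npd] /= := boolP (prime d); first by rewrite c0// mulr0.
  rewrite ler_piMr ?vonMangoldt_ge0//.
  by have [_] := @bincoef_le1 m H d (leq_ltn_trans (leq0n _) Hd) Hm; rewrite lern1.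
have /andP[l2 l2'] := ln2_bounds R.
have lb0 : 2 * H%:R * ln 2 - ln (2 * H).+1%:R <= ln 'C(2 * H, H)%:R :> R.
  have : ln ((4 ^ H)%N%:R) <= ln (((2 * H).+1 * 'C(2 * H, H))%N%:R : R).
    rewrite ler_ln ?posrE ?ltr0n ?expn_gt0 ?muln_gt0 ?bin_gt0 ?ler_nat ?bin_dbl_ge//=.
    by clear; lia.
  rewrite natrM lnM ?posrE ?ltr0n ?bin_gt0//; last by clear; lia.
  rewrite ln_4X.
  have aux (p q v u : R) : v * (2 * u) <= q + p -> 2 * v * u - q <= p by move=> *; lra.
  exact: aux.
have lnH : ln (2 * H).+1%:R <= 500 * w + 2 :> R.
  apply: (@le_trans _ _ (ln (2 * 2 * H%:R))).
    rewrite ler_ln ?posrE ?ltr0n ?mulr_gt0// -!natrM ler_nat; clear -H00; lia.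
  rewrite !lnM ?posrE ?mulr_gt0//.
  have -> : ln H%:R = 500 * ln w by rewrite -wH lnXn// mulr_natl.
  have := ltW (ln_sublinear w0); move: (ln w) => t; lra.
have small : 500 * w + 3 + 10 ^+ 5 * 2 ^+ 52 * w ^+ 468 < H%:R / 10.
  rewrite -wH.
  have w32 : 2 ^+ 96 <= w ^+ 32.
    rewrite -[96%N]/(3 * 32)%N exprM; rewrite lerXn2r ?nnegrE//; [lra|].
    by apply: le_trans w8; rewrite !exprS expr0; lra.
  have -> : w ^+ 500 = w ^+ 468 * w ^+ 32 by rewrite -exprD.
  have w468 : w <= w ^+ 468 by rewrite ler_eXnr.
  have p0 : 0 < w ^+ 468 by rewrite exprn_gt0.
  have e96 : 2 ^+ 96 = 2 ^+ 52 * 2 ^+ 44 :> R by rewrite -exprD.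
  have t1000 : 1000 <= 10 ^+ 5 :> R by rewrite !exprS expr0; lra.
  have h28 : 10 ^+ 7 <= 2 ^+ 28 :> R.
    by rewrite -[28%N]/(4 * 7)%N exprM; rewrite lerXn2r ?nnegrE//; rewrite !exprS expr0; lra.
  have h44 : 10 ^+ 5 * 100 <= 2 ^+ 44 :> R.
    apply: (@le_trans _ _ (10 ^+ 7)); first by rewrite !exprS expr0; lra.
    by apply: le_trans h28 _; apply: ler_weXn2l => //; lra.
  have h52 : 10 ^+ 5 <= 2 ^+ 52 :> R.
    apply: (@le_trans _ _ (10 ^+ 7)); first by rewrite !exprS expr0; lra.
    by apply: le_trans h28 _; apply: ler_weXn2l => //; lra.
  have hz : w ^+ 468 * 2 ^+ 96 <= w ^+ 468 * w ^+ 32 by apply: ler_wpM2l => //; exact: ltW.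
  have a0 : 0 <= 2 ^+ 52 * w ^+ 468 by rewrite mulr_ge0 ?exprn_ge0// ltW.
  have hA : (2 ^+ 52 * w ^+ 468) * (10 ^+ 5 * 100) <= (2 ^+ 52 * w ^+ 468) * 2 ^+ 44 :> R.
    exact: ler_wpM2l.
  have hB : 10 ^+ 5 * w <= 2 ^+ 52 * w ^+ 468 :> R by apply: ler_pM => //; exact: ltW.
  have hC : 1000 * (2 ^+ 52 * w ^+ 468) <= 10 ^+ 5 * (2 ^+ 52 * w ^+ 468) by apply: ler_wpM2r.
  have hD : 1000 * w <= 10 ^+ 5 * w by apply: ler_wpM2r => //; exact: ltW.
  have hE : w ^+ 468 * 2 ^+ 96 = (2 ^+ 52 * w ^+ 468) * 2 ^+ 44 by rewrite e96; ring.
  have aux (t a c d v : R) : a * (t * 100) <= c -> t * v <= a -> 1000 * a <= t * a -> 1000 * v <= t * v ->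
     c <= d -> 8 <= v -> 500 * v + 3 + t * a < d / 10 by move=> *; lra.
  rewrite -mulrA; apply: (aux _ _ _ _ _ hA hB hC hD) => //.
  by rewrite -hE.
(* For N near H the primes reach only (N + H) / 3 <= 3H/4, worth at most (3/2) H ln 2 against the 2
   H ln 2 of the binomial coefficient. *)
have [NH|NH] := leqP (4 * N) (5 * H).
  have C2 : ln ('C(2 * H, H)%:R : R) <= ln 'C(m, H)%:R.
    rewrite ler_ln ?posrE ?ltr0n ?bin_gt0// ?ler_nat; [|clear; lia].
    by apply: leq_bin2l; rewrite mul2n -addnn leq_add2r.
  pose D := (m %/ 3)%N.
  have DH : (D <= H)%N by rewrite /D -ltnS ltn_divLR// /m; clear -NH H00; lia.
  have sD : \sum_(1 <= d < H.+1) Lam d * (bincoef m H d)%:R <= psi D.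
    rewrite (@big_cat_nat _ _ _ D.+1 1)//= [X in _ + X]big1_seq ?addr0; last first.
      move=> d; rewrite mem_index_iota => /andP[_ /andP[Dd]]; rewrite ltnS => dH.
      have d3 : (m < d * 3)%N by rewrite -ltn_divLR.
      rewrite /bincoef mH.
      have d0 : (0 < d)%N by clear -d3; lia.
      have -> : (m %/ d = 2)%N.
        apply/eqP; rewrite eqn_leq -ltnS ltn_divLR// leq_divRL//; rewrite /m in d3 *.
        by clear -d3 dH HN; lia.
      have -> : (H %/ d = 1)%N.
        apply/eqP; rewrite eqn_leq -ltnS ltn_divLR// leq_divRL//; rewrite /m in d3 *.
        by clear -d3 dH HN; lia.
      have -> : (N %/ d = 1)%N.
        apply/eqP; rewrite eqn_leq -ltnS ltn_divLR// leq_divRL//; rewrite /m in d3 *.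
        by clear -d3 dH HN NH; lia.
      by rewrite mulr0.
    apply: ler_sum_nat => d /andP[d0 _]; rewrite ler_piMr ?vonMangoldt_ge0//.
    by have [_] := @bincoef_le1 m H d d0 Hm; rewrite lern1.
  have DR : D%:R * 4 <= 3 * H%:R :> R.
    rewrite -!natrM ler_nat; have := leq_trunc_div m 3; rewrite -/D /m; clear -NH; lia.
  have := psi_le R D.
  have : D%:R * 4 * ln 2 <= 3 * H%:R * ln 2 :> R by apply: ler_wpM2r => //; lra.
  have : 2^-1 * H%:R <= ln 2 * H%:R :> R by apply: ler_wpM2r.
  move: up C2 lb0 lnH small sD; move: (ln 'C(m, H)%:R) (ln 'C(2 * H, H)%:R) (psi D) (ln (2 * H).+1%:R).
  move: (\sum_(1 <= d < H.+1) _) (10 ^+ 5 * 2 ^+ 52 * w ^+ 468) => a b c d e f.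
  by move=> *; lra.
(* The bound for psi H is now the full 2 H ln 2, the main term of ln 'C(2H, H). The growth over j
   steps adds j ln (9/5), about H/9 or more, which exceeds all errors, below H/10. *)
pose j := (H %/ 4)%N.
have jH : (4 * j <= H)%N by rewrite mulnC leq_trunc_div.
have jH' : (H < 4 * j.+1)%N by rewrite mulnC ltn_ceil.
have C2 : j%:R * ln (9 / 5) + ln ('C(2 * H, H)%:R : R) <= ln 'C(m, H)%:R.
  apply: (@le_trans _ _ (ln 'C(2 * H + j, H)%:R)); last first.
    rewrite ler_ln ?posrE ?ltr0n ?bin_gt0// ?ler_nat; [|clear; lia].
    by apply: leq_bin2l; rewrite /m; clear -NH jH; lia.
  have g := bin_growth jH.
  have : ln ((9 ^ j * 'C(2 * H, H))%N%:R : R) <= ln (5 ^ j * 'C(2 * H + j, H))%N%:R.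
    by rewrite ler_ln ?posrE ?ltr0n ?muln_gt0 ?expn_gt0 ?bin_gt0 ?ler_nat//=; clear; lia.
  rewrite !natrM !lnM ?posrE ?ltr0n ?expn_gt0 ?bin_gt0//; [|clear; lia|clear; lia].
  rewrite !natrX !lnXn// lnV ?posrE// -[ln 9 *+ _]mulr_natl -[ln 5 *+ _]mulr_natl.
  have aux (a b c x y : R) : x * a + b <= x * y + c -> x * (a - y) + b <= c by move=> *; lra.
  exact: aux.
have l95 : 4 / 9 <= ln (9 / 5) :> R.
  have := @le_ln1Dx R (- (4 / 9)).
  have -> : 1 + - (4 / 9) = (9 / 5)^-1 :> R by lra.
  rewrite lnV ?posrE ?divr_gt0// => /(_ _)/Wrap[|[]]; first by lra.
  by move: (ln (9 / 5)) => t; lra.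
have sD : \sum_(1 <= d < H.+1) Lam d * (bincoef m H d)%:R <= psi H.
  apply: ler_sum_nat => d /andP[d0 _]; rewrite ler_piMr ?vonMangoldt_ge0//.
  by have [_] := @bincoef_le1 m H d d0 Hm; rewrite lern1.
have jR : H%:R <= 4 * (j%:R + 1) :> R by rewrite natr1 -(natrM _ 4) ler_nat ltnW.
have := psi_le R H.
have : j%:R * (4 / 9) <= j%:R * ln (9 / 5) :> R by apply: ler_wpM2l.
move: up C2 lb0 lnH small sD; move: (ln 'C(m, H)%:R) (ln 'C(2 * H, H)%:R) (psi H) (ln (2 * H).+1%:R).
move: (\sum_(1 <= d < H.+1) _) (10 ^+ 5 * 2 ^+ 52 * w ^+ 468) (j%:R * ln (9 / 5)) => a b c d e f g.
by move=> *; lra.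
Qed.
End Sylvester.

(** * Exponential sums over primes *)

Section PrimeExpSum.
Variable R : realType.
Local Notation Lam := (vonMangoldt R).

(** The D-th root of the hypothesis on T reads T <= U (C / U)^(1/D); as U is at least z / 2, a z
    beyond a constant times r^(2D) turns this into the saving r^2 over Y. *)
Lemma saving_root D (C T U Y z r : R) : (0 < D)%N -> 0 < C -> 0 <= T -> 0 < U -> 0 < Y -> 0 < r ->
  T ^+ D <= C * U ^+ D.-1 -> U <= 3 * Y -> z <= 2 * U -> 2 * C * 3 ^+ D * r ^+ (2 * D) <= z ->
  T <= Y / r ^+ 2.
Proof.
move=> D0 C0 T0 U0 Y0 r0 TC UY zU rz.
rewrite ler_pdivlMr ?exprn_gt0// -(@ler_pXn2r _ D)// ?nnegrE; [|by sgn|exact: ltW].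
have K0 : 0 < 2 * C * 3 ^+ D by sgn.
rewrite -(ler_pM2l K0) exprMn -exprM.
apply: (@le_trans _ _ (T ^+ D * z)).
  rewrite mulrCA; apply: ler_wpM2l; first by sgn.
  exact: rz.
apply: (@le_trans _ _ (C * U ^+ D.-1 * (2 * U))).
  apply: (@le_trans _ _ (T ^+ D * (2 * U))); first by apply: ler_wpM2l => //; sgn.
  by apply: ler_wpM2r => //; sgn.
have -> : C * U ^+ D.-1 * (2 * U) = 2 * C * U ^+ D.
  have -> : U ^+ D = U ^+ D.-1 * U by rewrite -exprSr prednK.
  by ring.
have -> : 2 * C * 3 ^+ D * Y ^+ D = 2 * C * (3 * Y) ^+ D by rewrite exprMn; ring.
apply: ler_wpM2l; first by rewrite mulr_ge0// ltW.
by rewrite lerXn2r ?nnegrE ?mulr_ge0// ltW.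
Qed.

Lemma sum_nat_window (F : nat -> R) A B lo hi (p : pred nat) : (A <= lo.+1)%N -> (hi < B)%N -> (lo < hi)%N ->
  (forall b, (A <= b < B)%N -> p b = (lo < b <= hi)%N) ->
  \sum_(A <= b < B | p b) F b = \sum_(0 <= u < hi - lo) F (lo.+1 + u)%N.
Proof.
move=> Alo hB lohi pE.
have -> : \sum_(0 <= u < hi - lo) F (lo.+1 + u)%N = \sum_(lo.+1 <= b < hi.+1) F b.
  rewrite -{2}[lo.+1]add0n big_addn subSS; apply: eq_bigr => u _; by rewrite addnC.
rewrite big_nat_cond (eq_bigl (fun b => (A <= b < B)%N && (lo < b <= hi)%N)); last first.
  by move=> b; case: (boolP (A <= b < B)%N) => //= /pE.
rewrite -big_nat_cond (@big_cat_nat _ _ _ lo.+1 A B)//=; last by apply: leq_trans hB; exact: ltnW.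
rewrite [X in X + _]big_nat_cond [X in X + _]big_pred0 ?add0r; last first.
  by move=> b; apply/negbTE; clear; lia.
rewrite (@big_cat_nat _ _ _ hi.+1 lo.+1 B)//=; last by rewrite ltnS ltnW.
rewrite [X in _ + X]big_nat_cond [X in _ + X]big_pred0 ?addr0; last first.
  by move=> b; apply/negbTE; clear; lia.
by rewrite big_nat_cond [RHS]big_nat; apply: eq_bigl => b; clear; lia.
Qed.

(** Vaughan's identity at level z, the cube root of P. The bound X^5 >= 10^6 z^26 comes from the
    bilinear sums: for rows n, m the phase has size at least X / (2 n^2) over b of size P / n, and
    [weyl_bound] then asks that P^6 n^4 be at most a constant times X^5. *)
Lemma prime_expsum kap : (0 < kap)%N -> exists D : nat, exists2 C : R, (0 < D)%N /\ 0 < C &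
  forall (z : nat) (r X : R), (4 <= z)%N -> 1 <= r -> r ^+ 2 <= z%:R ->
    2 * C * 3 ^+ D * r ^+ (2 * D) <= z%:R ->
    10 ^+ 6 * z%:R ^+ 26 <= X ^+ 5 -> 0 < X -> X <= z%:R ^+ kap ->
  `|\sum_((z ^ 3).+1 <= u < (2 * z ^ 3).+1) Lam u * cos (X / u%:R)|
    <= 9 * (1 + ln (2 * z ^ 3)%N%:R) ^+ 3 * (z ^ 3)%N%:R / r.
Proof.
move=> kap0; have [|D [C [D0 C0] H]] := @weyl_bound R 1 (2 * kap) isT; first by rewrite muln_gt0.
exists D, C => // z r X z4 r1 rz Drz Xz X0 Xkap.
have z0 : (0 < z)%N by apply: leq_trans z4.
have zR0 : 0 < z%:R :> R by rewrite ltr0n.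
have zR1 : 1 <= z%:R :> R by rewrite ler1n.
have r0 : 0 < r by apply: lt_le_trans r1.
set P := (z ^ 3)%N.
have P0 : (0 < P)%N by rewrite expn_gt0 z0.
have PR0 : 0 < P%:R :> R by rewrite ltr0n.
have PRz : P%:R = z%:R ^+ 3 :> R by rewrite natrX.
have zP : (z <= P)%N by rewrite /P -{1}[z]expn1 leq_exp2l// (leq_trans _ z4).
(* 3^6 comes from U <= 3 P / n, 2^5 from m <= 2 n, and the further 2^4 from n <= 2 z^2. *)
have [K K1 [K0 K6]] : exists2 K : R, K = 3 ^+ 6 * 2 ^+ 5 & 1 <= K /\ K * 2 ^+ 4 <= 10 ^+ 6.
  by exists (3 ^+ 6 * 2 ^+ 5) => //; split; rewrite !exprS expr0; lra.
have K36 : 3 ^+ 6 <= K by rewrite K1 !exprS expr0; lra.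
have Ubnd d : (0 < d)%N -> (d <= 2 * P)%N -> (P %/ d).+1%:R <= 3 * (P%:R / d%:R) :> R.
  move=> d0 dP; have dR : 0 < d%:R :> R by rewrite ltr0n.
  have h1 : (P %/ d)%:R <= P%:R / d%:R :> R by rewrite ler_pdivlMr// -natrM ler_nat leq_trunc_div.
  have h2 : 1 <= 2 * (P%:R / d%:R) :> R.
    by rewrite mulrA ler_pdivlMr// mul1r -natrM ler_nat.
  by rewrite -natr1; move: h1 h2; move: (P%:R / d%:R) => p; lra.
have Xpow d : (z <= 2 * (P %/ d).+1)%N -> z%:R ^+ kap <= (P %/ d).+1%:R ^+ (2 * kap) :> R.
  move=> zU; rewrite exprM lerXn2r ?nnegrE ?exprn_ge0// -natrX ler_nat.
  by rewrite -mulnn; clear -zU z4; nia.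
apply: (@vaughan_bound R P z X r) => //.
- move=> d n /andP[d0 dz] nP.
  set U := (P %/ d).+1.
  have dR : 0 < d%:R :> R by rewrite ltr0n.
  have dP : (d <= P)%N by apply: leq_trans dz _; rewrite /P mulnn leq_exp2l// (leq_trans _ z4).
  have zU : (z <= P %/ d)%N by rewrite leq_divRL// /P expnS leq_mul2l -mulnn dz orbT.
  have := H U (X / d%:R) U n isT.
  case/(_ _ _ _ _ _)/Wrap => [|||||[W]].
  + rewrite muln1 expr_div_n; apply: (@le_trans _ _ ((3 * (P%:R / d%:R)) ^+ 6)).
      by rewrite lerXn2r ?nnegrE ?mulr_ge0 ?divr_ge0// Ubnd//; clear -dP; lia.
    have -> : (3 * (P%:R / d%:R)) ^+ 6 = 3 ^+ 6 * (P%:R ^+ 6 / d%:R ^+ 6) :> R.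
      by rewrite !exprMn exprVn.
    have -> : 3 ^+ 6 * (P%:R ^+ 6 / d%:R ^+ 6) = 3 ^+ 6 * P%:R ^+ 6 / d%:R / d%:R ^+ 5 :> R.
      by move: (3 ^+ 6 : R) => c; field; rewrite gt_eqF.
    rewrite ler_pM2r ?invr_gt0 ?exprn_gt0// ler_pdivrMr//.
    apply: (@le_trans _ _ (X ^+ 5)); last by rewrite ler_peMr ?ler1n// exprn_ge0// ltW.
    apply: le_trans Xz; rewrite PRz -exprM; apply: ler_pM => //; first by apply: le_trans K36 _; apply: le_trans K6; rewrite ler_peMr ?exprn_ege1//; lra.
    by apply: ler_weXn2l.
  + by rewrite divr_gt0.
  + apply: (@le_trans _ _ X); first by rewrite ler_pdivrMr// ler_peMr ?ler1n// ltW.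
    by apply: le_trans Xkap _; apply: Xpow; clear -zU; lia.
  + by [].
  + have : (2 * P %/ d < 2 * U)%N.
      by rewrite ltn_divLR// -mulnA ltn_mul2l/= /U -ltn_divLR.
    move: nP; rewrite -/U; clear; rewrite /U; lia.
  have -> : \sum_(0 <= u < n) cos (X / (d * (U + u))%:R) = \sum_(0 <= u < n) cos (X / d%:R / (U + u)%:R ^+ 1).
    by apply: eq_bigr => u _; rewrite expr1 natrM invfM mulrA.
  apply: (saving_root D0 C0 (normr_ge0 _) (_ : 0 < U%:R) _ r0 W) Drz => //.
  + by rewrite divr_gt0.
  + by apply: Ubnd => //; clear -dP; lia.
  + by rewrite -(natrM _ 2) ler_nat /U; clear -zU; lia.
move=> n m zn zm nm n2m m2n.
have n0 : (0 < n)%N by apply: leq_ltn_trans zn.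
have m0 : (0 < m)%N by apply: leq_ltn_trans zm.
have nR : 0 < n%:R :> R by rewrite ltr0n.
have mR : 0 < m%:R :> R by rewrite ltr0n.
pose lo := maxn z (maxn (P %/ n) (P %/ m)).
pose hi := minn (2 * P %/ n) (2 * P %/ m).
have cE b : (z < b)%N -> ((P < b * n <= 2 * P)%N && (P < b * m <= 2 * P)%N) = (lo < b <= hi)%N.
  move=> zb; rewrite /lo /hi !gtn_max leq_min zb/= !ltn_divLR// !leq_divRL//.
  by clear; case: (P < b * n)%N; case: (P < b * m)%N; rewrite ?andbF.
have [hilo|lohi] := leqP hi lo.
  rewrite big_nat_cond big_pred0 ?normr0; first by sgn.
  move=> b; apply/negbTE/negP => /andP[/andP[zb _]]; rewrite cE// => /andP[lb bh].
  by move: (leq_trans lb bh); rewrite ltnNge hilo.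
have hP : (hi <= 2 * P)%N by rewrite /hi geq_min leq_div.
rewrite (@sum_nat_window _ _ _ lo hi)//; last 2 first.
- by rewrite /lo ltnS leq_max leqnn.
- by move=> b /andP[zb _]; exact: cE.
set U := (P %/ n).+1.
have zhi : (z < hi)%N by apply: leq_ltn_trans lohi; rewrite leq_max leqnn.
have hin : (hi <= 2 * P %/ n)%N by rewrite geq_minl.
have h2U : (2 * P %/ n < 2 * U)%N.
  by rewrite ltn_divLR// -mulnA ltn_mul2l/= /U -ltn_divLR.
(* A nonempty range of b > z bounds n by 2 z^2; the extreme case, with n about z^2 and b about z,
   dictates the exponent 26 = 18 + 8. *)
have nz : (n * z <= 2 * P)%N.
  rewrite mulnC -leq_divRL//; apply: leq_trans hin; exact: ltnW.
have nz2 : (n <= 2 * z ^ 2)%N.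
  by move: nz; rewrite /P expnSr mulnA leq_pmul2r.
have nP : (n <= 2 * P)%N by apply: leq_trans nz; rewrite leq_pmulr.
pose X' := `|X / n%:R - X / m%:R|.
have X'lo : X / (n%:R * m%:R) <= X'.
  have -> : X' = X * `|m%:R - n%:R| / (n%:R * m%:R).
    rewrite /X' -[in RHS](gtr0_norm X0) -normrM -[n%:R * m%:R in RHS]gtr0_norm ?mulr_gt0//.
    rewrite -normf_div; congr (`|_|); field; by rewrite !gt_eqF.
  rewrite ler_pM2r ?invr_gt0 ?mulr_gt0//; apply: ler_peMr; first exact: ltW.
  have [mn|mn] := leqP m n.
    rewrite distrC ger0_norm ?subr_ge0 ?ler_nat// -natrB// ler1n subn_gt0 ltn_neqAle mn andbT.
    by rewrite eq_sym.
  have nm' := ltnW mn; by rewrite ger0_norm ?subr_ge0 ?ler_nat// -natrB// ler1n subn_gt0.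
have X'0 : 0 < X' by apply: lt_le_trans X'lo; rewrite divr_gt0 ?mulr_gt0.
have X'up : X' <= X.
  have xn : 0 <= X / n%:R <= X.
    by apply/andP; split; [rewrite divr_ge0// ltW|rewrite ler_pdivrMr// ler_peMr ?ler1n// ltW].
  have xm : 0 <= X / m%:R <= X.
    by apply/andP; split; [rewrite divr_ge0// ltW|rewrite ler_pdivrMr// ler_peMr ?ler1n// ltW].
  by rewrite /X' ler_norml; move: xn xm; move: (X / n%:R) (X / m%:R) => p q; lra.
have := H U X' lo.+1 (hi - lo)%N isT.
case/(_ _ _ _ _ _)/Wrap => [|||||[W]].
- rewrite muln1; apply: (@le_trans _ _ ((3 * (P%:R / n%:R)) ^+ 6)).
    by rewrite lerXn2r ?nnegrE ?mulr_ge0 ?divr_ge0// Ubnd.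
  apply: (@le_trans _ _ ((X / (n%:R * m%:R)) ^+ 5)); last first.
    have q0 : 0 <= X / (n%:R * m%:R) by apply: divr_ge0; [exact: ltW|exact: mulr_ge0].
    by rewrite lerXn2r ?nnegrE// ltW.
  apply: (@le_trans _ _ ((X / (2 * n%:R ^+ 2)) ^+ 5)); last first.
    have q1 : 0 <= X / (2 * n%:R ^+ 2) by rewrite divr_ge0 ?mulr_ge0 ?exprn_ge0// ltW.
    have q2 : 0 <= X / (n%:R * m%:R) by rewrite divr_ge0 ?mulr_ge0// ltW.
    rewrite lerXn2r ?nnegrE//.
    rewrite ler_pM2l// lef_pV2 ?posrE ?mulr_gt0 ?exprn_gt0//.
    rewrite expr2 mulrCA; apply: ler_wpM2l; first exact: ltW.
    by rewrite -natrM ler_nat.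
  have -> : (3 * (P%:R / n%:R)) ^+ 6 = (K * P%:R ^+ 6 * n%:R ^+ 4) / (2 ^+ 5 * n%:R ^+ 10) :> R.
    rewrite !exprMn exprVn K1; have : 2 ^+ 5 != 0 :> R by rewrite expf_neq0.
    by move: (3 ^+ 6 : R) (2 ^+ 5 : R) => c e e0; field; rewrite e0 gt_eqF.
  have -> : (X / (2 * n%:R ^+ 2)) ^+ 5 = X ^+ 5 / (2 ^+ 5 * n%:R ^+ 10) :> R.
    by rewrite expr_div_n [(2 * _) ^+ 5]exprMn -[(n%:R ^+ 2) ^+ 5]exprM.
  rewrite ler_pM2r ?invr_gt0 ?mulr_gt0 ?exprn_gt0//.
  apply: le_trans Xz.
  have n4 : n%:R ^+ 4 <= 2 ^+ 4 * z%:R ^+ 8 :> R.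
    have -> : 2 ^+ 4 * z%:R ^+ 8 = (2 * z%:R ^+ 2) ^+ 4 :> R.
      by rewrite [(2 * _) ^+ 4]exprMn -[(z%:R ^+ 2) ^+ 4]exprM.
    by rewrite lerXn2r ?nnegrE ?mulr_ge0 ?exprn_ge0// -natrX -natrM ler_nat.
  have K00 : 0 <= K by apply: le_trans K0.
  apply: (@le_trans _ _ (K * P%:R ^+ 6 * (2 ^+ 4 * z%:R ^+ 8))).
    by apply: ler_wpM2l => //; rewrite mulr_ge0// exprn_ge0.
  have -> : K * P%:R ^+ 6 * (2 ^+ 4 * z%:R ^+ 8) = K * 2 ^+ 4 * z%:R ^+ 26.
    have e1 : (3 * 6 = 18)%N by [].
    have e2 : (18 + 8 = 26)%N by [].
    by rewrite PRz -exprM e1 -e2 exprD; ring.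
  by apply: ler_wpM2r => //; rewrite exprn_ge0.
- exact: X'0.
- apply: le_trans X'up _; apply: le_trans Xkap _; apply: Xpow.
  by rewrite ltnW// (leq_trans zhi)// (leq_trans hin)// ltnW.
- by rewrite /U /lo ltnS !leq_max leqnn orbT.
- by rewrite addSn subnKC ?(ltnW lohi)// (leq_ltn_trans hin).
have -> : \sum_(0 <= u < hi - lo) cos (X / ((lo.+1 + u) * n)%:R - X / ((lo.+1 + u) * m)%:R) =
   \sum_(0 <= u < hi - lo) cos (X' / (lo.+1 + u)%:R ^+ 1).
  apply: eq_bigr => u _; rewrite expr1 -[LHS]cos_norm; congr cos.
  have b0 : 0 < (lo.+1 + u)%:R :> R by rewrite ltr0n.
  have e : X / ((lo.+1 + u) * n)%:R - X / ((lo.+1 + u) * m)%:R = (X / n%:R - X / m%:R) / (lo.+1 + u)%:R.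
    rewrite ![(_ * _)%:R]natrM; move: ((lo.+1 + u)%:R : R) b0 => b b0.
    by field; rewrite !gt_eqF.
  by rewrite e normf_div (gtr0_norm b0).
apply: (saving_root D0 C0 (normr_ge0 _) (_ : 0 < U%:R) _ r0 W) Drz => //.
- by rewrite divr_gt0.
- exact: Ubnd.
- by rewrite -(natrM _ 2) ler_nat ltnW// (ltn_trans zhi)// (leq_ltn_trans hin).
Qed.
End PrimeExpSum.

(** * Detecting small distance to the integers *)

Section Detection.
Variable R : realType.

(** The squared modulus of the sum of exp (2 pi i j x) over j < M: Fejer's kernel without its factor
    1 / M. *)
Definition fejer (M : nat) (x : R) : R :=
  \sum_(j < M) \sum_(l < M) cos (2 * pi * (j%:R - l%:R) * x).

Lemma fejerE M x : fejer M x = (\sum_(j < M) cos (2 * pi * j%:R * x)) ^+ 2 +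
  (\sum_(j < M) sin (2 * pi * j%:R * x)) ^+ 2.
Proof.
rewrite /fejer !expr2 !mulr_suml -big_split/=; apply: eq_bigr => j _.
rewrite !mulr_sumr -big_split/=; apply: eq_bigr => l _.
by rewrite -cosB; congr cos; ring.
Qed.

Lemma fejer_ge0 M x : 0 <= fejer M x.
Proof. by rewrite fejerE addr_ge0// sqr_ge0. Qed.

Lemma fejer_le M x : fejer M x <= M%:R ^+ 2.
Proof.
apply: (@le_trans _ _ (\sum_(j < M) \sum_(l < M) 1)).
  by apply: ler_sum => j _; apply: ler_sum => l _; exact: cos_le1.
by rewrite !sumr_const !card_ord -mulrnA -natrX -mulnn.
Qed.

Lemma cos_2piDint (y : R) (k : int) : cos (y + 2 * pi * k%:~R) = cos y.
Proof.
have per (n : nat) (x : R) : cos (x + 2 * pi * n%:R) = cos x.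
  have := periodicn (@cosD2pi R) n x.
  by rewrite -[pi *+ 2]mulr_natl -[(2 * pi) *+ n]mulr_natr.
case: k => k; first by rewrite -pmulrn per.
by rewrite NegzE mulrNz mulrN -[LHS](per k.+1) -pmulrn subrK.
Qed.

Lemma near_int_of_cos (x d : R) : 0 < d <= 2^-1 -> cos (2 * pi * d) < cos (2 * pi * x) ->
  exists m : int, `|x - m%:~R| < d.
Proof.
move=> /andP[d0 d1] cosx; pose m := Num.floor (x + 2^-1); exists m.
have pi0 := pi_gt0 R.
have /andP[lo hi] : m%:~R <= x + 2^-1 < (m + 1)%:~R by rewrite floor_le_tmp floorD1_gt.
rewrite intrD in hi.
pose y := x - m%:~R.
have y2 : `|y| <= 2^-1.
  by rewrite ler_norml /y; move: lo hi; move: (m%:~R : R) => p; lra.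
have cy : cos (2 * pi * x) = cos (2 * pi * `|y|).
  have -> : cos (2 * pi * `|y|) = cos (2 * pi * y).
    by case: (ger0P y) => _ //; rewrite mulrN cosN.
  by rewrite -[RHS](cos_2piDint _ m); congr cos; rewrite /y; ring.
rewrite ltNge; apply/negP => dy; move: cosx; rewrite cy ltNge => /negP; apply.
have pd (z : R) : 0 <= z <= 2^-1 -> 2 * pi * z \in `[0, pi]%R.
  move=> /andP[z0 z1]; rewrite in_itv/=; apply/andP; split.
    by rewrite mulr_ge0// mulr_ge0// ltW.
  have h : pi * z <= pi * 2^-1 by apply: ler_wpM2l => //; exact: ltW.
  by move: h; rewrite -mulrA; move: (pi * z) => t; lra.
rewrite leNgt ltr_cos; [|by apply: pd; rewrite normr_ge0|by apply: pd; rewrite ltW].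
rewrite -leNgt; apply: ler_wpM2l => //; by rewrite mulr_ge0// ltW.
Qed.

Lemma one_sub_cos_ge (d : R) : 0 <= d <= 4^-1 -> 2 * d ^+ 2 <= 1 - cos (2 * pi * d).
Proof.
move=> /andP[d0 d1]; rewrite cos_half_angle.
have -> : 2 * pi * d / 2 = pi * d by field.
have p2 := pi_ge2 R.
have p4 : pi < 4 :> R by have := pihalf_lt2 R; lra.
have pd0 : 0 <= pi * d by rewrite mulr_ge0// pi_ge0.
have pd1 : pi * d <= 1.
  have : pi * d <= 4 * d by apply: ler_wpM2r => //; exact: ltW.
  by lra.
have h := @sin_ge_half R (pi * d); rewrite pd0 pd1 in h; have {}h := h isT.
have d1' : d <= sin (pi * d).
  apply: le_trans h; have : 2 * d <= pi * d by apply: ler_wpM2r.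
  by lra.
have : d ^+ 2 <= sin (pi * d) ^+ 2 by rewrite lerXn2r ?nnegrE// (le_trans d0).
by lra.
Qed.

(** As pi < 4, every phase 2 pi j (x - m) with j < M is at most 1 in absolute value, so each cosine
    is at least 1/2. *)
Lemma fejer_ge_near M (x : R) (m : int) : (0 < M)%N -> `|x - m%:~R| <= (8 * M%:R)^-1 ->
  M%:R ^+ 2 / 4 <= fejer M x.
Proof.
move=> M0 xm; have MR : 0 < M%:R :> R by rewrite ltr0n.
have p4 : pi < 4 :> R by have := pihalf_lt2 R; lra.
have p0 := pi_gt0 R.
rewrite fejerE; apply: (@le_trans _ _ ((\sum_(j < M) cos (2 * pi * j%:R * x)) ^+ 2)); last first.
  by rewrite lerDl sqr_ge0.
have -> : M%:R ^+ 2 / 4 = (M%:R / 2) ^+ 2 :> R by rewrite expr_div_n; congr (_ / _); ring.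
have half (j : 'I_M) : 2^-1 <= cos (2 * pi * j%:R * x).
  have -> : cos (2 * pi * j%:R * x) = cos (2 * pi * j%:R * (x - m%:~R)).
    rewrite -(@cos_2piDint (2 * pi * j%:R * (x - m%:~R)) ((j : nat)%:Z * m)); congr cos.
    by rewrite intrM -pmulrn; ring.
  set y := _ * (x - _).
  have y1 : `|y| <= 1.
    rewrite /y !normrM (gtr0_norm p0) normr_nat normr_nat.
    have jM : j%:R <= M%:R :> R by rewrite ler_nat ltnW.
    apply: (@le_trans _ _ (2 * 4 * M%:R * (8 * M%:R)^-1)); last first.
      have -> : 2 * 4 = 8 :> R by ring.
      by rewrite mulfV// gt_eqF// mulr_gt0.
    apply: ler_pM => //; first by rewrite mulr_ge0// mulr_ge0// ltW.
    apply: ler_pM => //; first by rewrite mulr_ge0// ltW.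
    by apply: ler_wpM2l => //; exact: ltW.
  have y2 : y ^+ 2 <= 1 by rewrite -real_normK ?num_real// exprn_ile1.
  by have := cos_ge_quadratic y; lra.
have S : M%:R / 2 <= \sum_(j < M) cos (2 * pi * j%:R * x).
  apply: (@le_trans _ _ (\sum_(j < M) 2^-1)); last by apply: ler_sum => j _; exact: half.
  by rewrite sumr_const card_ord mulr_natl.
have M20 : 0 <= M%:R / 2 :> R by rewrite divr_ge0.
by rewrite lerXn2r ?nnegrE// (le_trans M20).
Qed.

Section Sums.
Variables (s : seq nat) (w th : nat -> R) (E : R) (M : nat).
Hypotheses (M0 : (0 < M)%N) (w0 : forall u, 0 <= w u) (E0 : 0 <= E).
Let S (k : R) : R := \sum_(u <- s) w u * cos (2 * pi * k * th u).
Hypothesis SE : forall k : nat, (0 < k <= M)%N -> `|S k%:R| <= E.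
Let Psi : R := \sum_(u <- s) w u.

Let SN k : S (- k) = S k.
Proof. by apply: eq_bigr => u _; rewrite mulrN mulNr cosN. Qed.

Let S0 : S 0 = Psi.
Proof. by apply: eq_bigr => u _; rewrite mulr0 mul0r cos0 mulr1. Qed.

Let S_int (a b : nat) : (a <= M)%N -> (b <= M)%N -> `|S (a%:R - b%:R) - (a == b)%:R * Psi| <= E.
Proof.
move=> aM bM; have [->|ab] := eqVneq a b; first by rewrite subrr S0 mul1r subrr normr0.
rewrite mul0r subr0; have [l|l] := leqP b a.
  rewrite -natrB//; apply: SE; rewrite subn_gt0 ltn_neqAle eq_sym ab l/=.
  by rewrite (leq_trans _ aM)// leq_subr.
rewrite -opprB SN -natrB ?(ltnW l)//; apply: SE; rewrite subn_gt0 l/=.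
by rewrite (leq_trans _ bM)// leq_subr.
Qed.

Lemma sum_fejer_le : \sum_(u <- s) w u * fejer M (th u) <= M%:R * Psi + M%:R ^+ 2 * E.
Proof.
have -> : \sum_(u <- s) w u * fejer M (th u) = \sum_(j < M) \sum_(l < M) S (j%:R - l%:R).
  rewrite /fejer; under eq_bigr do rewrite mulr_sumr.
  rewrite exchange_big/=; apply: eq_bigr => j _.
  under eq_bigr do rewrite mulr_sumr.
  by rewrite exchange_big.
apply: (@le_trans _ _ (\sum_(j < M) \sum_(l < M) ((j == l :> nat)%:R * Psi + E))).
  apply: ler_sum => j _; apply: ler_sum => l _.
  by have := @S_int j l (ltnW (ltn_ord j)) (ltnW (ltn_ord l)); rewrite ler_norml => /andP[_]; lra.
apply: (@le_trans _ _ (\sum_(j < M) (Psi + M%:R * E))).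
  apply: ler_sum => j _; rewrite big_split/= sumr_const card_ord mulr_natl lerD2r.
  rewrite (bigD1 j)//= eqxx mul1r big1 ?addr0// => l lj.
  by rewrite eq_sym (negbTE lj : (l == j :> nat) = false) mul0r.
by rewrite sumr_const card_ord -[leLHS]mulr_natl mulrDr expr2 mulrA.
Qed.

(** The factor cos (2 pi x) shifts the frequency j - l by one up and down. Each shifted frequency is
    0 for M - 1 of the M^2 pairs, and every pair costs at most E. *)
Lemma sum_fejer_cos_ge : M%:R * Psi - Psi - M%:R ^+ 2 * E <=
  \sum_(u <- s) w u * (fejer M (th u) * cos (2 * pi * th u)).
Proof.
have -> : \sum_(u <- s) w u * (fejer M (th u) * cos (2 * pi * th u)) =
  \sum_(j < M) \sum_(l < M) (S (j.+1%:R - l%:R) + S (j%:R - l.+1%:R)) / 2.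
  transitivity (\sum_(u <- s) \sum_(j < M) \sum_(l < M)
     (w u * cos (2 * pi * (j.+1%:R - l%:R) * th u) + w u * cos (2 * pi * (j%:R - l.+1%:R) * th u)) / 2).
    apply: eq_bigr => u _; rewrite /fejer mulr_suml mulr_sumr; apply: eq_bigr => j _.
    rewrite mulr_suml mulr_sumr; apply: eq_bigr => l _.
    have -> : 2 * pi * (j.+1%:R - l%:R) * th u = 2 * pi * (j%:R - l%:R) * th u + 2 * pi * th u.
      by rewrite -natr1; ring.
    have -> : 2 * pi * (j%:R - l.+1%:R) * th u = 2 * pi * (j%:R - l%:R) * th u - 2 * pi * th u.
      by rewrite -natr1; ring.
    by rewrite cosD cosB; field.
  rewrite exchange_big/=; apply: eq_bigr => j _.
  rewrite exchange_big/=; apply: eq_bigr => l _.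
  by rewrite -mulr_suml big_split.
apply: (@le_trans _ _ (\sum_(j < M) \sum_(l < M)
    (((j.+1 == l :> nat)%:R + (j == l.+1 :> nat)%:R) / 2 * Psi - E))); last first.
  apply: ler_sum => j _; apply: ler_sum => l _.
  have := @S_int j.+1 l (ltn_ord j) (ltnW (ltn_ord l)); rewrite ler_norml => /andP[h1 _].
  have := @S_int j l.+1 (ltnW (ltn_ord j)) (ltn_ord l); rewrite ler_norml => /andP[h2 _].
  have aux (p q a b P F : R) : - F <= p - a * P -> - F <= q - b * P ->
    (a + b) / 2 * P - F <= (p + q) / 2 by move=> *; lra.
  exact: aux.
have row (j : nat) : \sum_(l < M) (j.+1 == l :> nat)%:R = (j.+1 < M)%N%:R :> R.
  have [h|h] := boolP (j.+1 < M)%N.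
    rewrite (bigD1 (Ordinal h))//= eqxx big1 ?addr0// => l lj.
    by rewrite eq_sym (negbTE (lj : (l : nat) != j.+1)).
  by rewrite big1// => l _; have [e|//] := eqVneq j.+1 (l : nat); move: h; rewrite e ltn_ord.
have cnt : \sum_(j < M) \sum_(l < M) (j.+1 == l :> nat)%:R = M%:R - 1 :> R.
  under eq_bigr do rewrite row.
  case: (M) M0 => // m _; rewrite big_ord_recr/= ltnn addr0.
  rewrite (eq_bigr (fun=> 1)) ?sumr_const ?card_ord -?natr1 ?addrK// => j _.
  by rewrite ltnS ltn_ord.
have cnt' : \sum_(j < M) \sum_(l < M) (j == l.+1 :> nat)%:R = M%:R - 1 :> R.
  rewrite exchange_big/= -cnt; apply: eq_bigr => j _; apply: eq_bigr => l _.
  by rewrite eq_sym.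
rewrite (eq_bigr (fun j : 'I_M => (\sum_(l < M) (j.+1 == l :> nat)%:R + \sum_(l < M) (j == l.+1 :> nat)%:R) / 2 * Psi
   - M%:R * E)); last first.
  move=> j _; rewrite sumrB sumr_const card_ord mulr_natl; congr (_ - _).
  by rewrite -mulr_suml -mulr_suml big_split.
rewrite sumrB -mulr_suml -mulr_suml big_split/= cnt cnt' sumr_const card_ord -[(_ * E) *+ _]mulr_natl.
rewrite le_eqVlt; apply/orP; left; apply/eqP; by field.
Qed.

(* Testing with fejer * (cos (2 pi x) - c), which is nonpositive away from the integers. *)
Lemma detect_lower (A : pred nat) (c : R) : 0 <= c <= 1 ->
  (forall u, u \in s -> ~~ A u -> cos (2 * pi * th u) <= c) ->
  Psi * (1 - c - M%:R^-1) - 2 * M%:R * E <= 2 * M%:R * \sum_(u <- s | A u) w u.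
Proof.
move=> /andP[c0 c1] Ac; have MR : 0 < M%:R :> R by rewrite ltr0n.
have up : \sum_(u <- s) w u * (fejer M (th u) * cos (2 * pi * th u)) - c * \sum_(u <- s) w u * fejer M (th u)
   <= 2 * M%:R ^+ 2 * \sum_(u <- s | A u) w u.
  rewrite mulr_sumr -sumrB mulr_sumr [leRHS]big_mkcond/= big_seq [leRHS]big_seq; apply: ler_sum => u us.
  have -> : w u * (fejer M (th u) * cos (2 * pi * th u)) - c * (w u * fejer M (th u)) =
    w u * (fejer M (th u) * (cos (2 * pi * th u) - c)) by ring.
  have F0 := fejer_ge0 M (th u); have F1 := fejer_le M (th u).
  case: ifPn => Au.
    rewrite mulrC; apply: ler_wpM2r => //.
    have cc : cos (2 * pi * th u) - c <= 2 by have := cos_le1 (2 * pi * th u); lra.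
    apply: (@le_trans _ _ (fejer M (th u) * 2)); first exact: ler_wpM2l.
    by rewrite mulrC; apply: ler_wpM2l.
  rewrite mulr_ge0_le0// mulr_ge0_le0// subr_le0; exact: Ac.
have l1 := sum_fejer_cos_ge; have l2 := sum_fejer_le.
have l3 : c * \sum_(u <- s) w u * fejer M (th u) <= c * (M%:R * Psi) + M%:R ^+ 2 * E.
  apply: (@le_trans _ _ (c * (M%:R * Psi + M%:R ^+ 2 * E))); first exact: ler_wpM2l.
  by rewrite mulrDr lerD2l ler_piMl// mulr_ge0// exprn_ge0.
rewrite -(ler_pM2l MR).
have -> : M%:R * (Psi * (1 - c - M%:R^-1) - 2 * M%:R * E) = M%:R * Psi - Psi - c * (M%:R * Psi) - 2 * (M%:R ^+ 2 * E).
  by field; rewrite gt_eqF.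
have -> : M%:R * (2 * M%:R * \sum_(u <- s | A u) w u) = 2 * M%:R ^+ 2 * \sum_(u <- s | A u) w u by ring.
by lra.
Qed.

(** On A the kernel is at least M^2 / 4, so [sum_fejer_le] divided by M^2 / 4 bounds the mass of
    A. *)
Lemma detect_upper (A : pred nat) : 
  (forall u, u \in s -> A u -> exists m : int, `|th u - m%:~R| <= (8 * M%:R)^-1) ->
  \sum_(u <- s | A u) w u <= 4 * Psi / M%:R + 4 * E.
Proof.
move=> Ac; have MR : 0 < M%:R :> R by rewrite ltr0n.
have M2 : 0 < M%:R ^+ 2 / 4 :> R by rewrite divr_gt0// exprn_gt0.
rewrite -(ler_pM2l M2).
apply: (@le_trans _ _ (\sum_(u <- s) w u * fejer M (th u))).
  rewrite mulr_sumr big_mkcond/= big_seq [leRHS]big_seq; apply: ler_sum => u us.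
  case: ifPn => Au; last by rewrite mulr_ge0// fejer_ge0.
  rewrite mulrC; apply: ler_wpM2l => //.
  by have [m xm] := Ac u us Au; exact: fejer_ge_near xm.
apply: le_trans sum_fejer_le _.
by rewrite le_eqVlt; apply/orP; left; apply/eqP; field; rewrite gt_eqF.
Qed.
End Sums.
End Detection.

(** * Primes exactly dividing an element of an interval *)

Section KeyProp.
Variable R : realType.
Local Notation Lam := (vonMangoldt R).
Local Notation psi := (psi R).

(** Multiplied by u <= 2P, the hypothesis puts m u at distance less than H/2 from the centre N + H/2
    of the window. A negative m is excluded because m u > N. *)
Lemma multiple_of_near (N H P u : nat) (m : int) : (P < u <= 2 * P)%N ->
  `|(N%:R + H%:R / 2) / u%:R - m%:~R| < H%:R / (4 * P%:R) :> R ->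
  (N %/ u < (N + H) %/ u)%N.
Proof.
move=> /andP[Pu uP] near; have u0 : (0 < u)%N by apply: leq_ltn_trans Pu.
have uR : 0 < u%:R :> R by rewrite ltr0n.
have P0 : (0 < P)%N by clear -u0 uP; lia.
have PR : 0 < P%:R :> R by rewrite ltr0n.
have near2 : `|N%:R + H%:R / 2 - m%:~R * u%:R| < H%:R / 2 :> R.
  have -> : N%:R + H%:R / 2 - m%:~R * u%:R = ((N%:R + H%:R / 2) / u%:R - m%:~R) * u%:R :> R.
    by rewrite mulrBl divfK// gt_eqF.
  rewrite normrM (gtr0_norm uR).
  apply: (@lt_le_trans _ _ (H%:R / (4 * P%:R) * u%:R)); first by rewrite ltr_pM2r.
  have -> : H%:R / 2 = H%:R / (4 * P%:R) * (2 * P%:R) :> R by field; rewrite gt_eqF.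
  by apply: ler_wpM2l; [sgn|rewrite -natrM ler_nat].
move: near2; rewrite ltr_norml => /andP[h1 h2].
have lo : N%:R < m%:~R * u%:R :> R by lra.
have hi : m%:~R * u%:R < (N + H)%:R :> R by rewrite natrD; lra.
case: m {near h1 h2} lo hi => k; last first.
  move=> lo _; exfalso; move: lo; rewrite NegzE mulrNz mulNr ltNge => /negP; apply.
  by apply: (@le_trans _ _ 0) => //; rewrite oppr_le0.
rewrite -pmulrn -natrM !ltr_nat => lo hi.
by apply: (@leq_trans k); [rewrite ltn_divLR|rewrite leq_divRL// ltnW].
Qed.

Lemma near_of_multiple (N H v : nat) : (0 < v)%N -> (N %/ v < (N + H) %/ v)%N ->
  `|(N%:R + H%:R / 2) / v%:R - ((N + H) %/ v)%N%:Z%:~R| <= H%:R / (2 * v%:R) :> R.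
Proof.
move=> v0; rewrite ltn_divLR// => lo; have hi := leq_trunc_div (N + H) v.
have vR : 0 < v%:R :> R by rewrite ltr0n.
move: lo hi; rewrite -pmulrn; move: ((N + H) %/ v)%N => m lo hi.
have -> : (N%:R + H%:R / 2) / v%:R - m%:R = (N%:R + H%:R / 2 - (m * v)%N%:R) / v%:R :> R.
  by rewrite natrM mulrBl mulfK// gt_eqF.
rewrite normrM (gtr0_norm (_ : 0 < v%:R^-1)) ?invr_gt0//.
have -> : H%:R / (2 * v%:R) = H%:R / 2 / v%:R :> R by field; rewrite gt_eqF.
rewrite ler_pM2r ?invr_gt0//.
have : N%:R < (m * v)%N%:R :> R by rewrite ltr_nat.
have : (m * v)%N%:R <= N%:R + H%:R :> R by rewrite -natrD ler_nat.
by move: ((m * v)%N%:R : R) => t h1 h2; rewrite ler_norml; lra.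
Qed.

(** The quotient m = (N + H) / u^2 determines u: two values a < b with the same m would put m a^2
    and m b^2 in the window, at distance more than P >= H. The quotients are at most 2N / P^2. *)
Lemma square_multiples_few (N H P : nat) : (0 < P)%N -> (H <= P)%N -> (H <= N)%N ->
  (size [seq u <- index_iota P.+1 (2 * P).+1 | N %/ u ^ 2 < (N + H) %/ u ^ 2] * P ^ 2 <= 2 * N)%N.
Proof.
move=> P0 HP HN; set s := (X in size X).
have sP u : u \in s -> [/\ (P < u)%N, (N < (N + H) %/ u ^ 2 * u ^ 2)%N & ((N + H) %/ u ^ 2 * u ^ 2 <= N + H)%N].
  rewrite mem_filter mem_index_iota => /andP[h /andP[Pu _]].
  split=> //; last exact: leq_trunc_div.
  by rewrite -ltn_divLR// expn_gt0 (leq_ltn_trans _ Pu).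
pose f u := ((N + H) %/ u ^ 2)%N.
have finj : {in s &, injective f}.
  move=> a b /sP[Pa la ha] /sP[Pb lb hb]; rewrite /f => e.
  wlog ab : a b Pa la ha Pb lb hb e / (a <= b)%N => [W|].
    by have [/W|/ltnW /W] := leqP a b; [apply|move=> W'; apply/esym/W'].
  apply/eqP; rewrite eqn_leq ab leqNgt; apply/negP => lab.
  move: la hb; rewrite e; move: ((N + H) %/ b ^ 2)%N => m la hb.
  have m0 : (0 < m)%N by case: m la {hb}.
  have : (a ^ 2 + P < b ^ 2)%N.
    apply: (@leq_trans (a.+1 ^ 2)); last by rewrite leq_exp2r.
    by rewrite -!mulnn mulSn mulnS; move: Pa; clear; lia.
  move=> ab2; have : (m * (a ^ 2 + P) <= m * b ^ 2)%N by rewrite leq_mul2l ltnW ?orbT.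
  have : (P <= m * P)%N by rewrite leq_pmull.
  by rewrite mulnDr; move: (m * a ^ 2)%N (m * b ^ 2)%N (m * P)%N la hb HP; clear; lia.
have fb u : u \in s -> (0 < f u <= 2 * N %/ P ^ 2)%N.
  move=> /sP[Pu la ha]; apply/andP; split.
    by rewrite /f; move: la; case: (_ %/ _)%N.
  rewrite leq_divRL ?expn_gt0 ?P0//; apply: (@leq_trans (f u * u ^ 2)).
    by rewrite leq_mul2l leq_exp2r// ltnW ?orbT.
  by apply: leq_trans ha _; move: HN; clear; lia.
have : (size s <= 2 * N %/ P ^ 2)%N.
  rewrite -(size_map f) -[leqRHS](size_iota 1); apply: uniq_leq_size.
    by rewrite map_inj_in_uniq// filter_uniq// iota_uniq.
  by move=> m /mapP[u /fb fu ->]; rewrite mem_iota add1n ltnS.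
by rewrite leq_divRL// expn_gt0 P0.
Qed.

(** A multiple of u^2 in the window puts (N + H/2) / u^2 within 1 / (8 T^10) of an integer, since u
    > P >= H, and [detect_upper] with M = T^10 counts such u by Weyl sums of X / u^2. The resulting
    density 8 / T^10 is small against the density 1 / (16 T^6) of the primes with a multiple in the
    window. *)
Lemma square_multiples_weyl (K : nat) : (0 < K)%N -> exists f0 : nat, forall f, (f0 <= f)%N ->
  exists T0 : nat, forall T H N : nat, (T0 <= T)%N -> (H <= T ^ (300 * f))%N ->
    (H <= N)%N -> (N <= T ^ (300 * f * K))%N ->
  \sum_((T ^ (300 * f)).+1 <= u < (2 * T ^ (300 * f)).+1 | (N %/ u ^ 2 < (N + H) %/ u ^ 2)%N) 1
   <= 8 * T%:R ^+ (300 * f) / T%:R ^+ 10 :> R.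
Proof.
move=> K0; have [|D [C [D0 C0] W]] := @weyl_bound R 2 (K + 2) isT; first by rewrite addn_gt0 K0.
exists D.+1 => f fD; have f0 : (0 < f)%N by apply: leq_trans fD.
exists ((Num.truncn (2 * C * 3 ^+ D)).+1 + 2 ^ 11)%N => T H N TT0 HP HN NK.
set q := (300 * f)%N in HP NK *; set P := (T ^ q)%N in HP *.
pose t : R := T%:R.
have T11 : (2 ^ 11 <= T)%N by apply: leq_trans TT0; rewrite leq_addl.
have T0 : (0 < T)%N by apply: leq_trans T11; rewrite expn_gt0.
have P0 : (0 < P)%N by rewrite expn_gt0 T0.
have tC : 2 * C * 3 ^+ D <= t.
  apply/ltW/(lt_le_trans (truncnS_gt _)); rewrite /t ler_nat; apply: leq_trans TT0.
  exact: leq_addr.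
have t11 : 2 ^+ 11 <= t by rewrite /t -natrX ler_nat.
have t1 : 1 <= t by rewrite /t ler1n.
have t16 : 2 ^+ 4 <= t by apply: le_trans t11; apply: ler_weXn2l => //; lra.
have tt0 : 0 < t by apply: lt_le_trans t1.
have q300 : (300 <= q)%N by rewrite /q leq_pmulr.
have Pt : P%:R = t ^+ q :> R by rewrite natrX.
rewrite -/q -/t -Pt.
have PR0 : 0 < P%:R :> R by rewrite ltr0n.
have tP a : (a <= q)%N -> t ^+ a <= P%:R by move=> aq; rewrite Pt; apply: ler_weXn2l.
have t100 : 0 < t ^+ 10 by rewrite exprn_gt0.
(* Weyl's bound for X / u^2 asks for X >= U^(11/5); the exponent 12/5 leaves room for U <= 2P. Below
   it the elementary count 2N / P^2 is already at most 2 P^(2/5). *)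
have [PN|NP] := leqP (P ^ 12) (N ^ 5); last first.
  set S := \sum_(_ <= _ < _ | _) _.
  have SE : S = (size [seq u <- index_iota P.+1 (2 * P).+1 | (N %/ u ^ 2 < (N + H) %/ u ^ 2)%N])%:R.
    by rewrite /S big_const_seq iter_addr_0 size_filter.
  have S0 : 0 <= S by rewrite SE.
  have SP : S * P%:R ^+ 2 <= 2 * N%:R.
    by rewrite SE -natrX -!natrM ler_nat; exact: square_multiples_few.
  have S5 : (S * P%:R ^+ 2) ^+ 5 <= 2 ^+ 5 * P%:R ^+ 12.
    apply: (@le_trans _ _ ((2 * N%:R) ^+ 5)).
      by rewrite lerXn2r ?nnegrE ?mulr_ge0// exprn_ge0.
    rewrite exprMn; apply: ler_wpM2l; first by rewrite exprn_ge0.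
    by rewrite -!natrX ler_nat ltnW.
  rewrite ler_pdivlMr// -(@ler_pXn2r _ 5)// ?nnegrE; [|by sgn|by sgn].
  have P10 : 0 < P%:R ^+ 10 :> R by rewrite exprn_gt0.
  rewrite -(ler_pM2r P10).
  have -> : (S * t ^+ 10) ^+ 5 * P%:R ^+ 10 = (S * P%:R ^+ 2) ^+ 5 * t ^+ 50.
    by rewrite [(S * _ ^+ 10) ^+ 5]exprMn [(S * _ ^+ 2) ^+ 5]exprMn -[(t ^+ 10) ^+ 5]exprM -[(_ ^+ 2) ^+ 5]exprM mulrAC.
  apply: (@le_trans _ _ (2 ^+ 5 * P%:R ^+ 12 * P%:R)).
    apply: ler_pM => //; [by rewrite exprn_ge0// mulr_ge0// exprn_ge0|exact: exprn_ge0 (ltW tt0)|].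
    by apply: tP; exact: leq_trans q300.
  have -> : (8 * P%:R) ^+ 5 * P%:R ^+ 10 = 8 ^+ 5 * P%:R ^+ 15 :> R.
    by rewrite exprMn -[15%N]/(5 + 10)%N exprD mulrA.
  rewrite -mulrA -exprSr; apply: ler_pM; rewrite ?exprn_ge0//.
    by rewrite lerXn2r ?nnegrE//; lra.
  by apply: ler_weXn2l => //; rewrite ler1n.
pose th u : R := (N%:R + H%:R / 2) / (u ^ 2)%N%:R.
have MR : (T ^ 10)%N%:R = t ^+ 10 :> R by rewrite natrX.
have E0 : 0 <= P%:R / t ^+ 10 by rewrite divr_ge0// ltW.
have M0 : (0 < T ^ 10)%N by rewrite expn_gt0 T0.
have NR : 0 < N%:R :> R.
  rewrite ltr0n; case: (N) PN => // PN; move: PN; rewrite exp0n// leqn0 expn_eq0 => /andP[/eqP e _].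
  by rewrite e in P0.
have pi2 := pi_ge2 R.
have pi4 : pi <= 4 :> R by have := pihalf_lt2 R; lra.
have := @detect_upper R (index_iota P.+1 (2 * P).+1) (fun=> 1) th (P%:R / t ^+ 10) (T ^ 10) M0 (fun=> ler01) E0 _
  (fun u => (N %/ u ^ 2 < (N + H) %/ u ^ 2)%N) _.
case/(_ _ _)/Wrap => [k /andP[k0 kM]|u us Au|[Hd]].
- pose X : R := 2 * pi * k%:R * (N%:R + H%:R / 2).
  have kR : 1 <= k%:R :> R by rewrite ler1n.
  have kt : k%:R <= t ^+ 10 by rewrite -MR ler_nat.
  have HNR : H%:R <= N%:R :> R by rewrite ler_nat.
  have XN : N%:R <= X.
    rewrite /X -[leLHS]mul1r; apply: ler_pM => //; last by rewrite lerDl divr_ge0.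
    rewrite -[leLHS]mul1r; apply: ler_pM => //; lra.
  have X0 : 0 < X by apply: lt_le_trans XN.
  have Xup : X <= t ^+ 11 * N%:R.
    apply: (@le_trans _ _ (2 * 4 * t ^+ 10 * (2 * N%:R))).
      rewrite /X; apply: ler_pM.
      + by rewrite mulr_ge0// mulr_ge0// pi_ge0.
      + by rewrite addr_ge0// divr_ge0.
      + apply: ler_pM => //; first by rewrite mulr_ge0// pi_ge0.
        exact: ler_wpM2l.
      + by lra.
    have -> : 2 * 4 * t ^+ 10 * (2 * N%:R) = 2 ^+ 4 * t ^+ 10 * N%:R.
      by have -> : 2 ^+ 4 = 2 * 4 * 2 :> R by [rewrite !exprS expr0; ring]; ring.
    by apply: ler_wpM2r => //; rewrite exprS; apply: ler_wpM2r => //; exact: ltW.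
  have -> : \sum_(u <- index_iota P.+1 (2 * P).+1) 1 * cos (2 * pi * k%:R * th u) =
     \sum_(0 <= u < P) cos (X / (P.+1 + u)%:R ^+ 2).
    rewrite -{1}[P.+1]add0n big_addn.
    have -> : ((2 * P).+1 - P.+1 = P)%N by clear; lia.
    by apply: eq_bigr => u _; rewrite mul1r /th natrX /X addnC mulrA.
  have := W P.+1 X P.+1 P isT.
  case/(_ _ _ _ _ _)/Wrap => [|||||[W1]].
  + apply: (@le_trans _ _ ((2 * P%:R) ^+ 11)).
      rewrite lerXn2r ?nnegrE ?mulr_ge0// -(natrM _ 2) ler_nat mul2n -addnn -addn1 leq_add2l.
      exact: P0.
    rewrite exprMn; apply: (@le_trans _ _ (P%:R * P%:R ^+ 11)).
      apply: ler_wpM2r; first by rewrite exprn_ge0.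
      by apply: le_trans t11 _; rewrite -[leLHS]expr1; apply: tP; exact: leq_trans q300.
    rewrite -exprS; apply: (@le_trans _ _ (N%:R ^+ 5)); first by rewrite -!natrX ler_nat.
    by rewrite lerXn2r ?nnegrE// ltW.
  + exact: X0.
  + apply: le_trans Xup _; apply: (@le_trans _ _ (P%:R ^+ (K + 2))); last first.
      by rewrite lerXn2r ?nnegrE// ler_nat.
    rewrite exprD mulrC; apply: ler_pM => //; first by rewrite exprn_ge0// ltW.
      by rewrite /P -natrX ler_nat -expnM.
    apply: (@le_trans _ _ P%:R); first by apply: tP; exact: leq_trans q300.
    by rewrite ler_eXnr// ler1n.
  + by [].
  + by clear; lia.
  have tt5 : 0 < t ^+ 5 by rewrite exprn_gt0.
  have -> : P%:R / t ^+ 10 = P%:R / (t ^+ 5) ^+ 2 by rewrite -exprM.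
  apply: (saving_root D0 C0 (normr_ge0 _) (_ : 0 < P.+1%:R) PR0 tt5 W1 _ (_ : P%:R <= _)) => //.
  + by rewrite -natr1; have : 1 <= P%:R :> R; [rewrite ler1n|lra].
  + by rewrite -natr1; have : 0 <= P%:R :> R; [|lra].
  + rewrite -exprM; apply: (@le_trans _ _ (t ^+ (5 * (2 * D)).+1)).
      by rewrite exprS; apply: ler_wpM2r => //; rewrite exprn_ge0// ltW.
    by apply: tP; rewrite /q; move: fD; clear; lia.
- exists (((N + H) %/ u ^ 2)%N : int).
  have Pu : (P < u)%N by move: us; rewrite mem_index_iota => /andP[].
  have u20 : (0 < u ^ 2)%N by rewrite expn_gt0 (leq_ltn_trans _ Pu).
  apply: le_trans (near_of_multiple u20 Au) _.
  rewrite MR ler_pdivrMr ?mulr_gt0 ?ltr0n// mulrC ler_pdivlMr ?mulr_gt0//.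
  apply: (@le_trans _ _ (P%:R * (8 * t ^+ 10))).
    by apply: ler_wpM2r; rewrite ?mulr_ge0 ?ler_nat// ltW.
  apply: (@le_trans _ _ (P%:R * (2 * P%:R))).
    apply: ler_wpM2l => //.
    apply: (@le_trans _ _ (2 * (t * t ^+ 10))).
      have : 4 * t ^+ 10 <= t * t ^+ 10.
        apply: ler_wpM2r; first exact: ltW.
        by apply: le_trans t16; rewrite !exprS expr0; lra.
      by move: (t * t ^+ 10) (t ^+ 10) => a b; lra.
    by apply: ler_wpM2l => //; rewrite -exprS; apply: tP; exact: leq_trans q300.
  rewrite mulrCA; apply: ler_wpM2l => //; rewrite -natrM ler_nat -mulnn.
  by apply: leq_mul; exact: ltnW.
apply: le_trans Hd _.
have -> : \sum_(u <- index_iota P.+1 (2 * P).+1) 1 = P%:R :> R.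
  rewrite sumr_const_nat; congr (_%:R); clear; lia.
rewrite MR -mulrA -mulrDl.
rewrite -mulrA; apply: ler_wpM2r => //; lra.
Qed.
End KeyProp.

Section NearMultiples.
Variable R : realType.
Local Notation Lam := (vonMangoldt R).
Local Notation psi := (psi R).

Lemma ln_window_le (T q : nat) : (0 < T)%N ->
  1 + ln (2 * T ^ q)%N%:R <= (q + 2)%N%:R * T%:R :> R.
Proof.
move=> T0; have tR : 1 <= T%:R :> R by rewrite ler1n.
have t0 : 0 < T%:R :> R by apply: lt_le_trans tR.
rewrite natrM lnM ?posrE ?ltr0n ?expn_gt0 ?T0// natrX lnXn// mulr2n.
have /andP[_ l2] := ln2_bounds R.
have lt := ltW (ln_sublinear t0).
have : q%:R * ln T%:R <= q%:R * T%:R :> R by rewrite ler_wpM2l.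
rewrite -[ln _ *+ q]mulr_natl natrD mulrDl; move: (q%:R * ln _) (q%:R * T%:R : R) => a b h; lra.
Qed.

Lemma psi_window_ge (T q : nat) : (2 <= q)%N -> (16 * (q + 3) <= T)%N ->
  (T ^ q)%N%:R / 4 <= psi (2 * T ^ q) - psi (T ^ q).
Proof.
move=> q2 qT; have T0 : (0 < T)%N by apply: leq_trans qT; rewrite muln_gt0/= addnS.
have P0 : (0 < T ^ q)%N by rewrite expn_gt0 T0.
apply: le_trans (psi_dbl_ge R P0).
have /andP[l1 l2] := ln2_bounds R.
have lw := ln_window_le q T0.
have TP : T%:R ^+ 2 <= (T ^ q)%N%:R :> R by rewrite -natrX ler_nat leq_pexp2l.
have tR : 1 <= T%:R :> R by rewrite ler1n.
have h16 : 16 * ((q + 2)%N%:R * T%:R + T%:R) <= T%:R ^+ 2 :> R.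
  rewrite -[X in _ + X]mul1r -mulrDl -(natrD _ _ 1) addn1 mulrA -(natrM _ 16) expr2.
  by apply: ler_wpM2r => //; rewrite ler_nat -addnS.
have lS : ln (2 * T ^ q).+1%:R <= 1 + ln (2 * T ^ q)%N%:R :> R.
  apply: (@le_trans _ _ (ln (2 * (2 * T ^ q)%N%:R))).
    by rewrite ler_ln ?posrE ?mulr_gt0 ?ltr0n ?muln_gt0// -(natrM _ 2) ler_nat; clear -P0; lia.
  by rewrite lnM ?posrE ?ltr0n ?muln_gt0//; lra.
have PR : 0 < (T ^ q)%N%:R :> R by rewrite ltr0n.
have : (T ^ q)%N%:R / 3 <= 2 / 3 * (T ^ q)%N%:R * ln 2 :> R.
  rewrite -mulrA [leRHS]mulrC -!mulrA; apply: ler_wpM2l; first exact: ltW.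
  by lra.
move: ((T ^ q)%N%:R : R) PR TP lS lw h16 => P PR TP lS lw h16.
move: (ln _) lS => a lS; move: (ln _) lS lw => b lS lw.
by move: (2 / 3 * P * ln 2) => c; move: h16; move: (_ * T%:R : R) lw => d lw h16; lra.
Qed.

(* Fejer's kernel detects the primes having a multiple in the interval: the main
   term comes from psi, the other frequencies are killed by the exponential sum
   bound with saving T^20. *)
Lemma near_multiples_mass (K : nat) : (0 < K)%N -> exists f0 : nat, forall f, (f0 <= f)%N ->
  exists T0 : nat, forall T H N : nat, (T0 <= T)%N ->
    (H <= T ^ (300 * f).-1)%N -> (T ^ (300 * f).-1 <= 2 ^ (300 * f).-1 * H)%N ->
    (H ^ 9 < N ^ 5)%N -> (N <= T ^ (300 * f * K))%N ->
  (T ^ (300 * f))%N%:R / (16 * T%:R ^+ 6) <=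
  \sum_((T ^ (300 * f)).+1 <= u < (2 * T ^ (300 * f)).+1 | (N %/ u < (N + H) %/ u)%N) Lam u.
Proof.
move=> K0; have [|D [C [D0 C0] W]] := @prime_expsum R (3 * K + 1); first by rewrite addn1.
exists D.+1 => f fD; have f0 : (0 < f)%N by apply: leq_trans fD.
set q := (300 * f)%N.
(* Each summand bounds one constant of the proof, so that T beyond B dominates all of them. *)
pose B : R := 2 * C * 3 ^+ D + 10 ^+ 6 * 2 ^+ (9 * q) + 2 ^+ (2 * q + 2) +
  144 * (q + 2)%N%:R ^+ 3 + (16 * (q + 3))%N%:R.
exists (Num.truncn B).+1 => T H N TT0 HT TH HN NK.
set P := (T ^ q)%N.
pose t : R := T%:R.
have Bt : B <= t.
  by apply/ltW/(lt_le_trans (truncnS_gt _)); rewrite /t ler_nat.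
clear TT0; have T15 : 2 * C * 3 ^+ D <= t /\ 10 ^+ 6 * 2 ^+ (9 * q) <= t /\ 2 ^+ (2 * q + 2) <= t /\ 144 * (q + 2)%N%:R ^+ 3 <= t /\ (16 * (q + 3) <= T)%N.
  rewrite -(ler_nat R) -/t; move: Bt; rewrite /B.
  have : 0 <= 2 * C * 3 ^+ D by rewrite !mulr_ge0 ?exprn_ge0// ltW.
  have : 0 <= 10 ^+ 6 * 2 ^+ (9 * q) :> R by rewrite mulr_ge0 ?exprn_ge0.
  have : 0 <= 2 ^+ (2 * q + 2) :> R by rewrite exprn_ge0.
  have : 0 <= 144 * (q + 2)%N%:R ^+ 3 :> R by rewrite mulr_ge0 ?exprn_ge0.
  have : 0 <= (16 * (q + 3))%N%:R :> R by [].
  move: (_ * 3 ^+ D) (_ * 2 ^+ _) (2 ^+ _) (144 * _) ((16 * _)%N%:R : R) => a1 a2 a3 a4 a5.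
  by move=> h5 h4 h3 h2 h1 h; do 4?split; lra.
have {T15} [T1 [T2 [T3 [T4 T5]]]] := T15.
have T48 : (48 <= T)%N by apply: leq_trans T5; clear; lia.
have T0 : (0 < T)%N by clear -T48; lia.
have P0 : (0 < P)%N by rewrite expn_gt0 T0.
have PR0 : 0 < P%:R :> R by rewrite ltr0n.
have t48 : 48 <= t by rewrite /t ler_nat.
have t1 : 1 <= t by rewrite /t ler1n.
have t0 : 0 < t by apply: lt_le_trans t1.
have q300 : (300 <= q)%N by rewrite /q leq_pmulr.
have Pt : P%:R = t ^+ q :> R by rewrite natrX.
have Psuc : P = (T ^ q.-1 * T)%N by rewrite /P -expnSr prednK// (leq_trans _ q300).
have H0 : (0 < H)%N.
  by move: TH; case: (H) => // /[!muln0]; rewrite leqn0 expn_eq0 => /andP[/eqP e _]; rewrite e in T0.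
have HP : (H * T <= P)%N by rewrite Psuc leq_mul2r HT orbT.
have PH : (P <= 2 ^ q.-1 * H * T)%N by rewrite Psuc leq_mul2r TH orbT.
have HlN : (H <= N)%N.
  rewrite leqNgt; apply/negP => NH.
  have : (N ^ 5 <= H ^ 9)%N.
    by apply: (@leq_trans (H ^ 5)); [rewrite leq_exp2r// ltnW|rewrite leq_pexp2l].
  by rewrite leqNgt HN.
(* The cube root of P, the level of Vaughan's identity; the exponent 300 f is divisible by 3 for
   this. *)
pose z := (T ^ (100 * f))%N.
have zP : (z ^ 3 = P)%N by rewrite /z /P -expnM /q; congr (T ^ _)%N; clear; lia.
have zR : z%:R = t ^+ (100 * f) :> R by rewrite natrX.
pose A u := (N %/ u < (N + H) %/ u)%N.
pose th u : R := (N%:R + H%:R / 2) / u%:R.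
pose L : R := 1 + ln (2 * P)%N%:R.
have Lq : L <= (q + 2)%N%:R * t by exact: ln_window_le.
have L0 : 0 <= L by rewrite addr_ge0// ln_ge0// ler1n muln_gt0.
(* M = T^3 frequencies are used: 1 - c >= 2 d^2 with d at least 1 / (2^(q+1) T), so 1 / M is below
   this gap and the main term is of order P / T^3, while the error 2 M E is only of order L^3 P /
   T^17. *)
pose E := 9 * L ^+ 3 * P%:R / t ^+ 20.
have tn n : 0 < t ^+ n by rewrite exprn_gt0.
have E0 : 0 <= E by rewrite /E; sgn.
have M0 : (0 < T ^ 3)%N by rewrite expn_gt0 T0.
have MR : (T ^ 3)%N%:R = t ^+ 3 :> R by rewrite natrX.
pose d : R := H%:R / (4 * P%:R).
have HR : 0 < H%:R :> R by rewrite ltr0n.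
have d0 : 0 < d by rewrite /d divr_gt0// mulr_gt0.
have HPR : H%:R * t <= P%:R by rewrite /t -natrM ler_nat.
have HPR1 : H%:R <= P%:R :> R by apply: le_trans HPR; rewrite ler_peMr// ltW.
have d4 : d <= 4^-1.
  by rewrite /d ler_pdivrMr ?mulr_gt0// mulKf.
pose c := cos (2 * pi * d).
have pi2 := pi_ge2 R.
have pi4 : pi <= 4 :> R by have := pihalf_lt2 R; lra.
have c01 : 0 <= c <= 1.
  rewrite cos_le1 andbT; apply: cos_ge0_pihalf; apply/andP; split.
    apply: (@le_trans _ _ 0); first by rewrite oppr_le0; lra.
    by rewrite mulr_ge0 ?(ltW d0)//; lra.
  have : 2 * pi * d <= 2 * pi * 4^-1 :> R by apply: ler_wpM2l => //; lra.
  by move=> h; apply: le_trans h _; lra.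
have /(one_sub_cos_ge) : 0 <= d <= 4^-1 by rewrite d4 (ltW d0).
rewrite -/c => c2.
have := @detect_lower R (index_iota P.+1 (2 * P).+1) Lam th E (T ^ 3) M0 (vonMangoldt_ge0 R) E0 _ A c c01 _.
case/(_ _ _)/Wrap => [k /andP[k0 kM]|u us nAu|[Hd]].
- pose X : R := 2 * pi * k%:R * (N%:R + H%:R / 2).
  have NR : 0 < N%:R :> R by rewrite ltr0n (leq_trans H0).
  have kR : 1 <= k%:R :> R by rewrite ler1n.
  have kt : k%:R <= t ^+ 3 by rewrite -MR ler_nat.
  have HNR : H%:R <= N%:R :> R by rewrite ler_nat.
  have XN : N%:R <= X.
    rewrite /X -[leLHS]mul1r; apply: ler_pM => //; last by rewrite lerDl divr_ge0.
    rewrite -[leLHS]mul1r; apply: ler_pM => //; lra.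
  have X0 : 0 < X by apply: lt_le_trans XN.
  have Xup : X <= t ^+ 4 * N%:R.
    apply: (@le_trans _ _ (2 * 4 * t ^+ 3 * (2 * N%:R))).
      rewrite /X; apply: ler_pM.
      + by rewrite mulr_ge0// mulr_ge0// pi_ge0.
      + by rewrite addr_ge0// divr_ge0.
      + apply: ler_pM => //; first by rewrite mulr_ge0// pi_ge0.
        exact: ler_wpM2l.
      + by lra.
    have -> : 2 * 4 * t ^+ 3 * (2 * N%:R) = 16 * (t ^+ 3 * N%:R) by ring.
    rewrite [t ^+ 4]exprS -mulrA; apply: ler_wpM2r; first by rewrite mulr_ge0// ltW.
    by lra.
  have -> : \sum_(u <- index_iota P.+1 (2 * P).+1) Lam u * cos (2 * pi * k%:R * th u) =
     \sum_((z ^ 3).+1 <= u < (2 * z ^ 3).+1) Lam u * cos (X / u%:R).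
    by rewrite zP; apply: eq_bigr => u _; rewrite /th /X mulrA.
  have := W z (t ^+ 20) X.
  case/(_ _ _ _ _ _ _ _)/Wrap => [|||||||[W1]].
  + apply: (@leq_trans (T ^ 1)); first by rewrite expn1; clear -T48; lia.
    by rewrite leq_pexp2l// muln_gt0.
  + by rewrite exprn_ege1.
  + by rewrite zR -exprM; apply: ler_weXn2l => //; clear -f0; lia.
  + rewrite zR -exprM; apply: (@le_trans _ _ (t ^+ (20 * (2 * D)).+1)).
      by rewrite [t ^+ _.+1]exprS; apply: ler_wpM2r => //; exact: ltW.
    by apply: ler_weXn2l => //; clear -fD; lia.
  (* As P <= 2^q H T, up to a constant H^9 is at least P^9 / T^9 = T^(2700 f - 9), to be compared
     with z^26 = T^(2600 f): this is the gap between 9/5 and 26/15. *)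
  + apply: (@le_trans _ _ (N%:R ^+ 5)); last by rewrite lerXn2r ?nnegrE// ltW.
    apply: (@le_trans _ _ (H%:R ^+ 9)); last by rewrite -!natrX ler_nat ltnW.
    have PH9 : t ^+ (9 * q) <= 2 ^+ (9 * q) * H%:R ^+ 9 * t ^+ 9.
      have : P%:R <= 2 ^+ q * H%:R * t.
        apply: (@le_trans _ _ (2 ^+ q.-1 * H%:R * t)).
          by rewrite /t -natrX -!natrM ler_nat.
        apply: ler_wpM2r; first exact: ltW.
        apply: ler_wpM2r => //; apply: ler_weXn2l; first by lra.
        exact: leq_pred.
      rewrite mulnC exprM -Pt => hP.
      apply: (@le_trans _ _ ((2 ^+ q * H%:R * t) ^+ 9)).
        by rewrite lerXn2r ?nnegrE ?mulr_ge0 ?exprn_ge0// ltW.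
      by rewrite exprMn [(2 ^+ q * _) ^+ 9]exprMn -exprM.
    rewrite zR -exprM -(ler_pM2r (tn 9)) -(ler_pM2r (_ : 0 < 2 ^+ (9 * q))) ?exprn_gt0//.
    apply: le_trans (_ : t ^+ (9 * q) <= _); last first.
      by apply: le_trans PH9 _; rewrite le_eqVlt; apply/orP; left; apply/eqP; ring.
    have -> : 10 ^+ 6 * t ^+ (100 * f * 26) * t ^+ 9 * 2 ^+ (9 * q) =
       10 ^+ 6 * 2 ^+ (9 * q) * t ^+ (100 * f * 26 + 9) by rewrite exprD; ring.
    apply: (@le_trans _ _ (t ^+ (100 * f * 26 + 9).+1)).
      by rewrite [t ^+ _.+1]exprS; apply: ler_wpM2r => //; exact: ltW.
    by apply: ler_weXn2l => //; rewrite /q; clear -f0; lia.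
  + exact: X0.
  + apply: le_trans Xup _; rewrite zR -exprM.
    apply: (@le_trans _ _ (t ^+ 4 * t ^+ (q * K))).
      by apply: ler_wpM2l; [exact: ltW|rewrite /t -natrX ler_nat].
    by rewrite -exprD; apply: ler_weXn2l => //; rewrite /q; clear -f0; nia.
  by rewrite /E /L -zP.
- rewrite leNgt; apply/negP => cu.
  have d2 : 0 < d <= 2^-1 by rewrite d0/=; lra.
  have [m hm] := near_int_of_cos d2 cu.
  move: nAu; rewrite /A (multiple_of_near _ hm)//.
  by move: us; rewrite mem_index_iota ltnS.
rewrite -psi_diff in Hd; last by rewrite leq_pmull.
have PsiP : P%:R / 4 <= psi (2 * P) - psi P.
  by apply: psi_window_ge => //; exact: leq_trans q300.
(* Since d^2 >= 1 / (2^(2q+2) T^2), one spare factor T absorbs the power of 2. *)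
have gap : (t ^+ 3)^-1 <= 1 - c - (t ^+ 3)^-1.
  have : 2 * (t ^+ 3)^-1 <= 2 * d ^+ 2; last by lra.
  apply: ler_wpM2l => //.
  have dt : (2 ^+ (q + 1) * t)^-1 <= d.
    rewrite /d ler_pdivlMr ?mulr_gt0// mulrC ler_pdivrMr ?mulr_gt0 ?exprn_gt0//.
    have -> : H%:R * (2 ^+ (q + 1) * t) = 4 * (2 ^+ q.-1 * H%:R * t).
      have -> : (q + 1 = q.-1.+2)%N by rewrite addn1 prednK// (leq_trans _ q300).
      by rewrite !exprS; ring.
    by apply: ler_wpM2l => //; rewrite /t -natrX -!natrM ler_nat.
  apply: (@le_trans _ _ ((2 ^+ (q + 1) * t)^-1 ^+ 2)); last first.
    by rewrite lerXn2r ?nnegrE ?(ltW d0)// invr_ge0 mulr_ge0 ?exprn_ge0// ltW.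
  rewrite exprVn lef_pV2 ?posrE ?exprn_gt0 ?mulr_gt0 ?exprn_gt0//.
  rewrite exprMn -exprM mulnDl mul1n [(q * 2)%N]mulnC [t ^+ 3]exprS; apply: ler_wpM2r => //.
  exact: ltW.
rewrite MR in Hd.
have main : P%:R / 4 * (t ^+ 3)^-1 <= (psi (2 * P) - psi P) * (1 - c - (t ^+ 3)^-1).
  by apply: ler_pM => //; rewrite invr_ge0; exact: ltW.
have err : 2 * t ^+ 3 * E <= P%:R / 8 * (t ^+ 3)^-1.
  rewrite /E; apply: (@le_trans _ _ (2 * t ^+ 3 * (9 * ((q + 2)%N%:R * t) ^+ 3 * P%:R / t ^+ 20))).
    apply: ler_wpM2l; first by rewrite mulr_ge0// ltW.
    apply: ler_wpM2r; first by rewrite invr_ge0 ltW.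
    apply: ler_wpM2r => //; apply: ler_wpM2l => //.
    by rewrite lerXn2r ?nnegrE// mulr_ge0// ltW.
  have -> : 2 * t ^+ 3 * (9 * ((q + 2)%N%:R * t) ^+ 3 * P%:R / t ^+ 20) =
     144 * (q + 2)%N%:R ^+ 3 * (P%:R / 8 * t ^+ 6 / t ^+ 20).
    by rewrite exprMn; field; rewrite gt_eqF.
  have -> : P%:R / 8 * (t ^+ 3)^-1 = t ^+ 11 * (P%:R / 8 * t ^+ 6 / t ^+ 20).
    by field; rewrite gt_eqF.
  apply: ler_wpM2r; first by rewrite divr_ge0 ?mulr_ge0 ?divr_ge0// ltW.
  by apply: le_trans T4 _; rewrite ler_eXnr.
have fin : P%:R / 8 * (t ^+ 3)^-1 <= 2 * t ^+ 3 * \sum_(P.+1 <= u < (2 * P).+1 | A u) Lam u.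
  apply: le_trans Hd; move: main err.
  have -> : P%:R / 4 * (t ^+ 3)^-1 = P%:R / 8 * (t ^+ 3)^-1 + P%:R / 8 * (t ^+ 3)^-1 by field; rewrite gt_eqF.
  by move: (_ * E) (P%:R / 8 * _) ((psi (2 * P) - psi P) * _) => a b e; lra.
rewrite -/t -/A; move: fin; move: (\sum_(_ <= _ < _ | _) _) => S fin.
rewrite -(ler_pM2l (_ : 0 < 2 * t ^+ 3)) ?mulr_gt0//.
apply: le_trans fin; rewrite le_eqVlt; apply/orP; left; apply/eqP.
by field; rewrite gt_eqF.
Qed.
End NearMultiples.

Section SimplePrimeFactor.
Variable R : realType.
Local Notation Lam := (vonMangoldt R).

Lemma multiple_in_window (N H u : nat) : (0 < u)%N -> (N %/ u < (N + H) %/ u)%N ->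
  (N < (N + H) %/ u * u <= N + H)%N.
Proof. by move=> u0 h; rewrite -ltn_divLR// h leq_trunc_div. Qed.

Lemma window_of_multiple (N H u n : nat) : (0 < u)%N -> (N < n <= N + H)%N -> (u %| n)%N ->
  (N %/ u < (N + H) %/ u)%N.
Proof.
move=> u0 /andP[Nn nNH] /divnK en.
apply: (@leq_trans (n %/ u)); last exact: leq_div2r.
by rewrite ltn_divLR// en.
Qed.

(** A prime u counted on the left exceeds H, so the last hypothesis puts a multiple of u^2 in the
    window; its weight is at most ln (2P). The first term pays for the proper prime powers, with v =
    2 T^(3f), as 2P <= v^100. *)
Lemma prime_window_mass_le (P H N T f : nat) : (0 < T)%N -> (0 < f)%N ->
  P = (T ^ (300 * f))%N -> (H <= P)%N ->
  (forall p n, prime p -> (H < p)%N -> (N < n <= N + H)%N -> (p %| n)%N -> (p ^ 2 %| n)%N) ->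
  \sum_(P.+1 <= u < (2 * P).+1 | (N %/ u < (N + H) %/ u)%N) Lam u <=
    10 ^+ 5 * (2 * T%:R ^+ (3 * f)) ^+ 52 +
    ln (2 * P)%N%:R * \sum_(P.+1 <= u < (2 * P).+1 | (N %/ u ^ 2 < (N + H) %/ u ^ 2)%N) 1.
Proof.
move=> T0 f0 eP HP bad.
have P0 : (0 < P)%N by rewrite eP expn_gt0 T0.
have tR : 1 <= T%:R :> R by rewrite ler1n.
pose v : R := 2 * T%:R ^+ (3 * f).
have v1 : 1 <= v.
  by rewrite /v -[leLHS]mul1r; apply: ler_pM => //; [lra|rewrite exprn_ege1].
have pv : (2 * P)%N%:R <= v ^+ 100.
  rewrite /v exprMn -exprM natrM eP natrX; have -> : (3 * f * 100 = 300 * f)%N by clear; lia.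
  by apply: ler_wpM2r; [rewrite exprn_ge0|rewrite ler_eXnr//; lra].
have prop := @proper_sum_le R (2 * P) v (leq_trans P0 (leq_pmull P (isT : (0 < 2)%N))) v1 pv.
rewrite (bigID (fun u => prime u)) /= addrC; apply: lerD.
  apply: le_trans prop.
  rewrite [leRHS](@big_cat_nat _ _ _ P.+1)//=; last by rewrite ltnS leq_pmull.
  rewrite -[leLHS]add0r; apply: lerD; first by apply: sumr_ge0 => u _; exact: vonMangoldt_ge0.
  rewrite [leLHS]big_mkcond [leRHS]big_mkcond; apply: ler_sum => u _ /=.
  by case: (prime u) => /=; rewrite ?andbF// andbT; case: ifP => // _; exact: vonMangoldt_ge0.
rewrite mulr_sumr [leLHS]big_mkcond [leRHS]big_mkcond big_nat_cond [leRHS]big_nat_cond.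
apply: ler_sum => u; rewrite andbT => /andP[Pu]; rewrite ltnS => uP.
have u0 : (0 < u)%N by apply: leq_ltn_trans Pu.
have l0 : 0 <= ln (2 * P)%N%:R :> R by rewrite ln_ge0// ler1n muln_gt0.
rewrite mulr1; case: ifP => [/andP[Au pu]|_]; last by case: ifP.
have Iu := multiple_in_window u0 Au.
have uu := bad _ _ pu (leq_ltn_trans HP Pu) Iu (dvdn_mull _ (dvdnn u)).
rewrite (window_of_multiple _ Iu uu) ?expn_gt0 ?u0//.
rewrite -(expn1 u) vonMangoldt_pfactor// ler_ln ?posrE ?ltr0n ?muln_gt0//.
by rewrite ler_nat.
Qed.

(** If no such p existed, the mass P / (16 T^6) from [near_multiples_mass] would be bounded by two
    error terms, each at most a quarter of it. *)
Lemma simple_prime_factor (K : nat) : (0 < K)%N -> exists H0 : nat, forall H N : nat,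
  (H0 <= H)%N -> (H ^ 9 < N ^ 5)%N -> (N <= H ^ K)%N ->
  exists p n : nat, [/\ prime p, (H < p)%N, (N < n <= N + H)%N, (p %| n)%N & ~~ (p ^ 2 %| n)%N].
Proof.
move=> K0; have [f1 F1] := near_multiples_mass R K0; have [f2 F2] := square_multiples_weyl R K0.
pose f := (f1 + f2).+1.
have [|Ta W1] := F1 f; first by rewrite /f -addnS leq_addr.
have [|Tb W2] := F2 f; first by rewrite /f -addSn leq_addl.
have f0 : (0 < f)%N by [].
set q := (300 * f)%N in W1 W2.
have q300 : (300 <= q)%N by rewrite /q leq_pmulr.
pose B : R := 512 * (q + 2)%N%:R + 2 ^+ 6 * 10 ^+ 5 * 2 ^+ 52.
pose T1 := (Ta + Tb + (Num.truncn B).+1)%N.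
exists (T1 ^ q.-1)%N => H N HH HN NK.
have T1g : (0 < T1)%N by rewrite /T1 addnS.
have H0 : (0 < H)%N by apply: leq_trans HH; rewrite expn_gt0 T1g.
have q0 : (0 < q.-1)%N by clear -q300; lia.
(* T is one more than the integer root Q of H of order q - 1, so that H < T^(q-1) <= 2^(q-1) H. *)
have [||Q Q0 /andP[QH HQ]] := @nat_root R q.-1 H%:R.
- exact: q0.
- by rewrite ler1n.
move: QH HQ; rewrite -!natrX ler_nat ltr_nat => QH HQ.
pose T := Q.+1; pose t : R := T%:R.
have TT1 : (T1 <= T)%N.
  rewrite leqNgt; apply/negP => TT1; have := leq_ltn_trans HH HQ.
  by rewrite ltnNge => /negP; apply; rewrite leq_exp2r// ltnW.
have TH : (T ^ q.-1 <= 2 ^ q.-1 * H)%N.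
  apply: (@leq_trans ((2 * Q) ^ q.-1)).
    have : (T <= 2 * Q)%N by rewrite /T mul2n -addnn -addn1 leq_add2l.
    by rewrite leq_exp2r.
  by rewrite expnMn leq_mul2l QH orbT.
have T0 : (0 < T)%N by [].
have HT : (H <= T ^ q.-1)%N by exact: ltnW.
have HP : (H <= T ^ q)%N by apply: leq_trans HT _; rewrite leq_pexp2l// leq_pred.
have HlN : (H <= N)%N.
  rewrite leqNgt; apply/negP => NH.
  have : (N ^ 5 <= H ^ 9)%N.
    by apply: (@leq_trans (H ^ 5)); [rewrite leq_exp2r// ltnW|rewrite leq_pexp2l].
  by rewrite leqNgt HN.
have NT : (N <= T ^ (q * K))%N by rewrite expnM (leq_trans NK)// leq_exp2r.
apply/not_existsP => no.
have bad p n : prime p -> (H < p)%N -> (N < n <= N + H)%N -> (p %| n)%N -> (p ^ 2 %| n)%N.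
  move=> pp Hp In pn; apply/negP => /negP np2; apply: (no p); exists n; split => //.
have Tab : (Ta <= T)%N /\ (Tb <= T)%N.
  by split; apply: leq_trans TT1; rewrite /T1; clear; lia.
have low := W1 T H N Tab.1 HT TH HN NT.
have sq := W2 T H N Tab.2 HP HlN NT.
have up := prime_window_mass_le T0 f0 erefl HP bad.
have Bt : B <= t.
  apply/ltW/(lt_le_trans (truncnS_gt _)); rewrite /t ler_nat; apply: leq_trans TT1.
  by rewrite /T1 leq_addl.
have [t1 t2] : 512 * (q + 2)%N%:R <= t /\ 2 ^+ 6 * 10 ^+ 5 * 2 ^+ 52 <= t.
  move: Bt; rewrite /B; have : 0 <= 512 * (q + 2)%N%:R :> R by rewrite mulr_ge0 ?ler0n.
  have : 0 <= 2 ^+ 6 * 10 ^+ 5 * 2 ^+ 52 :> R by rewrite !mulr_ge0 ?exprn_ge0.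
  by move: (_ * 2 ^+ 52) (512 * _) => a b; split; lra.
have tge1 : 1 <= t by rewrite /t ler1n.
have tt0 : 0 < t by apply: lt_le_trans tge1.
have lnq : ln (2 * T ^ q)%N%:R <= (q + 2)%N%:R * t :> R.
  by have := ln_window_le R q T0; rewrite -/t; lra.
move: low sq up; rewrite -/q -/t natrX -/t.
move: (\sum_(_ <= _ < _ | _) Lam _) => S.
move: (\sum_(_ <= _ < _ | _) 1) => S2 low sq up.
have e1 : 10 ^+ 5 * (2 * t ^+ (3 * f)) ^+ 52 <= t ^+ q / (64 * t ^+ 6).
  rewrite exprMn -exprM ler_pdivlMr ?mulr_gt0 ?exprn_gt0//.
  have -> : 10 ^+ 5 * (2 ^+ 52 * t ^+ (3 * f * 52)) * (64 * t ^+ 6) =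
     2 ^+ 6 * 10 ^+ 5 * 2 ^+ 52 * t ^+ (3 * f * 52 + 6).
    by rewrite exprD; have -> : 64 = 2 ^+ 6 :> R; [rewrite !exprS expr0; ring|ring].
  apply: (@le_trans _ _ (t ^+ (3 * f * 52 + 6).+1)).
    by rewrite [t ^+ _.+1]exprS; apply: ler_wpM2r => //; rewrite exprn_ge0// ltW.
  by apply: ler_weXn2l => //; rewrite /q; clear; lia.
have tn n : 0 < t ^+ n by rewrite exprn_gt0.
have e2 : ln (2 * T ^ q)%N%:R * S2 <= t ^+ q / (64 * t ^+ 6).
  apply: (@le_trans _ _ ((q + 2)%N%:R * t * (8 * t ^+ q / t ^+ 10))).
    apply: (@le_trans _ _ (ln (2 * T ^ q)%N%:R * (8 * t ^+ q / t ^+ 10))).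
      by apply: ler_wpM2l => //; rewrite ln_ge0// ler1n muln_gt0 expn_gt0.
    by apply: ler_wpM2r => //; rewrite divr_ge0 ?mulr_ge0// ltW.
  have -> : (q + 2)%N%:R * t * (8 * t ^+ q / t ^+ 10) =
     512 * (q + 2)%N%:R * (t ^+ q / (64 * t ^+ 9)) by field; rewrite gt_eqF.
  have -> : t ^+ q / (64 * t ^+ 6) = t ^+ 3 * (t ^+ q / (64 * t ^+ 9)).
    by field; rewrite gt_eqF.
  apply: ler_wpM2r; first by rewrite divr_ge0 ?mulr_ge0// ltW.
  by apply: le_trans t1 _; rewrite ler_eXnr.
have e0 : 0 < t ^+ q / (64 * t ^+ 6) by rewrite divr_gt0// mulr_gt0.
have e3 : t ^+ q / (16 * t ^+ 6) = 4 * (t ^+ q / (64 * t ^+ 6)) by field; rewrite gt_eqF.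
move: low up e1 e2 e0; rewrite e3; move: (t ^+ q / _) (ln _ * S2) (_ * _ ^+ 52) => a b c.
by move=> *; lra.
Qed.
End SimplePrimeFactor.

(** * Very bad intervals *)

(** The other factors of the product are prime to p, so both factors p of the powerful product come
    from n. *)
Lemma very_bad_square_dvd (N H n p : nat) : very_bad N H -> prime p ->
  (N < n <= N + H)%N -> (p %| n)%N ->
  (forall m, (N < m <= N + H)%N -> (p %| m)%N -> m = n) -> (p ^ 2 %| n)%N.
Proof.
move=> vb pp /andP[Nn nNH] pn uniq_n.
have nI : n \in index_iota N.+1 (N + H).+1 by rewrite mem_index_iota Nn ltnS.
have pprod : (p %| \prod_(N.+1 <= m < (N + H).+1) m)%N.
  by rewrite (bigD1_seq n nI (iota_uniq _ _))/= dvdn_mulr.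
have := vb p pp pprod; rewrite (bigD1_seq n nI (iota_uniq _ _))/= Gauss_dvdl//.
rewrite coprimeXl// prime_coprime//.
apply/negP; rewrite Euclid_dvd_prod// big_has_cond => /hasP[m].
rewrite mem_index_iota ltnS => mI /andP[mn pm].
by rewrite (uniq_n m mI pm) eqxx in mn.
Qed.

Lemma very_bad_large_prime (N H n p : nat) : very_bad N H -> prime p -> (H < p)%N ->
  (N < n <= N + H)%N -> (p %| n)%N -> (p ^ 2 %| n)%N.
Proof.
move=> vb pp Hp In pn; apply: (very_bad_square_dvd vb pp In pn) => m Im pm.
wlog mn : m n In Im pn pm / (m <= n)%N => [W|].
  by have [/W|/ltnW /W] := leqP m n; [apply|move=> W'; apply/esym/W'].
apply/eqP; rewrite eqn_leq mn leqNgt; apply/negP => ltmn.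
have : (p <= n - m)%N by apply: dvdn_leq; [rewrite subn_gt0|rewrite dvdn_sub].
by clear -In Im Hp ltmn; lia.
Qed.

(** The mass psi (2k) - psi k is of order k; without primes in between it would consist of proper
    prime powers only, of order v^52 with 2k = v^100. *)
Lemma bertrand (R : realType) : exists k0 : nat, forall k, (k0 <= k)%N ->
  exists2 p, prime p & (k < p <= 2 * k)%N.
Proof.
have [n0 W] := @large_root R 100 (7 * 10 ^+ 5) isT.
exists n0.+1 => k kn0; have k0 : (0 < k)%N by apply: leq_trans kn0.
have [|v [vM v1 vk]] := W (2 * k)%N; first by clear -kn0; lia.
apply/not_exists2P => no.
have nop u : (k < u <= 2 * k)%N -> ~~ prime u.
  by move=> uk; apply/negP => pu; case: (no u).
have prop := @proper_sum_le R (2 * k) v _ v1.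
case/(_ _ _)/Wrap: prop => [||[prop]]; first by rewrite muln_gt0.
  by rewrite vk.
have := psi_dbl_ge R k0; rewrite psi_diff ?leq_pmull//.
have : \sum_(k.+1 <= u < (2 * k).+1) vonMangoldt R u <= 10 ^+ 5 * v ^+ 52.
  apply: le_trans prop; rewrite [leRHS](@big_cat_nat _ _ _ k.+1)//=; last by rewrite ltnS leq_pmull.
  rewrite -[leLHS]add0r; apply: lerD; first by apply: sumr_ge0 => u _; exact: vonMangoldt_ge0.
  rewrite [leRHS]big_mkcond /= [leLHS]big_nat_cond [leRHS]big_nat_cond.
  by apply: ler_sum => u; rewrite andbT ltnS => /nop ->.
move: (\sum_(_ <= _ < _) _) => S up low.
have v0 : 0 < v by apply: lt_le_trans v1.
have kv : k%:R = v ^+ 100 / 2 :> R by rewrite vk natrM mulrC mulKf.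
have /andP[l1 l2] := ln2_bounds R.
have lnv : ln (2 * k).+1%:R <= 1 + 100 * v.
  apply: (@le_trans _ _ (ln (2 * (2 * k)%N%:R))).
    by rewrite ler_ln ?posrE ?mulr_gt0 ?ltr0n ?muln_gt0// -(natrM _ 2) ler_nat; clear -k0; lia.
  rewrite -vk lnM ?posrE ?exprn_gt0// lnXn// -[ln v *+ _]mulr_natl.
  by have := ln_sublinear v0; move: (ln v) => a ha; lra.
have low2 : v ^+ 100 / 6 <= 2 / 3 * k%:R * ln 2.
  have -> : v ^+ 100 / 6 = 2 / 3 * k%:R * 2^-1 by rewrite kv; field.
  by apply: ler_wpM2l.
have big : (7 * 10 ^+ 5) * v ^+ 52 <= v ^+ 100.
  apply: (@le_trans _ _ (v ^+ 53)); last by apply: ler_weXn2l.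
  by rewrite [v ^+ 53]exprS; apply: ler_wpM2r => //; rewrite exprn_ge0// ltW.
have v52 : 1 <= v ^+ 52 by rewrite exprn_ege1.
have vv : v <= v ^+ 52 by rewrite ler_eXnr.
have ten : 10 ^+ 5 * v ^+ 52 = 10 ^+ 4 * (10 * v ^+ 52) by rewrite [10 ^+ 5]exprSr mulrA.
have ten4 : 1000 <= 10 ^+ 4 :> R.
  by rewrite exprS -natrX -natrM ler_nat.
have : 1000 * (10 * v ^+ 52) <= 10 ^+ 4 * (10 * v ^+ 52).
  by apply: ler_wpM2r => //; rewrite mulr_ge0// exprn_ge0// ltW.
rewrite -ten; move: big; rewrite -mulrA; move: up low lnv low2 vv v52.
move: (10 ^+ 5 * v ^+ 52) (v ^+ 52) (v ^+ 100) (ln _%:R) (2 / 3 * _ * _) => a b c d e *.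
lra.
Qed.

Lemma very_bad_short (R : realType) (K : nat) : (0 < K)%N ->
  exists H0 : nat, forall H N : nat, (H0 <= H)%N -> very_bad N H -> (H ^ K < N)%N.
Proof.
move=> K0; have [k0 W1] := bertrand R; have [h2 W2] := sylvester R.
have [h3 W3] := @simple_prime_factor R K K0.
exists (2 * k0 + h2 + h3 + 1)%N => H N HH vb.
rewrite ltnNge; apply/negP => NK.
have [NH|HN] := leqP N H.
  (* The interval contains a Bertrand prime p with 2p > N + H: it is its own only multiple there,
     and p^2 does not divide p. *)
  pose k := ((N + H) %/ 2)%N.
  have [|p pp /andP[kp pk]] := W1 k; first by rewrite /k leq_divRL//; clear -HH; lia.
  have Ip : (N < p <= N + H)%N by clear -NH kp pk; rewrite /k in kp pk; lia.
  have := very_bad_square_dvd vb pp Ip (dvdnn p).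
  case/(_ _)/Wrap => [m Im /dvdnP[j ej]|[]].
    case: j ej => [|[|j]] ej; [by move: Im; rewrite ej|by rewrite ej mul1n|].
    by exfalso; move: Im; rewrite ej !mulSn; clear -NH kp; rewrite /k in kp; lia.
  move=> /(dvdn_leq (prime_gt0 pp)); rewrite -mulnn leqNgt => /negP; apply.
  by rewrite ltn_Pmull// ?prime_gt1// prime_gt0.
have H0 : (0 < H)%N by clear -HH; lia.
(* In the first case N <= H^2, so p^2 >= (H + 1)^2 exceeds N + H. *)
have [N9|N9] := leqP (N ^ 5) (H ^ 9).
  have [|p [pp Hp [n In pn]]] := W2 H N _ (ltnW HN) N9; first by clear -HH; lia.
  have := very_bad_large_prime vb pp Hp In pn.
  have n0 : (0 < n)%N by case/andP: In; case: (n).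
  move=> /(dvdn_leq n0) pn2.
  have Hp2 : (H.+1 ^ 2 <= p ^ 2)%N by rewrite leq_exp2r.
  have NH2 : (N <= H ^ 2)%N.
    rewrite -(@leq_exp2r _ _ 5)// -expnM (leq_trans N9)// leq_pexp2l//.
  move: Hp2 NH2 pn2; rewrite -!mulnn mulSn mulnS; move: (H * H)%N (p * p)%N => a b.
  by clear -In; lia.
have [|p [n [pp Hp In pn /negP[]]]] := W3 H N _ N9 NK; first by clear -HH; lia.
exact: very_bad_large_prime vb pp Hp In pn.
Qed.

(** * Factorisations d s^3 r^2 and smooth radicals *)

Section PowerfulDecomposition.
Local Open Scope nat_scope.

Definition squarefree (s : nat) : Prop := forall p : nat, prime p -> ~~ (p ^ 2 %| s)%N.

Lemma squarefree_gt0 (s : nat) : squarefree s -> (0 < s)%N.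
Proof. by case: s => // /(_ 2%N isT); rewrite dvdn0. Qed.

Lemma squarefree_logn (s p : nat) : squarefree s -> (logn p s <= 1)%N.
Proof.
move=> sf; case pp : (prime p); last by rewrite lognE pp.
by rewrite leqNgt -pfactor_dvdn ?squarefree_gt0// sf.
Qed.

Lemma squarefreeW (s t : nat) : squarefree s -> (t %| s)%N -> squarefree t.
Proof. by move=> sf ts p pp; apply: contra (sf p pp) => /dvdn_trans; apply. Qed.

Lemma squarefree_dvd (s t : nat) : squarefree s ->
  (forall p, prime p -> (p %| s)%N -> (p %| t)%N) -> (s %| t)%N.
Proof.
move=> sf st; apply/dvdn_partP; first exact: squarefree_gt0.
move=> p; rewrite mem_primes => /and3P[pp s0 ps].
apply: dvdn_trans (_ : (p ^ 1 %| t)%N); last by rewrite expn1 st.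
by rewrite p_part dvdn_exp2l// squarefree_logn.
Qed.

Lemma squarefree_part (m : nat) : (0 < m)%N ->
  exists s t : nat, squarefree s /\ m = (s * t ^ 2)%N.
Proof.
move=> m0; have ex1 : exists t : nat, (t ^ 2 %| m)%N by exists 1%N.
have bd (t : nat) : (t ^ 2 %| m)%N -> (t <= m)%N.
  by move=> /(dvdn_leq m0); apply: leq_trans; rewrite -mulnn; case: t => // t; rewrite leq_pmulr.
case: (ex_maxnP ex1 bd) => t /dvdnP[s ms] tmax; exists s, t; split => // p pp.
apply/negP => /dvdnP[u us]; have : (p * t <= t)%N.
  by apply: tmax; rewrite ms us expnMn -mulnA dvdn_mull.
case: t ms {tmax} => [|t] ms; first by rewrite ms exp0n// muln0 in m0.
by apply/negP; rewrite -ltnNge ltn_Pmull// prime_gt1.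
Qed.

(** Write m = q t^2 with q squarefree, and let s be the part of q prime to pi. A prime of s divides
    m to an odd power that is at least 2, so it divides t; hence t = s r and m = d s t^2 = d s^3
    r^2. *)
Lemma cube_square_factor (pi : nat_pred) (m : nat) : (0 < m)%N ->
  (forall p, prime p -> p \notin pi -> (p %| m)%N -> (p ^ 2 %| m)%N) ->
  exists d s r : nat, [/\ squarefree (d * s)%N, pi.-nat d & m = (d * (s ^ 3 * r ^ 2))%N].
Proof.
move=> m0 hm; have [q [t [sq mt]]] := squarefree_part m0.
have q0 := squarefree_gt0 sq.
have t0 : (0 < t)%N by case: (t) mt m0 => // ->; rewrite exp0n// muln0.
have /dvdnP[r tr] : (q`_pi^' %| t)%N.
  apply: squarefree_dvd; first exact: squarefreeW (dvdn_part _ _).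
  move=> p pp pq.
  have pnpi : p \notin pi.
    by have := pnatPpi (part_pnat (negn pi) q) (_ : p \in _); apply; rewrite mem_primes pp part_gt0.
  have pq' : (p %| q)%N by apply: dvdn_trans pq (dvdn_part _ _).
  have : (p ^ 2 %| m)%N by apply: hm => //; rewrite mt dvdn_mulr.
  rewrite pfactor_dvdn// mt lognM ?expn_gt0 ?t0// lognX.
  have := squarefree_logn p sq; have -> : (p %| t)%N = (1 <= logn p t)%N by rewrite -pfactor_dvdn.
  by move: (logn p q) (logn p t) => a b; clear; lia.
exists q`_pi, q`_pi^', r; split; first by rewrite partnC.
  exact: part_pnat.
rewrite {1}mt {1}tr -{1}(partnC pi q0) expnMn.
by move: q`_pi q`_(negn pi) => a b; clear; lia.
Qed.

Lemma powerful_cube_square (m : nat) : (0 < m)%N -> powerful m ->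
  exists s r : nat, squarefree s /\ m = (s ^ 3 * r ^ 2)%N.
Proof.
move=> m0 pm; have [|d [s [r [sds dn ->]]]] := @cube_square_factor pred0 m m0.
  by move=> p pp _; exact: pm.
have d0 : 0 < d by have := squarefree_gt0 sds; rewrite muln_gt0 => /andP[].
have d1 : d = 1%N.
  apply/eqP; rewrite eqn_leq d0 andbT leqNgt; apply/negP => d1.
  by move/pnatP: dn => /(_ d0 _ (pdiv_prime d1) (pdiv_dvd d)).
by exists s, r; rewrite d1 !mul1n in sds *.
Qed.

Lemma cube_square_powerful (s r : nat) : powerful (s ^ 3 * r ^ 2).
Proof.
move=> p pp; rewrite Euclid_dvdM// !Euclid_dvdX// !andbT => /orP[ps|pr].
  by apply: dvdn_mulr; rewrite (expnSr s 2) dvdn_mulr// dvdn_exp2r.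
by apply: dvdn_mull; rewrite dvdn_exp2r.
Qed.

(** The valuation of s^3 r^2 at p is odd exactly when p divides s, so the product determines s. *)
Lemma cube_square_inj (s r s' r' : nat) : squarefree s -> squarefree s' ->
  (0 < r)%N -> (0 < r')%N -> (s ^ 3 * r ^ 2 = s' ^ 3 * r' ^ 2)%N -> s = s' /\ r = r'.
Proof.
move=> sf sf' r0 r0' e.
have s0 := squarefree_gt0 sf; have s0' := squarefree_gt0 sf'.
have ss : s = s'.
  apply: eqn_from_log => // p; have := congr1 (logn p) e.
  have lE a b : 0 < a -> 0 < b -> logn p (a ^ 3 * b ^ 2) = 3 * logn p a + 2 * logn p b.
    by move=> a0 b0; rewrite lognM ?expn_gt0 ?a0 ?b0// !lognX.
  rewrite !lE//.
  have := squarefree_logn p sf; have := squarefree_logn p sf'.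
  by move: (logn p s) (logn p s') (logn p r) (logn p r'); clear; lia.
split=> //; move/eqP: e; rewrite ss eqn_pmul2l ?expn_gt0 ?s0'// eqn_exp2r//.
by move/eqP.
Qed.

(** The radical of the H-smooth part of m; it bounds the factor d, made of primes up to H. *)
Definition srad (H m : nat) : nat := \prod_(0 <= p < H.+1 | prime p && (p %| m)) p.

Lemma prod_primes_dvd (r : seq nat) (P : pred nat) (m : nat) : uniq r ->
  (forall p, P p -> prime p /\ p %| m) -> \prod_(p <- r | P p) p %| m.
Proof.
move=> ur hP; elim: r ur => [|q r IH] /=; first by rewrite big_nil dvd1n.
move=> /andP[qr ur]; rewrite big_cons; case: ifP => Pq; last exact: IH.
have [pq qm] := hP _ Pq; rewrite Gauss_dvd ?qm ?IH//.
rewrite prime_coprime// Euclid_dvd_prod// big_has_cond; apply/negP => /hasP[p pr /andP[Pp]].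
have [pp _] := hP _ Pp; rewrite dvdn_prime2// => /eqP qp.
by rewrite qp pr in qr.
Qed.

Lemma srad_le (H m : nat) : 0 < m -> srad H m <= m.
Proof.
move=> m0; apply: dvdn_leq => //; apply: prod_primes_dvd; first exact: iota_uniq.
by move=> p /andP[].
Qed.

Lemma prod_multiples (N H p : nat) : 0 < p ->
  \prod_(N.+1 <= m < (N + H).+1 | p %| m) p = p ^ ((N + H) %/ p - N %/ p).
Proof.
move=> p0; elim: H => [|H IH]; first by rewrite addn0 subnn expn0 big_geq.
rewrite big_mkcond addnS big_nat_recr ?ltnS ?leq_addr//= -big_mkcond IH divnS//.
case: (p %| _); last by rewrite muln1.
by rewrite add1n subSn ?leq_div2r ?leq_addr// expnSr.
Qed.

Lemma prod_srad (N H : nat) :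
  \prod_(N.+1 <= m < (N + H).+1) srad H m =
  \prod_(0 <= p < H.+1 | prime p) p ^ ((N + H) %/ p - N %/ p).
Proof.
rewrite /srad (exchange_big_dep (fun p => prime p))/=; last by move=> m p _ /andP[].
apply: eq_bigr => p pp; rewrite -prod_multiples ?prime_gt0//.
by apply: eq_bigl => m; rewrite pp.
Qed.

(* Both products are products over p <= H of powers of p, and an interval of length H
   contains at most H/p + 1 <= 2 (H/p) multiples of p. *)
Lemma prod_srad_le (N H : nat) :
  \prod_(N.+1 <= m < (N + H).+1) srad H m <= H ^ (2 * H).
Proof.
apply: (@leq_trans ((\prod_(1 <= m < H.+1) srad H m) ^ 2)).
  have := prod_srad 0 H; rewrite add0n => ->; rewrite prod_srad -mulnn -big_split/=.
  rewrite [leqLHS]big_nat_cond [leqRHS]big_nat_cond.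
  apply: leq_prod => p /andP[/andP[_ pH] pp]; rewrite -expnD.
  rewrite leq_pexp2l ?prime_gt0// div0n subn0 divnD ?prime_gt0//.
  have : 0 < H %/ p by rewrite divn_gt0 ?prime_gt0.
  have := leq_b1 (p <= N %% p + H %% p); move: (nat_of_bool _) (N %/ p) (H %/ p) => c a b.
  by rewrite -addnA addKn; clear; lia.
rewrite mulnC expnM leq_exp2r//.
apply: (@leq_trans (\prod_(1 <= m < H.+1) H)); last by rewrite prod_nat_const_nat subn1.
rewrite [leqLHS]big_nat_cond [leqRHS]big_nat_cond.
apply: leq_prod => m /andP[/andP[m0 mH] _].
exact: leq_trans (srad_le H m0) _.
Qed.
Lemma very_bad_factor (N H m : nat) : very_bad N H -> (N < m <= N + H)%N ->
  exists d s r : nat, [/\ (0 < d)%N, (0 < s)%N, (d <= srad H m)%N & m = (d * (s ^ 3 * r ^ 2))%N].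
Proof.
move=> vb Im; have m0 : (0 < m)%N by case/andP: Im; case: (m).
have [|d [s [r [sf dn me]]]] := @cube_square_factor [pred p | (p <= H)%N] m m0.
  by move=> p pp; rewrite inE -ltnNge => Hp pm; exact: very_bad_large_prime vb pp Hp Im pm.
have := squarefree_gt0 sf; rewrite muln_gt0 => /andP[d0 s0].
exists d, s, r; split=> //; apply: dvdn_leq.
  by rewrite /srad; apply: prodn_cond_gt0 => p /andP[/prime_gt0].
apply: squarefree_dvd; first exact: squarefreeW sf (dvdn_mulr _ _).
move=> p pp pd; have pH : (p <= H)%N by move/pnatP: dn => /(_ d0 p pp pd).
have pm : (p %| m)%N by rewrite me dvdn_mulr.
have pI : p \in index_iota 0 H.+1 by rewrite mem_index_iota ltnS.
by rewrite /srad big_mkcond (bigD1_seq p pI (iota_uniq _ _))/= pp pm dvdn_mulr.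
Qed.
End PowerfulDecomposition.

(** * Counting very bad numbers that are not powerful *)

Section Counting.
Local Open Scope nat_scope.

(** Otherwise all but one of the H elements would have [srad] above H^5, giving a product of at
    least H^(5 (H - 1)); this contradicts [prod_srad_le], because 5 (H - 1) > 2H from H = 2 on. *)
Lemma two_small_srad (N H : nat) : 2 <= H -> exists m m' : nat,
  [/\ N < m', m' < m, m <= N + H, srad H m <= H ^ 5 & srad H m' <= H ^ 5].
Proof.
move=> H2; apply: contrapT => no.
have [m0 [Im0 hm0]] : exists m0, N < m0 <= N + H /\
    forall m, N < m <= N + H -> m != m0 -> H ^ 5 < srad H m.
  have [[m0 [Im0 sm0]]|none] := pselect (exists m0, N < m0 <= N + H /\ srad H m0 <= H ^ 5).
    exists m0; split=> // m Im mm0; rewrite ltnNge; apply/negP => sm; apply: no.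
    by case/andP: Im => ? ?; case/andP: Im0 => ? ?; move: mm0; rewrite neq_ltn => /orP[] ?;
       [exists m0, m|exists m, m0].
  exists N.+1; split; first by rewrite ltnSn -addn1 leq_add2l; clear -H2; lia.
  move=> m Im _; rewrite ltnNge; apply/negP => sm; apply: none; by exists m.
have iI : m0 \in index_iota N.+1 (N + H).+1 by rewrite mem_index_iota ltnS.
have := prod_srad_le N H; rewrite (bigD1_seq m0 iI (iota_uniq _ _))/=.
have s0 : 0 < srad H m0 by apply: prodn_cond_gt0 => p /andP[/prime_gt0].
have := prod_nat_const_nat N.+1 (N + H).+1 (H ^ 5).
rewrite (bigD1_seq m0 iI (iota_uniq _ _))/= subSS addKn -expnM.
set K := \prod_(_ <- _ | _) _; set K' := \prod_(_ <- _ | _) _ => eK leK.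
have KK : K <= K'.
  rewrite /K /K' [leqLHS]big_seq_cond [leqRHS]big_seq_cond.
  apply: leq_prod => m /andP[]; rewrite mem_index_iota ltnS => Im mm0.
  exact: ltnW (hm0 _ Im mm0).
have : H ^ (5 * H) <= H ^ (2 * H + 5).
  rewrite -eK expnD mulnC leq_mul2r orbC (leq_trans KK)//.
  by apply: leq_trans leK; rewrite leq_pmull.
by rewrite leq_exp2l//; clear -H2; lia.
Qed.

Definition cnt (P : nat -> Prop) (X : nat) : nat := \sum_(1 <= n < X.+1) `[< P n >].

Lemma cnt_mono (P Q : nat -> Prop) (X : nat) :
  (forall n, 0 < n <= X -> P n -> Q n) -> cnt P X <= cnt Q X.
Proof.
move=> PQ; rewrite /cnt [leqLHS]big_nat_cond [leqRHS]big_nat_cond.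
apply: leq_sum => n; rewrite andbT ltnS => /PQ {}PQ.
by case: asboolP => // /PQ Qn; case: asboolP.
Qed.

Lemma cnt_or (P Q : nat -> Prop) (X : nat) :
  cnt (fun n => P n \/ Q n) X <= cnt P X + cnt Q X.
Proof.
rewrite /cnt -big_split/=; apply: leq_sum => n _.
by case: asboolP => //; case: asboolP => //; case: asboolP => // q p [].
Qed.

Lemma cnt_ex (k c : nat) (P : nat -> nat -> Prop) (X : nat) :
  (forall i, i < k -> cnt (P i) X <= c) ->
  cnt (fun n => exists i, i < k /\ P i n) X <= k * c.
Proof.
elim: k => [|k IH] hc.
  rewrite mul0n leqn0; apply/eqP; rewrite /cnt big1// => n _.
  by case: asboolP => // -[i []].
rewrite mulSn addnC; apply: leq_trans (leq_add (IH _) (hc k (ltnSn _))); last first.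
  by move=> i ik; apply: hc; exact: ltnW.
apply: leq_trans (cnt_or _ _ _); apply: cnt_mono => n _ [i []].
rewrite ltnS leq_eqVlt => /orP[/eqP ->|ik] Pi; first by right.
by left; exists i.
Qed.

Lemma cnt_le1 (P : nat -> Prop) (X : nat) : (forall a b, P a -> P b -> a = b) ->
  cnt P X <= 1.
Proof.
move=> inj; rewrite /cnt; have [[a [aX Pa]]|none] := pselect (exists a, 0 < a <= X /\ P a).
  rewrite (bigD1_seq a)/= ?mem_index_iota ?ltnS ?iota_uniq//.
  rewrite big1 ?addn0 ?leq_b1// => n na; case: asboolP => // /(inj _ _ Pa) e.
  by rewrite e eqxx in na.
rewrite big_nat_cond big1// => n; rewrite andbT ltnS => nX.
by case: asboolP => // Pn; case: none; exists n.
Qed.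

(** An injection in relational form: the witness m need not be chosen as a function of n, it only
    has to determine n. *)
Lemma cnt_image (P G : nat -> Prop) (E : nat -> nat -> Prop) (X Y : nat) :
  (forall n, 0 < n <= X -> P n -> exists m, [/\ 0 < m <= Y, G m & E n m]) ->
  (forall n n' m, E n m -> E n' m -> n = n') -> cnt P X <= cnt G Y.
Proof.
move=> PG inj.
apply: (@leq_trans (\sum_(1 <= n < X.+1) \sum_(1 <= m < Y.+1) `[< G m /\ E n m >])).
  rewrite /cnt [leqLHS]big_nat_cond [leqRHS]big_nat_cond.
  apply: leq_sum => n; rewrite andbT ltnS => nX.
  case: asboolP => // /(PG _ nX)[m [mY Gm Enm]].
  rewrite (bigD1_seq m)/= ?mem_index_iota ?ltnS ?iota_uniq//.
  by case: asboolP => // -[].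
rewrite exchange_big/=; apply: leq_sum => m _.
have [Gm|nGm] := asboolP (G m).
  by apply: cnt_le1 => n n' [_ e] [_ e']; exact: inj e e'.
by rewrite big1// => n _; case: asboolP => // -[].
Qed.

Lemma cnt_leq (k X : nat) : cnt (fun n => n <= k) X <= k.
Proof.
apply: (@leq_trans (cnt (fun=> True) k)).
  by apply: (cnt_image (E := eq)) => [n /andP[n0 _] nk|n n' m -> ->//]; exists n; rewrite n0.
rewrite /cnt; apply: (@leq_trans (\sum_(1 <= n < k.+1) 1)); first by apply: leq_sum => n _; exact: leq_b1.
by rewrite sum_nat_const_nat subn1 muln1.
Qed.

(** The offset n + B - m takes at most 2B + 1 values, and for each of them n is determined by m. *)
Lemma cnt_near (G : nat -> Prop) (B X Y : nat) :
  cnt (fun n => exists m, [/\ 0 < m <= Y, G m, n <= m + B & m <= n + B]) X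
    <= (2 * B).+1 * cnt G Y.
Proof.
pose P i n := exists m, [/\ 0 < m <= Y, G m & n + B = m + i].
apply: leq_trans (cnt_ex (P := P) (c := cnt G Y) _); last first.
  move=> i _; apply: (cnt_image (E := fun n m => n + B = m + i)) => // n n' m.
  by clear; lia.
apply: cnt_mono => n _ [m [mY Gm h1 h2]]; exists (n + B - m); split.
  by clear -h1 h2; lia.
by exists m; split=> //; rewrite subnKC.
Qed.
End Counting.

(** * Pell type equations *)

Section Pell.
Local Open Scope ring_scope.

(* Multiplying the first solution by the unit T + U sqrt(AB) of norm 1 gives the
   second one; the unit is not 1, so T >= 2. *)
Lemma pell_double (A B h r s a b : int) :
  0 < A -> 0 < B -> 0 < h -> 0 < r -> 0 < s -> 0 < a -> 0 <= b ->
  A * r ^+ 2 = B * s ^+ 2 + h -> A * (r + h * a) ^+ 2 = B * (s + h * b) ^+ 2 + h ->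
  2 * r <= r + h * a.
Proof.
move=> A0 B0 h0 r0 s0 a0 b0 e1 e2.
pose R := r + h * a; pose S := s + h * b; rewrite -/R -/S in e2.
have R0 : 0 < R by rewrite addr_gt0// mulr_gt0.
have S0 : 0 < S by rewrite ltr_pwDl// mulr_ge0// ltW.
have lt1 : B * s ^+ 2 < A * r ^+ 2 by rewrite e1 ltrDl.
have lt2 : B * S ^+ 2 < A * R ^+ 2 by rewrite e2 ltrDl.
have cross : B * (s * S) < A * (r * R).
  rewrite -(@ltr_pXn2r _ 2)// ?nnegrE; [|by sgn|by sgn].
  rewrite !exprMn.
  have -> : B ^+ 2 * (s ^+ 2 * S ^+ 2) = (B * s ^+ 2) * (B * S ^+ 2) by ring.
  have -> : A ^+ 2 * (r ^+ 2 * R ^+ 2) = (A * r ^+ 2) * (A * R ^+ 2) by ring.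
  by apply: ltr_pM => //; sgn.
(* Coordinates of the quotient of the two solutions, divided by h; the form r + h a, s + h b of the
   second solution is what makes them integers. *)
pose T := 1 + A * r * a - B * s * b; pose U := r * b - s * a.
have hT : h * T = A * (r * R) - B * (s * S).
  rewrite /T /R /S; have -> : h = A * r ^+ 2 - B * s ^+ 2 by rewrite e1 addrAC subrr add0r.
  by ring.
have hU : h * U = r * S - s * R by rewrite /U /R /S; ring.
have T0 : 0 < T by rewrite -(pmulr_rgt0 _ h0) hT subr_gt0.
(* Brahmagupta's identity for the product of the two forms, divided by h^2. *)
have norm : T ^+ 2 = 1 + A * B * U ^+ 2.
  have h20 : h ^+ 2 != 0 by rewrite expf_neq0// gt_eqF.
  apply: (mulfI h20).
  have -> : h ^+ 2 * T ^+ 2 = (A * (r * R) - B * (s * S)) ^+ 2 by rewrite -hT exprMn.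
  have -> : h ^+ 2 * (1 + A * B * U ^+ 2) = h ^+ 2 + A * B * (r * S - s * R) ^+ 2.
    by rewrite -hU; ring.
  have -> : h ^+ 2 = (A * r ^+ 2 - B * s ^+ 2) * (A * R ^+ 2 - B * S ^+ 2).
    by rewrite e1 e2; ring.
  by ring.
have step : R = T * r + B * U * s.
  have -> : T * r + B * U * s = r + a * (A * r ^+ 2 - B * s ^+ 2) by rewrite /T /U; ring.
  by rewrite e1 /R; ring.
have U0 : 0 < U.
  rewrite -(pmulr_rgt0 _ h0) hU subr_gt0 -subr_gt0.
  have e3 : A * a * (r + R) = B * b * (s + S).
    have hh : h != 0 by rewrite gt_eqF.
    apply: (mulfI hh).
    have -> : h * (A * a * (r + R)) = A * R ^+ 2 - A * r ^+ 2 by rewrite /R; ring.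
    have -> : h * (B * b * (s + S)) = B * S ^+ 2 - B * s ^+ 2 by rewrite /S; ring.
    by rewrite e1 e2; ring.
  (* If U <= 0, that is r b <= s a, then [e3] multiplied by r contradicts the sum of [lt1] and
     [cross]. *)
  rewrite -hU ltNge; apply/negP => hU0.
  have sa : r * b <= s * a by rewrite -subr_le0 -/U -(pmulr_rle0 _ h0).
  have : A * a * (r + R) * r <= B * (s * a) * (s + S).
    rewrite e3; have -> : B * b * (s + S) * r = B * (r * b) * (s + S) by ring.
    apply: ler_wpM2r; first by rewrite addr_ge0// ltW.
    by apply: ler_wpM2l => //; exact: ltW.
  have -> : A * a * (r + R) * r = a * (A * r ^+ 2 + A * (r * R)) by ring.
  have -> : B * (s * a) * (s + S) = a * (B * s ^+ 2 + B * (s * S)) by ring.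
  by rewrite ler_pM2l// leNgt => /negP; apply; exact: ltrD.
have T2 : 2 <= T.
  have U1 : 1 <= U by [].
  have : 1 < T ^+ 2 by rewrite norm ltrDl mulr_gt0 ?mulr_gt0// exprn_gt0.
  by rewrite -[1](expr1n _ 2) ltr_pXn2r ?nnegrE//; exact: ltW.
rewrite -/R step -[leLHS]addr0; apply: lerD.
  by apply: ler_wpM2r => //; exact: ltW.
by rewrite mulr_ge0 ?mulr_ge0// ltW.
Qed.
End Pell.

Section PellCount.
Local Open Scope nat_scope.

Lemma pell_double_nat (A B h r s r2 s2 : nat) :
  0 < A -> 0 < B -> 0 < h -> 0 < r -> 0 < s ->
  A * r ^ 2 = B * s ^ 2 + h -> A * r2 ^ 2 = B * s2 ^ 2 + h -> r < r2 ->
  r = r2 %[mod h] -> s = s2 %[mod h] -> 2 * r <= r2.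
Proof.
move=> A0 B0 h0 r0 s0 e1 e2 rr2 mr ms.
have ss2 : s <= s2.
  have : B * s ^ 2 <= B * s2 ^ 2.
    by rewrite -(leq_add2r h) -e1 -e2 leq_pmul2l// leq_exp2r// ltnW.
  by rewrite leq_pmul2l// leq_exp2r.
have /dvdnP[a ea] : h %| r2 - r by rewrite -(eqn_mod_dvd _ (ltnW rr2)) mr.
have /dvdnP[b eb] : h %| s2 - s by rewrite -(eqn_mod_dvd _ ss2) ms.
have r2e : r2 = r + h * a by rewrite mulnC -ea subnKC// ltnW.
have s2e : s2 = s + h * b by rewrite mulnC -eb subnKC.
have a0 : 0 < a by rewrite r2e -[ltnLHS]addn0 ltn_add2l muln_gt0 in rr2; case/andP: rr2.
have cast (C D c r' s' : nat) : C * r' ^ 2 = D * s' ^ 2 + c ->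
    (C%:Z * r'%:Z ^+ 2 = D%:Z * s'%:Z ^+ 2 + c%:Z)%R.
  by move=> e; move/(congr1 Posz): e; rewrite -!mulnn PoszD !PoszM !expr2.
have := @pell_double A B h r s a b; rewrite r2e s2e in e2.
have e1' := cast _ _ _ _ _ e1; have := cast _ _ _ _ _ e2; rewrite !PoszD !PoszM => e2'.
rewrite !ltz_nat => /(_ A0 B0 h0 r0 s0 a0 isT e1' e2').
by rewrite -PoszM -PoszM -PoszD lez_nat r2e.
Qed.

(* Solutions congruent modulo h at least double, so residues and binary size of r
   determine the solution. *)
Lemma cnt_pell (A B h X : nat) :
  cnt (fun m => exists r s, [/\ [&& 0 < A, 0 < B, 0 < h, 0 < r & 0 < s],
     m = A * r ^ 2 & A * r ^ 2 = B * s ^ 2 + h]) X <= h * (h * (trunc_log 2 X).+1).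
Proof.
pose P i j l m := exists r s, [/\ [&& 0 < A, 0 < B, 0 < h, 0 < r & 0 < s],
   m = A * r ^ 2, A * r ^ 2 = B * s ^ 2 + h & [/\ r %% h = i, s %% h = j & trunc_log 2 r = l]].
apply: (@leq_trans (cnt (fun m => exists i, i < h /\ exists j, j < h /\
    exists l, l < (trunc_log 2 X).+1 /\ P i j l m) X)).
  apply: cnt_mono => m /andP[m0 mX] [r [s [pos me e]]].
  have /and5P[A0 B0 h0 r0 s0] := pos.
  exists (r %% h); split; first by rewrite ltn_mod.
  exists (s %% h); split; first by rewrite ltn_mod.
  exists (trunc_log 2 r); split; last by exists r, s.
  rewrite ltnS leq_trunc_log// (leq_trans _ mX)// me.
  by rewrite (leq_trans _ (leq_pmull _ A0))// -mulnn leq_pmulr.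
apply: cnt_ex => i _; apply: cnt_ex => j _; rewrite -[leqRHS]muln1; apply: cnt_ex => l _.
apply: cnt_le1 => m m' [r [s [pos -> e [ri sj tl]]]] [r' [s' [pos' -> e' [ri' sj' tl']]]].
wlog rr : r s r' s' pos e ri sj tl pos' e' ri' sj' tl' / r <= r' => [W|].
  have [rr|/ltnW rr] := leqP r r'; first exact: (W r s r' s').
  by apply/esym; exact: (W r' s' r s).
move: rr; rewrite leq_eqVlt => /orP[/eqP -> //|rr].
have /and5P[A0 B0 h0 r0 s0] := pos.
have : 2 * r <= r'.
  by apply: (pell_double_nat A0 B0 h0 r0 s0 e e' rr); rewrite ?ri ?ri' ?sj ?sj'.
move=> /(leq_trunc_log 2); rewrite trunc_logMp// tl tl'.
by rewrite ltnn.
Qed.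

(* m is the larger of two nearby integers d s^3 r^2 and d' s'^3 r'^2. *)
Definition pell_near (D S B m : nat) : Prop := exists d d' s s' h r r' : nat,
  [/\ [&& 0 < d <= D, 0 < d' <= D, 0 < s <= S & 0 < s' <= S], 0 < h < B,
      m = d * (s ^ 3 * r ^ 2), m = d' * (s' ^ 3 * r' ^ 2) + h & 0 < r /\ 0 < r'].

Lemma cnt_pell_near (D S B X : nat) :
  cnt (pell_near D S B) X <=
  D.+1 * (D.+1 * (S.+1 * (S.+1 * (B * (B * (B * (trunc_log 2 X).+1)))))).
Proof.
pose P d d' s s' h m := exists r r', [/\ [&& 0 < d * s ^ 3, 0 < d' * s' ^ 3, 0 < h, 0 < r & 0 < r'],
  m = d * s ^ 3 * r ^ 2 & d * s ^ 3 * r ^ 2 = d' * s' ^ 3 * r' ^ 2 + h].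
apply: (@leq_trans (cnt (fun m => exists d, d < D.+1 /\ exists d', d' < D.+1 /\
    exists s, s < S.+1 /\ exists s', s' < S.+1 /\ exists h, h < B /\ P d d' s s' h m) X)).
  apply: cnt_mono => m _ [d [d' [s [s' [h [r [r' [/and4P[dD dD' sS sS'] hB m1 m2 [r0 r0']]]]]]]]].
  case/andP: dD dD' sS sS' hB => d0 dD /andP[d0' dD'] /andP[s0 sS] /andP[s0' sS'] /andP[h0 hB].
  exists d; split=> //; exists d'; split=> //; exists s; split=> //; exists s'; split=> //.
  have p0 : 0 < d * s ^ 3 by rewrite muln_gt0 d0 expn_gt0 s0.
  have p0' : 0 < d' * s' ^ 3 by rewrite muln_gt0 d0' expn_gt0 s0'.
  exists h; split=> //; exists r, r'; rewrite h0 r0 r0' p0 p0'.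
  by rewrite -(mulnA d) -(mulnA d'); split=> //; rewrite -m1.
apply: cnt_ex => d _; apply: cnt_ex => d' _; apply: cnt_ex => s _; apply: cnt_ex => s' _.
apply: cnt_ex => h hB; apply: leq_trans (cnt_pell _ _ _ _) _.
by apply: leq_mul; [exact: ltnW|apply: leq_mul; [exact: ltnW|]].
Qed.
End PellCount.

(** * Numbers with a large cube factor *)

Section LargeCubes.
Variable R : realType.
Local Open Scope ring_scope.

Lemma cnt_le_real (y : R) (X : nat) : 0 <= y ->
  (cnt (fun n => n%:R <= y) X)%:R <= y.
Proof.
move=> y0; apply: le_trans (_ : (Num.truncn y)%:R <= y); last by rewrite truncn_le.
rewrite ler_nat; apply: leq_trans (cnt_leq _ X).
by apply: cnt_mono => n _; rewrite truncn_ge_nat.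
Qed.

Lemma cnt_square_multiples (c X : nat) : (0 < c)%N ->
  (cnt (fun n => exists r, (0 < r)%N /\ n = (c * r ^ 2)%N) X)%:R <= Num.sqrt (X%:R / c%:R) :> R.
Proof.
move=> c0; have cR : 0 < c%:R :> R by rewrite ltr0n.
apply: le_trans (cnt_le_real X (sqrtr_ge0 _)); rewrite ler_nat.
apply: (cnt_image (E := fun n r => n = (c * r ^ 2)%N)); last by move=> n n' m -> ->.
move=> n /andP[n0 nX] [r [r0 e]]; exists r; split=> //.
  rewrite r0 (leq_trans _ nX)// e (leq_trans _ (leq_pmull _ c0))// -mulnn leq_pmulr//.
rewrite -[leLHS]ger0_norm// -sqrtr_sqr ler_wsqrtr// ler_pdivlMr// mulrC -natrX -natrM ler_nat.
by rewrite -e.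
Qed.

(** Telescoping against 2 / sqrt n: with x = sqrt n and y = sqrt (n + 1), the difference 2 / x - 2 /
    y = 2 / (x y (x + y)) is at least y^(-3), because x <= y. *)
Lemma sum_inv_cube_sqrt_le (S n : nat) : (0 < S)%N ->
  \sum_(S.+1 <= s < n.+1) (Num.sqrt (s%:R ^+ 3))^-1 <= 2 / Num.sqrt S%:R :> R.
Proof.
move=> S0; have q0 k : (0 < k)%N -> 0 < Num.sqrt k%:R :> R by move=> k0; rewrite sqrtr_gt0 ltr0n.
have [nS|Sn] := leqP n S; first by rewrite big_geq// divr_ge0// ltW// q0.
suff : \sum_(S.+1 <= s < n.+1) (Num.sqrt (s%:R ^+ 3))^-1 <=
    2 / Num.sqrt S%:R - 2 / Num.sqrt n%:R :> R.
  by move/le_trans; apply; rewrite gerBl divr_ge0// sqrtr_ge0.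
move/ltnW: Sn; elim: n => [|n IH]; first by rewrite leqn0 => /eqP e; rewrite e in S0.
rewrite leq_eqVlt => /orP[/eqP <-|]; first by rewrite big_geq// subrr.
rewrite ltnS => Sn; rewrite big_nat_recr//=.
have n0 : (0 < n)%N by apply: leq_trans Sn.
apply: le_trans (lerD (IH Sn) (lexx _)) _.
rewrite -addrA lerD2l.
pose x : R := Num.sqrt n%:R; pose y : R := Num.sqrt n.+1%:R.
have x0 : 0 < x by exact: q0.
have y0 : 0 < y by exact: q0.
have xy : x <= y by rewrite /x /y ler_wsqrtr// ler_nat.
have x2 : x ^+ 2 = n%:R by rewrite sqr_sqrtr.
have y2 : y ^+ 2 = x ^+ 2 + 1 by rewrite x2 sqr_sqrtr// -natr1.
have -> : Num.sqrt (n.+1%:R ^+ 3) = y ^+ 3 :> R.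
  have -> : n.+1%:R ^+ 3 = (y ^+ 3) ^+ 2 by rewrite -exprM mulnC exprM sqr_sqrtr.
  by rewrite sqrtr_sqr ger0_norm// exprn_ge0// ltW.
rewrite -/x -/y.
have e : 2 / x - 2 / y = 2 / (x * y * (x + y)).
  have -> : 2 / x - 2 / y = 2 * (y - x) / (x * y) by field; rewrite !gt_eqF.
  have yx : (y - x) * (x + y) = 1.
    have -> : (y - x) * (x + y) = y ^+ 2 - x ^+ 2 by ring.
    by rewrite y2; ring.
  have -> : 2 / (x * y * (x + y)) = 2 * ((y - x) * (x + y)) / (x * y * (x + y)) by rewrite yx mulr1.
  by field; rewrite !gt_eqF// addr_gt0.
suff : (y ^+ 3)^-1 <= 2 / x - 2 / y by lra.
rewrite e -[leLHS]mul1r ler_pdivrMr ?exprn_gt0// mulrAC ler_pdivlMr ?mulr_gt0 ?addr_gt0// mul1r.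
have : x * y * (x + y) <= y * y * (y + y).
  apply: ler_pM; [by rewrite mulr_ge0// ltW|by rewrite addr_ge0// ltW| |by rewrite lerD2r].
  by apply: ler_wpM2r => //; exact: ltW.
by rewrite !exprS expr0; move: (x * y * _) => c; lra.
Qed.

Definition large_cube (D S m : nat) : Prop := exists d s r : nat,
  [/\ (0 < d <= D)%N, (S < s)%N, (0 < r)%N & m = (d * (s ^ 3 * r ^ 2))%N].

Lemma cnt_bigcup (P : nat -> nat -> Prop) (a b X : nat) :
  (cnt (fun n => exists i, (a <= i < b)%N /\ P i n) X <= \sum_(a <= i < b) cnt (P i) X)%N.
Proof.
rewrite /cnt exchange_big/=; apply: leq_sum => n _.
case: asboolP => // -[i [iab Pi]].
rewrite (bigD1_seq i)/= ?mem_index_iota ?iota_uniq//.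
by case: asboolP.
Qed.

(** For fixed d and s there are at most sqrt (X / s^3) values of r; the sum of s^(-3/2) beyond S
    gives the factor 2 / sqrt S. *)
Lemma cnt_large_cube (D S X : nat) : (0 < S)%N ->
  (cnt (large_cube D S) X)%:R <= D%:R * (2 * Num.sqrt X%:R / Num.sqrt S%:R) :> R.
Proof.
move=> S0.
pose P s n := exists d, (d < D)%N /\ exists r, (0 < r)%N /\ n = (d.+1 * s ^ 3 * r ^ 2)%N.
apply: (@le_trans _ _ (cnt (fun n => exists s, (S.+1 <= s < X.+1)%N /\ P s n) X)%:R).
  rewrite ler_nat; apply: cnt_mono => n /andP[n0 nX] [[|d] [s [r [//dD Ss r0 e]]]].
  have s0 : (0 < s)%N by apply: leq_ltn_trans Ss.
  exists s; split; last by exists d; split=> //; exists r; rewrite -mulnA.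
  rewrite Ss ltnS (leq_trans _ nX)// e mulSn (leq_trans _ (leq_addr _ _))//.
  rewrite (leq_trans _ (leq_pmulr _ _))// ?expn_gt0 ?r0//.
  by rewrite expnS leq_pmulr// expn_gt0 s0.
apply: (@le_trans _ _ (\sum_(S.+1 <= s < X.+1) cnt (P s) X)%:R).
  by rewrite ler_nat cnt_bigcup.
rewrite natr_sum.
apply: (@le_trans _ _ (\sum_(S.+1 <= s < X.+1) D%:R * (Num.sqrt X%:R * (Num.sqrt (s%:R ^+ 3))^-1))).
  apply: ler_sum_nat => s /andP[Ss _].
  have s0 : (0 < s)%N by apply: leq_ltn_trans Ss.
  (* [cnt_ex] takes a natural number as bound, so the root is rounded down. *)
  pose k := Num.truncn (Num.sqrt X%:R * (Num.sqrt (s%:R ^+ 3))^-1 : R).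
  apply: (@le_trans _ _ (D * k)%N%:R).
    rewrite ler_nat; apply: cnt_ex => d dD.
    have pos : 0 <= Num.sqrt (X%:R / (d.+1 * s ^ 3)%N%:R) :> R by exact: sqrtr_ge0.
    rewrite /k truncn_ge_nat ?mulr_ge0 ?invr_ge0 ?sqrtr_ge0//.
    apply: le_trans (cnt_square_multiples X _) _; first by rewrite muln_gt0 expn_gt0 s0.
    have -> : (Num.sqrt (s%:R ^+ 3))^-1 = Num.sqrt ((s%:R ^+ 3)^-1) :> R by rewrite sqrtrV// exprn_ge0.
    rewrite -sqrtrM// ler_wsqrtr// ler_wpM2l// lef_pV2 ?posrE ?exprn_gt0 ?ltr0n ?muln_gt0 ?expn_gt0 ?s0//.
    by rewrite -natrX ler_nat leq_pmull.
  rewrite natrM; apply: ler_wpM2l => //; rewrite truncn_le.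
  by rewrite mulr_ge0 ?invr_ge0 ?sqrtr_ge0.
rewrite -mulr_sumr -mulr_sumr; apply: ler_wpM2l => //.
rewrite [2 * _]mulrC -mulrA; apply: ler_wpM2l; first exact: sqrtr_ge0.
exact: sum_inv_cube_sqrt_le.
Qed.
End LargeCubes.

(** The element n itself may have a large d; one of the two elements provided by [two_small_srad],
    at distance at most B from n, is counted in its place. *)
Lemma very_bad_cover (N H B S n : nat) : very_bad N H -> (1 < H <= B)%N -> (N < n <= N + H)%N ->
  exists m, [/\ (0 < m <= N + H)%N, large_cube (B ^ 5) S m \/ pell_near (B ^ 5) S B m,
    (n <= m + B)%N & (m <= n + B)%N].
Proof.
move=> vb /andP[H2 HB] In; have [m [m' [Nm' m'm mNH sm sm']]] := two_small_srad N H2.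
have H5 : (H ^ 5 <= B ^ 5)%N by rewrite leq_exp2r.
have Im : (N < m <= N + H)%N by rewrite mNH (ltn_trans Nm').
have Im' : (N < m' <= N + H)%N by rewrite Nm' (leq_trans (ltnW m'm)).
have near k : (N < k <= N + H)%N -> (n <= k + B)%N /\ (k <= n + B)%N.
  by clear -In HB; lia.
have pos k : (N < k <= N + H)%N -> (0 < k <= N + H)%N by clear; lia.
have [d [s [r [d0 s0 dm me]]]] := very_bad_factor vb Im.
have [d' [s' [r' [d0' s0' dm' me']]]] := very_bad_factor vb Im'.
have r0 : (0 < r)%N by case: (r) me Im => // -> /=; rewrite exp0n// !muln0.
have r0' : (0 < r')%N by case: (r') me' Im' => // -> /=; rewrite exp0n// !muln0.
have dB : (0 < d <= B ^ 5)%N by rewrite d0 (leq_trans dm)// (leq_trans sm).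
have dB' : (0 < d' <= B ^ 5)%N by rewrite d0' (leq_trans dm')// (leq_trans sm').
have [sS|Ss] := leqP s S; last first.
  have [n1 n2] := near _ Im; exists m; split; [exact: pos| |done|done].
  by left; exists d, s, r.
have [sS'|Ss'] := leqP s' S; last first.
  have [n1 n2] := near _ Im'; exists m'; split; [exact: pos| |done|done].
  by left; exists d', s', r'.
have [n1 n2] := near _ Im; exists m; split; [exact: pos| |done|done].
right; exists d, d', s, s', (m - m')%N, r, r'; rewrite dB dB' s0 s0' sS sS'; split=> //.
  by rewrite subn_gt0 m'm/=; clear -Nm' mNH HB m'm; lia.
by rewrite -me' subnKC// ltnW.
Qed.

Lemma cnt_very_bad_diff (B X S : nat) :
  (forall N H, (N < X)%N -> very_bad N H -> (H <= B)%N) ->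
  (cnt (VB `\` VB1) X <=
   (2 * B).+1 * (cnt (large_cube (B ^ 5) S) (X + B) + cnt (pell_near (B ^ 5) S B) (X + B)))%N.
Proof.
move=> short; apply: (@leq_trans ((2 * B).+1 * cnt (fun m => large_cube (B ^ 5) S m \/
  pell_near (B ^ 5) S B m) (X + B))); last by rewrite leq_mul2l cnt_or orbT.
apply: leq_trans (cnt_near _ _ X _).
apply: cnt_mono => n /andP[n0 nX] [[N [H [H0 vb In]]] notVB1].
have NX : (N < X)%N by case/andP: In => h _; exact: leq_trans nX.
have HB := short _ _ NX vb.
(* An interval of length 1 is a single powerful number, excluded here; [very_bad_cover] asks for a
   longer one. *)
have H2 : (1 < H)%N.
  rewrite ltn_neqAle H0 andbT; apply/eqP => H1; apply: notVB1; split=> //.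
  move: vb In; rewrite /very_bad -H1 addn1 big_nat1 => vb In.
  by have -> : n = N.+1 by clear -In; lia.
have HB2 : (1 < H <= B)%N by rewrite H2.
have [m [mNH hm n1 n2]] := @very_bad_cover N H B S n vb HB2 In.
exists m; split=> //; case/andP: mNH => -> mNH /=.
by apply: leq_trans mNH _; apply: leq_add => //; exact: ltnW.
Qed.

Lemma trunc_log2_le (R : realType) (B X w K : nat) : (0 < K)%N -> (0 < B)%N -> (0 < X)%N ->
  (X < w.+1 ^ K)%N -> (w < B)%N ->
  ((trunc_log 2 (X + B)).+1%:R : R) <= 9 * K%:R * B%:R.
Proof.
move=> K0 B0 X0 Xw wB.
have B1 : 1 <= B%:R :> R by rewrite ler1n.
have K1 : 1 <= K%:R :> R by rewrite ler1n.
have BP : 0 < B%:R :> R by rewrite ltr0n.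
have /andP[l1 _] := ln2_bounds R.
set L := trunc_log 2 _.
have LX : (2 ^ L <= 2 * B * X)%N.
  apply: leq_trans (trunc_logP _ _) _ => //; first by rewrite addn_gt0 X0.
  by clear -B0 X0; nia.
have : L%:R * ln 2 <= 2 * B%:R + K%:R * B%:R :> R.
  rewrite mulr_natl -lnXn//; apply: (@le_trans _ _ (ln ((2 * B%:R) * B%:R ^+ K))).
    rewrite ler_ln ?posrE ?exprn_gt0 ?mulr_gt0 ?exprn_gt0// -!natrX -!natrM ler_nat.
    apply: leq_trans LX _; rewrite leq_mul2l (leq_trans (ltnW Xw)) ?orbT//.
    by rewrite leq_exp2r.
  rewrite lnM ?posrE ?mulr_gt0 ?exprn_gt0// lnXn//.
  apply: lerD; first by apply/ltW/ln_sublinear; rewrite mulr_gt0.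
  by rewrite -[leLHS]mulr_natl; apply: ler_wpM2l => //; apply/ltW/ln_sublinear.
have h : L%:R * 2^-1 <= L%:R * ln 2 :> R by apply: ler_wpM2l.
have KB : B%:R <= K%:R * B%:R :> R by rewrite ler_peMl// ltW.
rewrite -[L.+1%:R]natr1 -[9 * _ * _]mulrA; move: (L%:R : R) (K%:R * B%:R : R) (_ * ln 2) h KB => l kb c h KB h2.
by lra.
Qed.

(** Very bad intervals with N < X have length at most B, about X^(1/K). With v = X^(1/10) and S
    about v^2, both contributions are v^4 = X^(2/5) up to powers of B: v^5 / sqrt S for the large
    cubes and S^2 for the Pell type equations. *)
Lemma cnt_diff_bound (R : realType) (K : nat) : (0 < K)%N -> exists2 C : R, 0 < C &
  forall X : nat, (0 < X)%N -> (cnt (VB `\` VB1) X)%:R <= C * X%:R `^ (2 / 5 + 15 / K%:R).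
Proof.
move=> K0; have [H0 short] := very_bad_short R K0.
pose h : R := H0%:R + 1.
have h1 : 1 <= h by rewrite /h lerDr.
have KR : 0 < K%:R :> R by rewrite ltr0n.
have c0 : 0 < 9 * 72 * K%:R :> R by rewrite !mulr_gt0.
exists (9 * 72 * K%:R * (2 * h) ^+ 15).
  by rewrite mulr_gt0// exprn_gt0// mulr_gt0// (lt_le_trans _ h1).
move=> X X0; have XR : 1 <= X%:R :> R by rewrite ler1n.
have X0R : 0 < X%:R :> R by rewrite ltr0n.
have [w w0 /andP[]] := @nat_root R K X%:R K0 XR; rewrite -!natrX ler_nat ltr_nat => wX Xw.
have [S S0 /andP[SX XS]] := @nat_root R 5 X%:R isT XR.
(* Lengths below H0 are not controlled by [very_bad_short], so H0 enters B; for H >= H0 the chain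
   H^K < N < X gives H <= w. *)
pose B := (H0 + w).+1.
have B0 : (0 < B)%N by [].
have shortB N H : (N < X)%N -> very_bad N H -> (H <= B)%N.
  move=> NX vb; have [HH|HH] := leqP H0 H; last by rewrite /B; clear -HH; lia.
  have HN := short _ _ HH vb.
  have : (H ^ K < w.+1 ^ K)%N by apply: ltn_trans HN (ltn_trans NX Xw).
  by rewrite ltn_exp2r// ltnS => Hw; rewrite /B; clear -Hw; lia.
pose v : R := X%:R `^ (10%:R^-1).
have v10 : v ^+ 10 = X%:R by rewrite /v -powR_mulrn ?powR_ge0// -powRrM mulVf// powRr1.
have v1 : 1 <= v.
  apply: (@le_trans _ _ (1 `^ 10%:R^-1)); first by rewrite powR1.
  by apply: ge0_ler_powR; rewrite ?nnegrE.
have v0 : 0 < v by apply: lt_le_trans v1.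
have Sv : S%:R <= v ^+ 2.
  rewrite -(@ler_pXn2r _ 5)// ?nnegrE; [|by sgn|by sgn].
  by rewrite -exprM v10.
have vS : v ^+ 2 <= 2 * S%:R.
  apply: (@le_trans _ _ S.+1%:R).
    rewrite -(@ler_pXn2r _ 5)// ?nnegrE; [|by sgn|by sgn].
    by rewrite -exprM v10 ltW.
  by rewrite -(natrM _ 2) ler_nat; clear -S0; lia.
have S1v : S.+1%:R <= 2 * v ^+ 2.
  by rewrite -natr1; have : 1 <= v ^+ 2; [exact: exprn_ege1|lra].
pose b : R := B%:R.
have b1 : 1 <= b by rewrite /b ler1n.
have b0 : 0 < b by apply: lt_le_trans b1.
have bw : b <= 2 * h * w%:R.
  have w1 : 1 <= w%:R :> R by rewrite ler1n.
  have hw : h <= h * w%:R by rewrite ler_peMr// (le_trans _ h1).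
  have hw2 : w%:R <= h * w%:R by rewrite ler_peMl.
  rewrite /b /B -natr1 natrD -mulrA; move: hw hw2; rewrite {1}/h; move: (h * _) => z.
  by lra.
have sqS : v / 2 <= Num.sqrt S%:R.
  rewrite -(@ler_pXn2r _ 2)// ?nnegrE ?sqrtr_ge0//; last by rewrite divr_ge0// ltW.
  by rewrite sqr_sqrtr// expr_div_n; lra.
have sq0 : 0 < Num.sqrt S%:R :> R by rewrite sqrtr_gt0 ltr0n.
have sqX : Num.sqrt (X + B)%N%:R <= 2 * b * v ^+ 5.
  have v50 : 0 <= 2 * b * v ^+ 5 by sgn.
  rewrite -[leRHS]ger0_norm// -sqrtr_sqr ler_wsqrtr// exprMn -exprM v10 natrD -/b.
  apply: (@le_trans _ _ (X%:R * b + X%:R * b)).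
    by apply: lerD; [rewrite ler_peMr// ltW|rewrite ler_peMl// ltW].
  have -> : X%:R * b + X%:R * b = 2 * b * X%:R by ring.
  apply: ler_wpM2r; first exact: ltW.
  by rewrite ler_eXnr//; lra.
have G1 : (cnt (large_cube (B ^ 5) S) (X + B))%:R <= 8 * b ^+ 6 * v ^+ 4.
  apply: le_trans (cnt_large_cube _ _ _ S0) _; rewrite natrX -/b.
  have -> : 8 * b ^+ 6 * v ^+ 4 = b ^+ 5 * (2 * (2 * b * v ^+ 5) / (v / 2)) by field; rewrite gt_eqF.
  apply: ler_wpM2l; first by sgn.
  apply: ler_pM; [by rewrite mulr_ge0|by rewrite invr_ge0 ltW|by apply: ler_wpM2l|].
  by rewrite lef_pV2 ?posrE// divr_gt0.
have G2 : (cnt (pell_near (B ^ 5) S B) (X + B))%:R <= 144 * K%:R * b ^+ 14 * v ^+ 4.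
  have := cnt_pell_near (B ^ 5) S B (X + B); rewrite -(ler_nat R) => /le_trans; apply.
  rewrite !natrM -/b.
  have wB : (w < B)%N by rewrite /B; clear; lia.
  have L9 := @trunc_log2_le R B X w K K0 B0 X0 Xw wB.
  have B5 : (B ^ 5).+1%:R <= 2 * b ^+ 5.
    by rewrite -natr1 natrX -/b; have : 1 <= b ^+ 5; [exact: exprn_ege1|lra].
  apply: (@le_trans _ _ (2 * b ^+ 5 * (2 * b ^+ 5 * (2 * v ^+ 2 * (2 * v ^+ 2 *
     (b * (b * (b * (9 * K%:R * b))))))))).
    by do !apply: ler_pM => //; sgn.
  by rewrite le_eqVlt; apply/orP; left; apply/eqP; ring.
(* Of the 15 factors b, one comes from [cnt_near], ten from the pairs d, d' <= B^5, three from h and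
   the two residues modulo h, one from the logarithm. *)
have tot : (cnt (VB `\` VB1) X)%:R <= 9 * 72 * K%:R * b ^+ 15 * v ^+ 4.
  have := cnt_very_bad_diff S shortB; rewrite -(ler_nat R) natrM natrD => /le_trans; apply.
  apply: (@le_trans _ _ (3 * b * (8 * b ^+ 6 * v ^+ 4 + 144 * K%:R * b ^+ 14 * v ^+ 4))).
    apply: ler_pM => //.
      by rewrite -[(2 * B).+1%:R]natr1 natrM -/b; lra.
    exact: lerD.
  have b614 : 8 * b ^+ 6 <= 8 * K%:R * b ^+ 14.
    rewrite -!mulrA; apply: ler_wpM2l => //; rewrite -[leLHS]mul1r; apply: ler_pM => //; first by sgn.
      by rewrite ler1n.
    exact: ler_weXn2l.
  apply: (@le_trans _ _ (3 * b * (8 * K%:R * b ^+ 14 * v ^+ 4 + 144 * K%:R * b ^+ 14 * v ^+ 4))).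
    apply: ler_wpM2l; first by sgn.
    by rewrite lerD2r; apply: ler_wpM2r => //; sgn.
  have -> : 3 * b * (8 * K%:R * b ^+ 14 * v ^+ 4 + 144 * K%:R * b ^+ 14 * v ^+ 4) =
     456 * (K%:R * b ^+ 15 * v ^+ 4) by ring.
  rewrite -[9 * 72 * _ * _ * _]mulrA -[9 * 72 * _ * _]mulrA [K%:R * (_ * _)]mulrA.
  by apply: ler_wpM2r; [sgn|rewrite -natrM ler_nat].
apply: le_trans tot _.
have v4 : v ^+ 4 = X%:R `^ (2 / 5).
  by rewrite /v -powR_mulrn ?powR_ge0// -powRrM; congr (_ `^ _); field.
have w15 : w%:R ^+ 15 <= X%:R `^ (15 / K%:R) :> R.
  have -> : w%:R ^+ 15 = (w ^ K)%N%:R `^ (15 / K%:R) :> R.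
    rewrite natrX -[w%:R ^+ K]powR_mulrn// -powRrM mulrC divfK ?gt_eqF//.
    by rewrite powR_mulrn.
  by apply: ge0_ler_powR; rewrite ?nnegrE ?divr_ge0// ?ler_nat.
have -> : X%:R `^ (2 / 5 + 15 / K%:R) = X%:R `^ (2 / 5) * X%:R `^ (15 / K%:R) :> R.
  by apply: powRD; rewrite (lt0r_neq0 X0R) implybT.
rewrite -v4; move: (_ `^ _) w15 => p w15.
have -> : 9 * 72 * K%:R * (2 * h) ^+ 15 * (v ^+ 4 * p) = 9 * 72 * K%:R * ((2 * h) ^+ 15 * p) * v ^+ 4.
  by ring.
apply: ler_wpM2r; first by sgn.
apply: ler_wpM2l; first exact: ltW.
apply: (@le_trans _ _ ((2 * h) ^+ 15 * w%:R ^+ 15)).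
  by rewrite -exprMn lerXn2r ?nnegrE ?(ltW b0)// !mulr_ge0// (le_trans _ h1).
by apply: ler_wpM2l => //; rewrite exprn_ge0// mulr_ge0// (le_trans _ h1).
Qed.

(** * Counting powerful numbers *)

Section InjectiveSums.
Variable R : realType.

Lemma ler_sum_inj (I J : eqType) (s : seq I) (r : seq J) (f : I -> J) (F : J -> R) :
  uniq s -> uniq r -> {in s &, injective f} -> (forall x, x \in s -> f x \in r) ->
  (forall y, 0 <= F y) -> \sum_(x <- s) F (f x) <= \sum_(y <- r) F y.
Proof.
move=> us ur inj sub F0; rewrite -(big_map f predT F).
rewrite [leRHS](bigID (fun y => y \in map f s))/=.
rewrite -[leLHS]addr0; apply: lerD; last by apply: sumr_ge0.
rewrite -[leRHS]big_filter le_eqVlt; apply/orP; left; apply/eqP; apply: perm_big.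
apply: uniq_perm; [by rewrite map_inj_in_uniq|by rewrite filter_uniq|].
move=> y; rewrite mem_filter andb_idr// => /mapP[x xs ->].
exact: sub.
Qed.

End InjectiveSums.

(** * The constant zeta(3/2) / zeta(3) *)

Section SquarefreeSum.
Variable R : realType.

(** Partial sums of the Dirichlet series of mu^2 at 3/2, whose value is zeta(3/2) / zeta(3). *)
Definition sqf_sum (M : nat) : R :=
  \sum_(s <- [seq s <- index_iota 1 M.+1 | `[< squarefree s >]]) (s%:R `^ (3 / 2))^-1.

Lemma riemann_seriesE (a : R) (M : nat) :
  series (riemannR a) M = \sum_(n <- index_iota 1 M.+1) (n%:R `^ a)^-1.
Proof. by rewrite /series/= big_add1. Qed.

Lemma powR_three_half (n : nat) : n%:R `^ (3 / 2) = Num.sqrt (n%:R ^+ 3) :> R.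
Proof.
by rewrite -powR12_sqrt ?exprn_ge0// -powR_mulrn// -powRrM.
Qed.

Lemma riemann_32_ge0 (n : nat) : 0 <= (n%:R `^ (3 / 2))^-1 :> R.
Proof. by rewrite invr_ge0 powR_ge0. Qed.

Lemma riemann_series_le3 (M : nat) : series (riemannR (3 / 2)) M <= 3 :> R.
Proof.
rewrite riemann_seriesE; case: M => [|M]; first by rewrite big_geq.
rewrite big_ltn// powR1 invr1.
under eq_bigr do rewrite powR_three_half.
have := @sum_inv_cube_sqrt_le R 1 M.+1 isT; rewrite sqrtr1 divr1.
by move: (\sum_(_ <= _ < _) _) => z; lra.
Qed.

Lemma cvg_partial_sums (u : nat -> R) (B : R) : {homo u : n m / (n <= m)%N >-> n <= m} ->
  (forall n, u n <= B) -> cvgn u.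
Proof.
move=> homo_u uB; apply: nondecreasing_is_cvgn => //.
by exists B => _ [n _ <-].
Qed.

Lemma riemann_series_homo (a : R) : {homo series (riemannR a) : n m / (n <= m)%N >-> n <= m}.
Proof.
by apply/nondecreasing_seqP => n; rewrite /series/= big_nat_recr//= lerDl invr_ge0 powR_ge0.
Qed.

Lemma cvg_riemann_32 : cvgn (series (riemannR (3 / 2 : R))).
Proof. exact: cvg_partial_sums (@riemann_series_homo _) riemann_series_le3. Qed.

Lemma cvg_riemann_3 : cvgn (series (riemannR (3 : R))).
Proof.
apply: (cvg_partial_sums (B := 3)) (@riemann_series_homo _) _ => n.
apply: le_trans (riemann_series_le3 n); apply: ler_sum => k _ /=.
rewrite lef_pV2 ?posrE ?powR_gt0//; apply: ler_powR; last by lra.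
by rewrite ler1n.
Qed.

Lemma sqf_sum_homo : {homo sqf_sum : n m / (n <= m)%N >-> n <= m}.
Proof.
apply/nondecreasing_seqP => n; rewrite /sqf_sum !big_filter [leRHS]big_mkcond [leLHS]big_mkcond.
rewrite [leRHS]big_nat_recr//= lerDl; case: ifP => // _; exact: riemann_32_ge0.
Qed.

Lemma sqf_sum_le3 (M : nat) : sqf_sum M <= 3.
Proof.
apply: le_trans (riemann_series_le3 M); rewrite riemann_seriesE /sqf_sum big_filter big_mkcond.
by apply: ler_sum => s _; case: ifP => // _; exact: riemann_32_ge0.
Qed.

Lemma cvg_sqf_sum : cvgn sqf_sum.
Proof. exact: cvg_partial_sums sqf_sum_homo sqf_sum_le3. Qed.

Let sqfs (M : nat) := [seq s <- index_iota 1 M.+1 | `[< squarefree s >]].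

Lemma mem_sqfs (M s : nat) : s \in sqfs M -> squarefree s /\ (0 < s <= M)%N.
Proof. by rewrite mem_filter mem_index_iota ltnS => /andP[/asboolP]. Qed.

Lemma riemann_square_part (s d : nat) : (0 < s)%N -> (0 < d)%N ->
  ((s * d ^ 2)%N%:R `^ (3 / 2))^-1 = (s%:R `^ (3 / 2))^-1 * (d%:R `^ 3)^-1 :> R.
Proof.
move=> s0 d0; rewrite natrM powRM// natrX -[d%:R ^+ 2]powR_mulrn// -powRrM invfM.
by have -> : 2%:R * (3 / 2) = 3 :> R by rewrite mulrC divfK.
Qed.

(** Multiplying both sides by (s s')^2 gives s^3 (d s')^2 = s'^3 (d' s)^2, where [cube_square_inj]
    applies. *)
Lemma square_part_inj (s d s' d' : nat) : squarefree s -> squarefree s' -> (0 < d)%N -> (0 < d')%N ->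
  (s * d ^ 2 = s' * d' ^ 2)%N -> s = s' /\ d = d'.
Proof.
move=> sf sf' d0 d0' e; have s0 := squarefree_gt0 sf; have s0' := squarefree_gt0 sf'.
have [|||ss dd] := @cube_square_inj s (d * s') s' (d' * s) sf sf'.
- by rewrite muln_gt0 d0.
- by rewrite muln_gt0 d0'.
- have -> : (s ^ 3 * (d * s') ^ 2 = s ^ 2 * s' ^ 2 * (s * d ^ 2))%N by clear; lia.
  by rewrite e; clear; lia.
by split=> //; move/eqP: dd; rewrite ss eqn_pmul2r// => /eqP.
Qed.

(** Each n <= M is s d^2 with s, d <= M, different n give different pairs, and n^(-3/2) factors as
    s^(-3/2) d^(-3). *)
Lemma riemann_le_sqf (M : nat) :
  series (riemannR (3 / 2)) M <= sqf_sum M * series (riemannR 3) M.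
Proof.
have ex (n : nat) : exists p : nat * nat,
    (0 < n)%N -> squarefree p.1 /\ n = (p.1 * p.2 ^ 2)%N.
  have [n0|n0] := posnP n; first by exists (0%N, 0%N); rewrite n0.
  by have [s [d sd]] := squarefree_part n0; exists (s, d).
have [f fP] := choice ex.
rewrite !riemann_seriesE /sqf_sum big_distrlr/= -/(sqfs M).
pose F (p : nat * nat) : R := (p.1%:R `^ (3 / 2))^-1 * (p.2%:R `^ 3)^-1.
have F0 p : 0 <= F p by rewrite mulr_ge0// invr_ge0 powR_ge0.
have d0 n : (0 < n)%N -> (0 < (f n).2)%N.
  move=> n0; have [_ e] := fP n n0; rewrite lt0n; apply/eqP => z.
  by move: n0; rewrite e z exp0n// muln0.
pose r := [seq (s, d) | s <- sqfs M, d <- index_iota 1 M.+1].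
have -> : \sum_(s <- sqfs M) \sum_(d <- index_iota 1 M.+1) (s%:R `^ (3 / 2))^-1 * (d%:R `^ 3)^-1 =
    \sum_(p <- r) F p by rewrite /r big_allpairs_dep.
apply: (@le_trans _ _ (\sum_(n <- index_iota 1 M.+1) F (f n))).
  rewrite big_nat_cond [leRHS]big_nat_cond; apply: ler_sum => n /andP[/andP[n0 _] _].
  have [sf e] := fP n n0; rewrite {1}e riemann_square_part ?d0//.
  exact: squarefree_gt0.
apply: ler_sum_inj => //.
- exact: iota_uniq.
- apply: allpairs_uniq; [by rewrite filter_uniq// iota_uniq|exact: iota_uniq|].
  by move=> [a b] [a' b'] _ _ /= [-> ->].
- move=> n n'; rewrite !mem_index_iota => /andP[n0 _] /andP[n0' _] e.
  by have [_ ->] := fP n n0; have [_ ->] := fP n' n0'; rewrite e.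
move=> n; rewrite mem_index_iota ltnS => /andP[n0 nM].
have [sf e] := fP n n0; have s0 := squarefree_gt0 sf.
rewrite (surjective_pairing (f n)); apply: allpairs_f.
  rewrite mem_filter mem_index_iota ltnS s0/=; apply/andP; split; first exact/asboolP.
  by rewrite (leq_trans _ nM)// {2}e leq_pmulr// expn_gt0 d0.
rewrite mem_index_iota ltnS d0//= (leq_trans _ nM)// {2}e (leq_trans _ (leq_pmull _ s0))//.
by rewrite -mulnn leq_pmulr// d0.
Qed.

(** Conversely s, d <= M gives s d^2 <= M^3, and these products are distinct; together the two
    comparisons determine the limit. *)
Lemma sqf_le_riemann (M : nat) :
  sqf_sum M * series (riemannR 3) M <= series (riemannR (3 / 2)) (M ^ 3)%N.
Proof.
rewrite !riemann_seriesE /sqf_sum big_distrlr/= -/(sqfs M).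
pose r := [seq (s, d) | s <- sqfs M, d <- index_iota 1 M.+1].
pose f (p : nat * nat) := (p.1 * p.2 ^ 2)%N.
have rP p : p \in r -> [/\ squarefree p.1, (0 < p.1 <= M)%N & (0 < p.2 <= M)%N].
  move=> /allpairsP[[s d] /= [/mem_sqfs[sf sM]]]; rewrite mem_index_iota ltnS => dM ->.
  by split.
apply: (@le_trans _ _ (\sum_(p <- r) ((f p)%:R `^ (3 / 2))^-1)).
  rewrite /r big_allpairs_dep/= big_seq [leRHS]big_seq.
  apply: ler_sum => s /mem_sqfs[sf /andP[s0 _]].
  rewrite big_nat_cond [leRHS]big_nat_cond; apply: ler_sum => d /andP[/andP[d0 _] _].
  by rewrite /f riemann_square_part.
apply: (ler_sum_inj (F := fun n => (n%:R `^ (3 / 2))^-1)).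
- apply: allpairs_uniq; [by rewrite filter_uniq// iota_uniq|exact: iota_uniq|].
  by move=> [a b] [a' b'] _ _ /= [-> ->].
- exact: iota_uniq.
- move=> [s d] [s' d'] /rP/= [sf _ /andP[d0 _]] /rP/= [sf' _ /andP[d0' _]] /= e.
  by have [-> ->] := square_part_inj sf sf' d0 d0' e.
- move=> [s d] /rP/= [_ /andP[s0 sM] /andP[d0 dM]].
  rewrite mem_index_iota ltnS muln_gt0 s0 expn_gt0 d0/= expnS.
  by apply: leq_mul => //; rewrite leq_exp2r.
by move=> n; exact: riemann_32_ge0.
Qed.

Lemma zeta_sqf : zeta (3 / 2) = limn sqf_sum * zeta 3 :> R.
Proof.
have cvgM : (fun M => sqf_sum M * series (riemannR 3) M) @ \oo --> limn sqf_sum * zeta 3.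
  exact: cvgM cvg_sqf_sum cvg_riemann_3.
apply/eqP; rewrite eq_le; apply/andP; split.
  rewrite -(cvg_lim _ cvgM)//; apply: ler_lim; [exact: cvg_riemann_32|by apply/cvg_ex; eexists; exact: cvgM|].
  by apply: nearW => M; exact: riemann_le_sqf.
rewrite -(cvg_lim _ cvgM)//; apply: limr_le; first by apply/cvg_ex; eexists; exact: cvgM.
apply: nearW => M; apply: le_trans (sqf_le_riemann M) _.
by apply: nondecreasing_cvgn_le; [exact: riemann_series_homo|exact: cvg_riemann_32].
Qed.

Lemma zeta3_gt0 : 0 < zeta 3 :> R.
Proof.
apply: (@lt_le_trans _ _ (series (riemannR 3) 1)).
  by rewrite riemann_seriesE big_nat1 powR1 invr1.
by apply: nondecreasing_cvgn_le; [exact: riemann_series_homo|exact: cvg_riemann_3].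
Qed.

Lemma limn_sqf_gt0 : 0 < limn sqf_sum.
Proof.
apply: (@lt_le_trans _ _ (sqf_sum 1)); last first.
  by apply: nondecreasing_cvgn_le; [exact: sqf_sum_homo|exact: cvg_sqf_sum].
rewrite /sqf_sum big_filter big_mkcond big_nat1 powR1 invr1; case: ifP => // /asboolP[] p pp.
by apply/negP => /dvdn_leq => /(_ isT); rewrite leqNgt -{1}(exp1n 2) ltn_exp2r// prime_gt1.
Qed.
End SquarefreeSum.

Section PowerfulCount.
Variable R : realType.

Lemma cnt_natrE (P : nat -> Prop) (X : nat) :
  (cnt P X)%:R = \sum_(n <- index_iota 1 X.+1) (`[< P n >])%:R :> R.
Proof. by rewrite /cnt natr_sum. Qed.

Lemma powerful_part_count_le (s X : nat) : (0 < s)%N ->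
  (cnt (fun n => exists r, (0 < r)%N /\ n = (s ^ 3 * r ^ 2)%N) X)%:R <=
  Num.sqrt X%:R * (s%:R `^ (3 / 2))^-1 :> R.
Proof.
move=> s0; apply: le_trans (cnt_square_multiples R X _) _; first by rewrite expn_gt0 s0.
by rewrite powR_three_half -sqrtrV ?exprn_ge0// -sqrtrM// natrX.
Qed.

Lemma cnt_powerful_le (X : nat) :
  (cnt VB1 X)%:R <= Num.sqrt X%:R * limn (sqf_sum R) :> R.
Proof.
apply: (@le_trans _ _ (Num.sqrt X%:R * sqf_sum R X)); last first.
  apply: ler_wpM2l; first exact: sqrtr_ge0.
  by apply: nondecreasing_cvgn_le; [exact: sqf_sum_homo|exact: cvg_sqf_sum].
pose P s n := squarefree s /\ exists r, (0 < r)%N /\ n = (s ^ 3 * r ^ 2)%N.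
apply: (@le_trans _ _ (\sum_(1 <= s < X.+1) cnt (P s) X)%:R).
  rewrite ler_nat; apply: leq_trans (cnt_bigcup P 1 X.+1 X).
  apply: cnt_mono => n /andP[n0 nX] [_ /(powerful_cube_square n0)[s [r [sf e]]]].
  have s0 := squarefree_gt0 sf.
  have r0 : (0 < r)%N.
    by rewrite lt0n; apply/eqP => r0; move: n0; rewrite e r0 exp0n// muln0.
  exists s; split; last by split=> //; exists r.
  rewrite s0 ltnS (leq_trans _ nX)// e (leq_trans _ (leq_pmulr _ _))// ?expn_gt0 ?r0//.
  by rewrite expnS leq_pmulr// expn_gt0 s0.
rewrite natr_sum /sqf_sum big_filter mulr_sumr [leRHS]big_mkcond big_nat_cond [leRHS]big_nat_cond.
apply: ler_sum => s /andP[/andP[s0 _] _]; case: asboolP => sf.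
  apply: le_trans (powerful_part_count_le X s0).
  by rewrite ler_nat; apply: cnt_mono => n _ [].
rewrite [cnt _ _](_ : _ = 0%N)//; apply/eqP; rewrite -leqn0.
by rewrite /cnt big1// => n _; case: asboolP => // -[].
Qed.

(** For each squarefree s <= M, the r up to sqrt X / s^(3/2) give distinct powerful numbers s^3 r^2
    <= X; rounding this bound down loses at most 1 for each s, M in all. *)
Lemma cnt_powerful_ge (M X : nat) :
  Num.sqrt X%:R * sqf_sum R M - M%:R <= (cnt VB1 X)%:R.
Proof.
pose sq := [seq s <- index_iota 1 M.+1 | `[< squarefree s >]].
pose w s : R := Num.sqrt X%:R * (s%:R `^ (3 / 2))^-1.
pose k s := Num.truncn (w s).
have w0 s : 0 <= w s by rewrite mulr_ge0 ?sqrtr_ge0// riemann_32_ge0.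
pose r := [seq (s, d) | s <- sq, d <- index_iota 1 (k s).+1].
pose f (p : nat * nat) := (p.1 ^ 3 * p.2 ^ 2)%N.
pose F (n : nat) : R := (`[< VB1 n >])%:R.
have rP p : p \in r -> [/\ squarefree p.1, (0 < p.1)%N & (0 < p.2 <= k p.1)%N].
  move=> /allpairsPdep[s [d []]]; rewrite mem_filter !mem_index_iota !ltnS.
  by move=> /andP[/asboolP sf _] dk ->; split=> //; exact: squarefree_gt0.
have fF p : p \in r -> F (f p) = 1.
  move=> /rP[_ s0 /andP[d0 _]]; rewrite /F; case: asboolP => // -[].
  by split; [rewrite muln_gt0 !expn_gt0 s0 d0|exact: cube_square_powerful].
apply: (@le_trans _ _ (\sum_(p <- r) F (f p))).
  rewrite (eq_big_seq _ fF) /r big_allpairs_dep/=.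
  apply: (@le_trans _ _ (\sum_(s <- sq) (w s - 1))).
    rewrite big_split/= -mulr_sumr -/sq lerD2l sumrN lerN2.
    rewrite big_const_seq iter_addr_0 ler_nat count_predT size_filter.
    by rewrite (leq_trans (count_size _ _))// size_iota subn1.
  apply: ler_sum => s _; rewrite big_const_seq iter_addr_0 count_predT size_iota subn1/=.
  by rewrite lerBlDr natr1 ltW// truncnS_gt.
rewrite cnt_natrE; apply: ler_sum_inj.
- apply: allpairs_uniq_dep => [|s _|[s d] [s' d'] _ _ /= [-> ->]//].
    by rewrite filter_uniq// iota_uniq.
  exact: iota_uniq.
- exact: iota_uniq.
- move=> [s d] [s' d'] /rP/= [sf _ /andP[d0 _]] /rP/= [sf' _ /andP[d0' _]] e.
  by have [-> ->] := cube_square_inj sf sf' d0 d0' e.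
- move=> [s d] /rP/= [sf s0 /andP[d0 dk]].
  rewrite mem_index_iota ltnS muln_gt0 !expn_gt0 s0 d0/=.
  have : d%:R <= w s by rewrite -truncn_ge_nat.
  rewrite /w powR_three_half => h; have s30 : 0 < s%:R ^+ 3 :> R by rewrite exprn_gt0// ltr0n.
  have q0 : 0 < Num.sqrt (s%:R ^+ 3) :> R by rewrite sqrtr_gt0.
  move: h; rewrite ler_pdivlMr// => h.
  have : (d%:R * Num.sqrt (s%:R ^+ 3)) ^+ 2 <= Num.sqrt X%:R ^+ 2 :> R.
    by rewrite lerXn2r ?nnegrE ?mulr_ge0 ?sqrtr_ge0.
  by rewrite exprMn !sqr_sqrtr ?(ltW s30)// -!natrX -natrM ler_nat mulnC.
by move=> n; rewrite /F.
Qed.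

Lemma cnt_powerful_asymp (eps : R) : 0 < eps -> exists x0 : R, forall x : R, x0 <= x ->
  `|(cnt VB1 (Num.truncn x))%:R - limn (sqf_sum R) * Num.sqrt x| <= eps * Num.sqrt x.
Proof.
move=> eps0; set c := limn _.
have c0 : 0 < c by exact: limn_sqf_gt0.
have [M hM] : exists M, c - eps / 2 <= sqf_sum R M.
  have e2 : 0 < eps / 2 by rewrite divr_gt0.
  have /cvgrPdist_le/(_ _ e2)[M _ hM] := @cvg_sqf_sum R.
  by exists M; have := hM M (leqnn M); rewrite -/c ler_distl => /andP[]; lra.
(* From this point on c + M is at most (eps / 2) sqrt x: c pays for passing from x to its integer
   part, M for the truncations. *)
exists (Num.max 1 (((c + M%:R) * 2 / eps) ^+ 2)) => x; rewrite ge_max => /andP[x1 xB].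
have x0 : 0 <= x by apply: le_trans x1.
set X := Num.truncn x.
have Xx : X%:R <= x by rewrite truncn_le.
have xX : x < X.+1%:R by exact: truncnS_gt.
have sXx : Num.sqrt X%:R <= Num.sqrt x by apply: ler_wsqrtr.
have sx : Num.sqrt x - 1 <= Num.sqrt X%:R.
  rewrite lerBlDr -[leRHS]ger0_norm; last by rewrite addr_ge0// sqrtr_ge0.
  rewrite -sqrtr_sqr ler_wsqrtr// (le_trans (ltW xX))// -natr1 sqrrD1 sqr_sqrtr//.
  by rewrite -addrA lerD2l lerDr mulrn_wge0// sqrtr_ge0.
have big : c + M%:R <= eps / 2 * Num.sqrt x.
  have -> : c + M%:R = eps / 2 * ((c + M%:R) * 2 / eps) by field; rewrite gt_eqF.
  apply: ler_wpM2l; first by rewrite divr_ge0// ltW.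
  have p0 : 0 <= (c + M%:R) * 2 / eps.
    by rewrite divr_ge0 ?(ltW eps0)// mulr_ge0// addr_ge0// ltW.
  by rewrite -[leLHS]ger0_norm// -sqrtr_sqr ler_wsqrtr.
have up := cnt_powerful_le X; have lo := cnt_powerful_ge M X; rewrite -/c in up.
have sM : sqf_sum R M <= c.
  by apply: nondecreasing_cvgn_le; [exact: sqf_sum_homo|exact: cvg_sqf_sum].
have sM0 : 0 <= sqf_sum R M by apply: sumr_ge0 => s _; exact: riemann_32_ge0.
have h1 : Num.sqrt X%:R * c <= Num.sqrt x * c by apply: ler_wpM2r => //; exact: ltW.
have h2 : (Num.sqrt x - 1) * sqf_sum R M <= Num.sqrt X%:R * sqf_sum R M by apply: ler_wpM2r.
have h3 : Num.sqrt x * (c - eps / 2) <= Num.sqrt x * sqf_sum R M.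
  by apply: ler_wpM2l => //; exact: sqrtr_ge0.
have ex : 0 <= eps * Num.sqrt x by rewrite mulr_ge0 ?sqrtr_ge0// ltW.
rewrite ler_norml; move: h1 h2 h3 big up lo ex; rewrite mulrBl mul1r mulrBr.
have -> : eps / 2 * Num.sqrt x = eps * Num.sqrt x / 2 by ring.
have -> : Num.sqrt x * (eps / 2) = eps * Num.sqrt x / 2 by ring.
rewrite [Num.sqrt x * c]mulrC.
move: (_ * sqf_sum R M) (Num.sqrt x * sqf_sum R M) (Num.sqrt X%:R * c) (c * _) (eps * _) => a b d e g.
move=> h1 h2 h3 big up lo ex; apply/andP; split; lra.
Qed.

Lemma counting_funE (A : set nat) (x : R) : 0 <= x ->
  counting_fun A x = (cnt A (Num.truncn x))%:R.
Proof.
move=> x0; rewrite /counting_fun; congr (_%:R).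
pose s := [seq n <- index_iota 1 (Num.truncn x).+1 | `[< A n >]].
have e : A `&` [set n : nat | 1 <= (n%:R : R) <= x] = [set` s].
  apply/seteqP; split=> n /=.
    move=> [An /andP[n1 nx]]; rewrite mem_filter mem_index_iota ltnS truncn_ge_nat//.
    by rewrite nx -(ler_nat R) n1 !andbT; exact/asboolP.
  rewrite mem_filter mem_index_iota ltnS truncn_ge_nat// => /andP[/asboolP An /andP[n1 nx]].
  by split=> //; rewrite nx ler1n n1.
have -> : fset_set (A `&` [set n : nat | 1 <= (n%:R : R) <= x]) = [fset n in s]%fset.
  apply/fsetP => n; rewrite e in_fset_set ?inE//=.
  by apply/idP/idP; rewrite inE.
rewrite card_fseq undup_id ?filter_uniq ?iota_uniq// size_filter /cnt.
by rewrite -sum1_count big_mkcond/=; apply: eq_bigr => n _; case: (`[< A n >]).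
Qed.
End PowerfulCount.

(** * Passage to the limit *)

Section FinalEstimates.
Variable R : realType.

Lemma powR_ge_of (C d x : R) : 0 < d -> 0 <= C -> C `^ d^-1 <= x -> C <= x `^ d.
Proof.
move=> d0 C0 Cx; rewrite -[leLHS](powRr1 C0) -[X in C `^ X](mulVf (lt0r_neq0 d0)) powRrM.
apply: ge0_ler_powR; rewrite ?nnegrE ?powR_ge0 ?(ltW d0)//.
by apply: le_trans Cx; exact: powR_ge0.
Qed.

(** K is taken above 30 / eps, so 15 / K is at most eps / 2; the other half of eps absorbs the
    constant. The summand 1 will keep a logarithm meaningful when the count is 0. *)
Lemma cnt_diff_le_powR (eps : R) : 0 < eps -> exists x0 : R, forall x : R, x0 <= x ->
  (cnt (VB `\` VB1) (Num.truncn x))%:R + 1 <= x `^ (2 / 5 + eps).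
Proof.
move=> eps0; pose K := (Num.truncn (30 / eps)).+1.
have KR : 0 < K%:R :> R by rewrite ltr0n.
have Keps : 15 / K%:R <= eps / 2.
  rewrite ler_pdivrMr//; have /ltW : 30 / eps < K%:R by exact: truncnS_gt.
  by rewrite ler_pdivrMr//; move: (eps) (K%:R : R) => u v; nra.
have [C C0 hC] := @cnt_diff_bound R K isT.
have e2 : 0 < eps / 2 by rewrite divr_gt0.
exists (Num.max 1 ((C + 1) `^ (eps / 2)^-1)) => x; rewrite ge_max => /andP[x1 xC].
have x0 : 0 < x by apply: lt_le_trans x1.
have X1 : (0 < Num.truncn x)%N by rewrite truncn_ge_nat// ltW.
have a0 : 0 <= 2 / 5 + 15 / K%:R :> R by rewrite addr_ge0// divr_ge0.
set a := (2 / 5 + 15 / K%:R) in hC a0.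
have xa1 : 1 <= x `^ a by rewrite -(powRr0 x); apply: ler_powR.
have big : C + 1 <= x `^ (eps / 2).
  by apply: powR_ge_of => //; rewrite addr_ge0// ltW.
apply: (@le_trans _ _ ((C + 1) * x `^ a)).
  rewrite mulrDl mul1r; apply: lerD => //; apply: le_trans (hC _ X1) _.
  apply: ler_wpM2l; first exact: ltW.
  by apply: ge0_ler_powR; rewrite ?nnegrE ?truncn_le// ltW.
apply: (@le_trans _ _ (x `^ (eps / 2) * x `^ (2 / 5 + eps / 2))).
  apply: ler_pM => //; [by rewrite addr_ge0// ltW|exact: powR_ge0|].
  by apply: ler_powR => //; rewrite /a lerD2l.
rewrite -powRD; last by rewrite (lt0r_neq0 x0) implybT.
by rewrite le_eqVlt; apply/orP; left; apply/eqP; congr (_ `^ _); field.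
Qed.

Lemma cnt_diff_le_sqrt (eps : R) : 0 < eps -> exists x0 : R, forall x : R, x0 <= x ->
  (cnt (VB `\` VB1) (Num.truncn x))%:R <= eps * Num.sqrt x.
Proof.
(* 2/5 + 1/20 + 1/20 = 1/2: one 1/20 is spent on the exponent, the other one beats 1 / eps. *)
move=> eps0; have t0 : 0 < 20^-1 :> R by rewrite invr_gt0.
have [x0 h] := cnt_diff_le_powR t0.
exists (Num.max 1 (Num.max x0 (eps^-1 `^ (20^-1)^-1))) => x.
rewrite !ge_max => /and3P[x1 /h hx xe].
have xp : 0 < x by apply: lt_le_trans x1.
have big : eps^-1 <= x `^ 20^-1 by apply: powR_ge_of => //; rewrite invr_ge0 ltW.
have -> : Num.sqrt x = x `^ (2 / 5 + 20^-1) * x `^ 20^-1.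
  rewrite -powRD; last by rewrite (lt0r_neq0 xp) implybT.
  by rewrite -powR12_sqrt ?(ltW xp)//; congr (_ `^ _); field.
apply: (@le_trans _ _ (x `^ (2 / 5 + 20^-1))); first by lra.
rewrite mulrCA -[leLHS]mulr1; apply: ler_wpM2l; first exact: powR_ge0.
by rewrite -(ler_pM2l eps0) mulfV ?gt_eqF// in big.
Qed.

Lemma cnt_VB_split (X : nat) :
  (cnt VB1 X <= cnt VB X <= cnt VB1 X + cnt (VB `\` VB1) X)%N.
Proof.
apply/andP; split.
  apply: cnt_mono => n /andP[n0 _] [_ pn]; exists n.-1, 1%N; split=> //.
    by rewrite /very_bad addn1 big_nat1 prednK.
  by rewrite prednK// addn1 prednK// leqnn.
apply: leq_trans (cnt_or _ _ _); apply: cnt_mono => n _ nVB.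
by have [n1|n1] := pselect (VB1 n); [left|right].
Qed.

End FinalEstimates.

Theorem theorem1p8 (R : realType) :
  [/\ exists2 e : R -> R, e x @[x --> +oo] --> 0 &
        (counting_fun (VB `\` VB1) : R -> R)
          =O_+oo (fun x : R => x `^ (2 / 5 + e x)),
      (counting_fun VB : R -> R) ~_+oo (counting_fun VB1 : R -> R) &
      (counting_fun VB : R -> R)
        ~_+oo (fun x : R => zeta (3 / 2) / zeta 3 * Num.sqrt x)].
Proof.
have zetaE : zeta (3 / 2) / zeta 3 = limn (sqf_sum R) :> R.
  by rewrite zeta_sqf mulfK// gt_eqF// zeta3_gt0.
rewrite zetaE; set c := limn _; have c0 : 0 < c by exact: limn_sqf_gt0.
split.
- pose D (x : R) : R := counting_fun (VB `\` VB1) x.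
  (* The exponent that the count really requires, cut off below at 0: the bound then holds with
     constant 1 for x >= 2, and the convergence to 0 only needs an upper estimate. *)
  pose e (x : R) := Num.max 0 (ln (D x + 1) / ln x - 2 / 5).
  have D0 x : 0 <= D x by rewrite /D /counting_fun.
  have lnx (x : R) : 2 <= x -> 0 < ln x by move=> x2; rewrite ln_gt0//; lra.
  exists e.
    apply/cvgrPdist_le => eps eps0; have [x0 hx0] := cnt_diff_le_powR eps0.
    exists (Num.max 2 x0); split; first exact: num_real.
    move=> x /ltW; rewrite ge_max => /andP[x2 /hx0].
    have xp : 0 < x by lra.
    rewrite -counting_funE ?(ltW xp)// -/(D x) => hx.
    rewrite sub0r normrN ger0_norm /e ?le_max ?lexx// ge_max (ltW eps0)/=.
    rewrite lerBlDl ler_pdivrMr ?lnx// -ln_powR.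
    by rewrite ler_ln ?posrE ?powR_gt0// ltr_wpDl.
  apply/eqO_exP; exists 1 => //; exists 2; split; first exact: num_real.
  move=> x /ltW x2; have xp : 0 < x by lra.
  rewrite mul1r !ger0_norm ?powR_ge0// -/(D x); apply: (@le_trans _ _ (D x + 1)); first by rewrite lerDl.
  rewrite -ler_ln ?posrE ?powR_gt0 ?ltr_wpDl// ln_powR -ler_pdivrMr ?lnx//.
  by rewrite -lerBlDl /e le_max lexx orbT.
- apply/eqaddoP => eps eps0.
  (* The powerful numbers up to x eventually number at least (c / 2) sqrt x, hence this
     tolerance. *)
  have ec : 0 < eps * (c / 2) by rewrite mulr_gt0// divr_gt0.
  have [x1 h1] := cnt_diff_le_sqrt ec.
  have [|x2 h2] := @cnt_powerful_asymp R (c / 2); first by rewrite divr_gt0.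
  exists (Num.max 0 (Num.max x1 x2)); split; first exact: num_real.
  move=> x /ltW; rewrite !ge_max => /and3P[x0 /h1 hd /h2].
  rewrite -/c ler_distl => /andP[hlo _].
  have /andP[] := cnt_VB_split (Num.truncn x); rewrite -!(ler_nat R) natrD => v1 v2.
  change (`|counting_fun VB x - counting_fun VB1 x| <= eps * `|counting_fun VB1 x|).
  rewrite !counting_funE// [X in _ * X]ger0_norm// ger0_norm ?subr_ge0//.
  apply: (@le_trans _ _ (eps * (c / 2 * Num.sqrt x))); first by rewrite mulrA; lra.
  apply: ler_wpM2l; first exact: ltW.
  move: hlo; have -> : c / 2 * Num.sqrt x = c * Num.sqrt x / 2 by ring.
  by move: (c * _) => u; lra.
apply/eqaddoP => eps eps0.
have ec : 0 < eps * c / 2 by rewrite divr_gt0// mulr_gt0.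
have [x1 h1] := cnt_diff_le_sqrt ec; have [x2 h2] := cnt_powerful_asymp ec.
exists (Num.max 0 (Num.max x1 x2)); split; first exact: num_real.
move=> x /ltW; rewrite !ge_max => /and3P[x0 /h1 hd /h2 ha].
have /andP[] := cnt_VB_split (Num.truncn x); rewrite -!(ler_nat R) natrD => v1 v2.
change (`|counting_fun VB x - c * Num.sqrt x| <= eps * `|c * Num.sqrt x|).
rewrite counting_funE// [X in _ <= _ * X]ger0_norm; last by rewrite mulr_ge0 ?sqrtr_ge0// ltW.
rewrite -/c in ha; move: hd ha; rewrite !ler_norml [eps * (c * _)]mulrA.
have -> : eps * c / 2 * Num.sqrt x = eps * c * Num.sqrt x / 2 by ring.
move: (c * _) (eps * c * _) => u v hd /andP[lo hi]; apply/andP; split; lra.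
Qed.
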